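(* Given a $\mathbb{Q}$-weighted automaton $\mathcal{A}$, one can check in polynomial time whether $\mathcal{A}$ is an IFA.
   Context: A $\mathbb{Q}$-weighted automaton $\mathcal{A} = (Q, \Sigma, M, \alpha, \eta)$ consists of a finite set of states $Q$, a finite alphabet $\Sigma$, a map $M : \Sigma \to \mathbb{Q}^{Q \times Q}$, an initial row vector $\alpha \in \mathbb{Q}^Q$ and a final column vector $\eta \in \mathbb{Q}^Q$ (rationals given in binary). $M$ is extended to $\Sigma^*$ by $M(a_1\cdots a_k) = M(a_1)\cdots M(a_k)$, and $L_\mathcal{A}(w) = \alpha M(w)\eta$. $\mathcal{A}$ is an IFA (image-binary finite automaton) if $L_\mathcal{A}(w) \in \{0,1\}$ for all $w \in \Sigma^*$. *)

(* Defs.v *)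
From HB Require Import structures.
From mathcomp Require Import all_boot all_order all_algebra.
Set Implicit Arguments. Unset Strict Implicit. Unset Printing Implicit Defensive.
Import Order.TTheory GRing.Theory Num.Theory.
Local Open Scope ring_scope.

(* States Q = 'I_n, alphabet Sigma = 'I_k (any finite set, up to renaming). *)
Record wautomaton := WAutomaton {
  wa_n : nat;
  wa_k : nat;
  wa_M : 'I_wa_k -> 'M[rat]_wa_n;
  wa_alpha : 'rV[rat]_wa_n;
  wa_eta : 'cV[rat]_wa_n
}.
Arguments wa_M : clear implicits.
Arguments wa_alpha : clear implicits.
Arguments wa_eta : clear implicits.

Definition wa_Mw (A : wautomaton) (w : seq 'I_(wa_k A)) : 'M[rat]_(wa_n A) :=
  foldr (fun a P => wa_M A a *m P) 1%:M w.
Arguments wa_Mw : clear implicits.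

Definition wa_L (A : wautomaton) (w : seq 'I_(wa_k A)) : rat :=
  (wa_alpha A *m wa_Mw A w *m wa_eta A) 0 0.
Arguments wa_L : clear implicits.

Definition is_IFA (A : wautomaton) : Prop :=
  forall w : seq 'I_(wa_k A), wa_L A w = 0 \/ wa_L A w = 1.

Inductive sym := S0 | S1 | Sep.

Fixpoint binf (fuel n : nat) : seq sym :=
  match fuel with
  | 0 => [::]
  | f.+1 => if n == 0%N then [::] else (if odd n then S1 else S0) :: binf f n./2
  end.
(* little-endian binary representation of n (empty for 0) *)
Definition bin (n : nat) : seq sym := binf n n.

Definition enc_int (z : int) : seq sym :=
  match z with Posz n => S0 :: bin n | Negz n => S1 :: bin n.+1 end.

Definition enc_rat (q : rat) : seq sym :=
  enc_int (numq q) ++ Sep :: enc_int (denq q) ++ [:: Sep].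

Definition encode (A : wautomaton) : seq sym :=
  bin (wa_n A) ++ Sep :: bin (wa_k A) ++ Sep ::
  flatten [seq flatten [seq flatten [seq enc_rat (wa_M A a i j)
                                      | j <- enum 'I_(wa_n A)]
                         | i <- enum 'I_(wa_n A)]
           | a <- enum 'I_(wa_k A)]
  ++ flatten [seq enc_rat (wa_alpha A 0 j) | j <- enum 'I_(wa_n A)]
  ++ flatten [seq enc_rat (wa_eta A i 0) | i <- enum 'I_(wa_n A)].

Inductive move := MLeft | MRight | MStay.

(* States 'I_(nQ.+3): 0 = start, 1 = accept, 2 = reject (halting).
   Tape symbols 'I_(nG.+4): 0 = blank, 1,2,3 = input symbols S0,S1,Sep. *)
Record TM := MkTM {
  tm_nQ : nat;
  tm_nG : nat;
  tm_delta : 'I_tm_nQ.+3 -> 'I_tm_nG.+4 -> 'I_tm_nQ.+3 * 'I_tm_nG.+4 * move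
}.
Arguments tm_delta : clear implicits.

Definition tm_start (M : TM) : 'I_(tm_nQ M).+3 := inord 0.
Definition tm_acc (M : TM) : 'I_(tm_nQ M).+3 := inord 1.
Definition tm_rej (M : TM) : 'I_(tm_nQ M).+3 := inord 2.
Definition tm_blank (M : TM) : 'I_(tm_nG M).+4 := inord 0.

Definition sym_code (M : TM) (s : sym) : 'I_(tm_nG M).+4 :=
  match s with S0 => inord 1 | S1 => inord 2 | Sep => inord 3 end.

(* configuration: state, tape left of head (nearest first), head symbol,
   tape right of head (nearest first); unlisted cells are blank *)
Record config (M : TM) := Config {
  cf_state : 'I_(tm_nQ M).+3;
  cf_left : seq 'I_(tm_nG M).+4;
  cf_head : 'I_(tm_nG M).+4;
  cf_right : seq 'I_(tm_nG M).+4
}.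

Definition tm_step (M : TM) (c : config M) : config M :=
  let q := cf_state c in
  if (q == tm_acc M) || (q == tm_rej M) then c else
  let: (q', g, m) := tm_delta M q (cf_head c) in
  match m with
  | MStay => Config q' (cf_left c) g (cf_right c)
  | MLeft =>
      match cf_left c with
      | [::] => Config q' [::] (tm_blank M) (g :: cf_right c)
      | h :: l => Config q' l h (g :: cf_right c)
      end
  | MRight =>
      match cf_right c with
      | [::] => Config q' (g :: cf_left c) (tm_blank M) [::]
      | h :: r => Config q' (g :: cf_left c) h r
      end
  end.

Definition tm_init (M : TM) (x : seq sym) : config M :=
  match map (sym_code M) x with
  | [::] => Config (tm_start M) [::] (tm_blank M) [::]
  | h :: r => Config (tm_start M) [::] h r
  end.

Definition tm_run (M : TM) (t : nat) (x : seq sym) : config M :=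
  iter t (@tm_step M) (tm_init M x).

(* Main.v *)
Require Import Defs.
From mathcomp Require Import all_boot all_order all_algebra.
From mathcomp Require Import zify ring.
Set Implicit Arguments. Unset Strict Implicit. Unset Printing Implicit Defensive.

(* For words of length [i], being 0 or 1 on all of them is a single equation:
   the sum over [w] of [(L w * (L w - 1))^2] vanishes.  Since [L * (L - 1)] is
   linear in the tensor square of the vector [(alpha M(w), 1)], it suffices to
   test [i < (n+1)^2].  The sum is the contraction of a fourth tensor power,
   which is computed letter by letter by applying a matrix to the first index
   and moving this index to the end.  After multiplication by the common
   denominator everything is an integer of polynomial bit length, so it can be
   computed in two's complement, i.e. modulo [2^W] for a polynomial [W], using
   additions and multiplications only.
   A one-tape machine performs this by sweeps over its tape: registers are
   markers on the tape cells, memory consists of tracks of bits, and one sweep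
   executes one instruction.  Loops whose bounds are registers not modified in
   their bodies take polynomial time. *)

(** * Turing machines executing marker programs *)

(** The squares prevent cancellation, since [L * (L - 1)] is negative for [0 < L < 1]; they double
    the two tensor factors to four. Summing over exponentially many words is cheap: the sum of the
    fourth tensor powers over words of length [i + 1] is the image of the sum for length [i] under
    one linear map, the sum over the letters of the fourth tensor powers of their matrices. Moving
    the treated index to the end makes each use of a matrix the same operation, and four of them
    restore the order; with a matrix of one column or one row it contracts with a vector or forms an
    outer product. A basis of the reachable space would need pivots and divisions. Here nothing is
    divided: an entry is scaled by multiplying its numerator by the denominators of all other
    entries. Only vanishing is tested, so residues modulo [2 ^ W] suffice once the sums are below
    [2 ^ W] in absolute value; [W = (L + 1) ^ 8] is enough for inputs of length [L]. The price of
    loops with fixed bounds is that no loop can be left early: a task that is done sooner idles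
    until the counter reaches its limit. *)

Record store := Store { reg : nat -> nat; mem : nat -> nat -> bool }.

Definition upd (T : Type) (f : nat -> T) (i : nat) (v : T) : nat -> T :=
  fun x => if x == i then v else f x.

Definition set_reg (s : store) r v := Store (upd (reg s) r v) (mem s).
Definition set_bit (s : store) t p b :=
  Store (reg s) (upd (mem s) t (upd (mem s t) p b)).

Inductive instr :=
  | IInc of nat
  | IZero of nat
  | IMov of nat & nat
  | IWr of nat & nat & bool
  | IBit of nat & nat & nat
  | IEq of nat & nat & nat
  | IJmp of nat
  | IHalt of bool.

Definition exec1 (i : instr) (s : store) : store :=
  match i with
  | IInc r => set_reg s r (reg s r).+1
  | IZero r => set_reg s r 0
  | IMov r r' => set_reg s r (reg s r')
  | IWr t r b => set_bit s t (reg s r) b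
  | _ => s
  end.

Definition jump (i : instr) (s : store) (pc : nat) : nat :=
  match i with
  | IBit t r l => if mem s t (reg s r) then pc.+1 else l
  | IEq r r' l => if reg s r == reg s r' then pc.+1 else l
  | IJmp l => l
  | IHalt _ => pc
  | _ => pc.+1
  end.

Definition fetch (code : seq instr) pc := nth (IHalt false) code pc.

Definition flat_step (code : seq instr) (c : nat * store) : nat * store :=
  (jump (fetch code c.1) c.2 c.1, exec1 (fetch code c.1) c.2).

Definition instr_in (K T P : nat) (i : instr) : bool :=
  match i with
  | IInc r | IZero r => r < K
  | IMov r r' => (r < K) && (r' < K)
  | IWr t r _ => (t < T) && (r < K)
  | IBit t r l => [&& t < T, r < K & l < P]
  | IEq r r' l => [&& r < K, r' < K & l < P]
  | IJmp l => l < P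
  | IHalt _ => true
  end.

(* [S1] is a mark on track 0 and [Sep] a mark on track 1; register 0 holds the
   input length. *)
Definition init_store (x : seq sym) : store :=
  Store (fun r => if r == 0 then size x else 0)
        (fun t p => match nth S0 x p with
                    | S0 => false | S1 => t == 0 | Sep => t == 1 end).

(** * The sweeping machine: tape alphabet, states, transitions *)

Section Machine.
Variables (K T : nat) (code : seq instr).
Hypothesis code_gt0 : 0 < size code.
Hypothesis code_in : all (instr_in K T (size code)) code.
Hypothesis code_end : exists b, fetch code (size code).-1 = IHalt b.

(* A tape cell records which registers point at it and its bit on each track. *)
Definition cell : finType := (K.-tuple bool * T.-tuple bool)%type.
Definition mkcell (f g : nat -> bool) : cell :=
  ([tuple f i | i < K], [tuple g i | i < T]).
Definition marks (c : cell) : nat -> bool := nth false c.1.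
Definition bits (c : cell) : nat -> bool := nth false c.2.

Lemma marks_mkcell f g r : r < K -> marks (mkcell f g) r = f r.
Proof. by move=> rK; rewrite /marks (nth_mktuple f false (Ordinal rK)). Qed.

Lemma bits_mkcell f g t : t < T -> bits (mkcell f g) t = g t.
Proof. by move=> tT; rewrite /bits (nth_mktuple g false (Ordinal tT)). Qed.

Lemma eq_mkcell f g f' g' :
  (forall r, r < K -> f r = f' r) -> (forall t, t < T -> g t = g' t) ->
  mkcell f g = mkcell f' g'.
Proof.
by move=> ff gg; congr (_, _); apply: eq_mktuple => i;
  [apply: ff | apply: gg]; apply: ltn_ord.
Qed.

(** [None] converts the input into cells. [Some (pc, None)] walks back to the blank left of the
    tape, and [Some (pc, Some st)] sweeps to the right, executing instruction [pc] with one bit [st]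
    of memory. *)
Definition state : finType := option ('I_(size code) * option bool).

(** The machine model reserves the first three states and the first four symbols, hence the offsets
    3 and 4. In the start state [decQ] returns [None], which tells [delta] that the head is on the
    first cell. *)
Definition codeQ (q : state) : 'I_(#|state|.+3) := inord (3 + enum_rank q).
Definition decQ (i : 'I_(#|state|.+3)) : option state :=
  if i < 3 then None else omap enum_val (insub (i - 3) : option 'I_#|state|).
Definition codeG (c : cell) : 'I_(#|cell|.+4) := inord (4 + enum_rank c).
Definition decG (i : 'I_(#|cell|.+4)) : option cell :=
  if i < 4 then None else omap enum_val (insub (i - 4) : option 'I_#|cell|).

Lemma codeQE q : codeQ q = 3 + enum_rank q :> nat.
Proof. by rewrite inordK // addnC !addnS addn0 !ltnS. Qed.
Lemma codeGE c : codeG c = 4 + enum_rank c :> nat.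
Proof. by rewrite inordK // addnC !addnS addn0 !ltnS. Qed.

Lemma codeQK q : decQ (codeQ q) = Some q.
Proof.
by rewrite /decQ codeQE ltnNge leq_addr /= addKn valK /= enum_rankK.
Qed.
Lemma codeGK c : decG (codeG c) = Some c.
Proof.
by rewrite /decG codeGE ltnNge leq_addr /= addKn valK /= enum_rankK.
Qed.

Definition pcQ (pc : nat) (ph : option bool) : state :=
  omap (fun i => (i, ph)) (insub pc : option 'I_(size code)).

(* One instruction is a letter-to-letter transduction of the tape. *)
Definition sweep (i : instr) (st : bool) (c : cell) : bool * cell :=
  match i with
  | IInc r => (marks c r, mkcell (upd (marks c) r st) (bits c))
  | IZero r => (true, mkcell (upd (marks c) r (~~ st)) (bits c))
  | IMov r r' => (false, mkcell (upd (marks c) r (marks c r')) (bits c))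
  | IWr t r b =>
      (false, mkcell (marks c) (upd (bits c) t (if marks c r then b else bits c t)))
  | IBit t r _ => (st || marks c r && bits c t, c)
  | IEq r r' _ => (st || marks c r && marks c r', c)
  | _ => (false, c)
  end.

Definition sweep_jump (i : instr) (st : bool) (pc : nat) : nat :=
  match i with
  | IBit _ _ l | IEq _ _ l => if st then pc.+1 else l
  | IJmp l => l
  | IHalt _ => pc
  | _ => pc.+1
  end.

Definition blank : 'I_(#|cell|.+4) := inord 0.

(* A register pushed past the last cell makes the tape one cell longer. *)
Definition sweep_end (i : instr) (st : bool) : 'I_(#|cell|.+4) :=
  match i with
  | IInc r => if st then codeG (mkcell (pred1 r) pred0) else blank
  | _ => blank
  end.

(** All registers except 0 start with value 0, so their marks lie on the first cell. The mark of
    register 0 is placed on the blank that ends the input, when the conversion reaches it. *)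
Definition raw_cell (first : bool) (g : 'I_(#|cell|.+4)) : cell :=
  mkcell (fun r => first && (r != 0))
         (fun t => (g == 2 :> nat) && (t == 0) || (g == 3 :> nat) && (t == 1)).

Definition delta (q : 'I_(#|state|.+3)) (g : 'I_(#|cell|.+4)) :=
  match decQ q with
  | None => (codeQ None, codeG (raw_cell true g), MRight)
  | Some None =>
      if g == blank then (codeQ (pcQ 0 None), codeG (mkcell (pred1 0) pred0), MLeft)
      else (q, codeG (raw_cell false g), MRight)
  | Some (Some (pc, Some st)) =>
      let i := fetch code pc in
      match decG g with
      | Some c => let: (st', c') := sweep i st c in
                  (codeQ (Some (pc, Some st')), codeG c', MRight)
      | None => (codeQ (pcQ (sweep_jump i st pc) None), sweep_end i st, MLeft)
      end
  | Some (Some (pc, None)) =>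
      match decG g with
      | Some c => (q, g, MLeft)
      | None =>
          match fetch code pc with
          | IHalt b => (inord (if b then 1 else 2), g, MStay)
          | _ => (codeQ (Some (pc, Some false)), g, MRight)
          end
      end
  end.

Definition sweeper : TM := @MkTM #|state| #|cell| delta.
Notation M := sweeper.

Lemma codeQ_nhalt q : (codeQ q == tm_acc M) || (codeQ q == tm_rej M) = false.
Proof. by rewrite -!val_eqE /= codeQE !inordK. Qed.

Lemma codeG_nblank c : codeG c == blank = false.
Proof. by rewrite -val_eqE /= codeGE !inordK. Qed.

Lemma decG_blank : decG blank = None.
Proof. by rewrite /decG inordK. Qed.

Definition mkconf q l (xs : seq 'I_(#|cell|.+4)) : config M :=
  match xs with
  | [::] => @Config M q l blank [::]
  | h :: r => @Config M q l h r
  end.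

Arguments mkconf : simpl never.

Lemma step_right q q' g l x xs :
  (q == tm_acc M) || (q == tm_rej M) = false ->
  delta q x = (q', g, MRight) ->
  tm_step (mkconf q l (x :: xs)) = mkconf q' (g :: l) xs.
Proof. by rewrite /tm_step /mkconf /= => -> ->; case: xs. Qed.

Lemma step_left q q' g l xs :
  (q == tm_acc M) || (q == tm_rej M) = false ->
  delta q (head blank xs) = (q', g, MLeft) ->
  tm_step (mkconf q l xs) =
  mkconf q' (behead l) (head blank l :: g :: behead xs).
Proof.
by rewrite /tm_step /mkconf; case: xs => [|x xs] /= -> ->; case: l.
Qed.

Lemma step_stay q q' g l x xs :
  (q == tm_acc M) || (q == tm_rej M) = false ->
  delta q x = (q', g, MStay) ->
  tm_step (mkconf q l (x :: xs)) = mkconf q' l (g :: xs).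
Proof. by rewrite /tm_step /mkconf /= => -> ->. Qed.

(** * Correctness of a sweep and of a round trip *)

Definition cell_of (s : store) (p : nat) : cell :=
  mkcell (fun r => reg s r == p) (fun t => mem s t p).
Definition tape (s : store) (N : nat) := mkseq (fun p => codeG (cell_of s p)) N.

Definition fits (s : store) (N : nat) :=
  (forall r, r < K -> reg s r < N) /\ (forall t p, t < T -> N <= p -> mem s t p = false).

(** Closed form of the bit carried into cell [p]. An increment carries the mark from the previous
    cell, [IZero] only distinguishes the first cell, and the tests remember whether they have
    succeeded on the left. *)
Definition sweep_state (i : instr) (s : store) (p : nat) : bool :=
  match i with
  | IInc r => p == (reg s r).+1
  | IZero r => p != 0
  | IBit t r _ => (reg s r < p) && mem s t (reg s r)
  | IEq r r' _ => (reg s r < p) && (reg s r == reg s r')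
  | _ => false
  end.

Lemma sweepP i s p : instr_in K T (size code) i ->
  sweep i (sweep_state i s p) (cell_of s p) =
  (sweep_state i s p.+1, cell_of (exec1 i s) p).
Proof.
case: i => [r|r|r r'|t r b|t r l|r r' l|l|b] //=.
- move=> rK; rewrite marks_mkcell // eqSS; congr (_, _); first by rewrite eq_sym.
  apply: eq_mkcell => [r' r'K|t tT]; last by rewrite bits_mkcell.
  by rewrite /= /upd; case: (r' =P r) => _; [rewrite eq_sym | rewrite marks_mkcell].
- move=> rK; congr (_, _).
  apply: eq_mkcell => [r' r'K|t tT]; last by rewrite bits_mkcell.
  by rewrite /= /upd; case: (r' =P r) => _; [rewrite negbK eq_sym | rewrite marks_mkcell].
- case/andP=> rK r'K; congr (_, _).
  apply: eq_mkcell => [r'' r''K|t tT]; last by rewrite bits_mkcell.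
  by rewrite /= /upd; case: (r'' =P r) => _; rewrite marks_mkcell.
- case/andP=> tT rK; congr (_, _).
  apply: eq_mkcell => [r'' r''K|t' t'T]; first by rewrite marks_mkcell.
  rewrite /= /upd; case: (t' =P t) => [_|_]; last by rewrite bits_mkcell.
  by rewrite marks_mkcell // bits_mkcell //= eq_sym.
- case/and3P=> tT rK _; congr (_, _).
  rewrite marks_mkcell // bits_mkcell // ltnS [in RHS]leq_eqVlt.
  by case: (reg s r =P p) => [->|_]; rewrite ?ltnn //= orbF.
- case/and3P=> rK r'K _; congr (_, _).
  rewrite !marks_mkcell // ltnS [in RHS]leq_eqVlt.
  by case: (reg s r =P p) => [->|_]; rewrite ?ltnn //= ?orbF // eq_sym.
Qed.

Lemma sweep_state0 i s : sweep_state i s 0 = false.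
Proof. by case: i. Qed.

Lemma sweep_jumpP i s pc N : instr_in K T (size code) i -> fits s N ->
  sweep_jump i (sweep_state i s N) pc = jump i s pc.
Proof.
case: i => [r|r|r r'|t r b|t r l|r r' l|l|b] //=.
- by case/and3P=> tT rK lP [/(_ _ rK) -> _].
- by case/and3P=> rK r'K lP [/(_ _ rK) -> _].
Qed.

Lemma pcQE pc (pcP : pc < size code) ph : pcQ pc ph = Some (Ordinal pcP, ph).
Proof. by rewrite /pcQ insubT. Qed.

Lemma iter_add1 n (c : config M) : iter n.+1 (@tm_step M) c = iter n (@tm_step M) (tm_step c).
Proof. by rewrite iterSr. Qed.

Lemma fetch_in pc : pc < size code -> instr_in K T (size code) (fetch code pc).
Proof. by move=> pcP; apply: (all_nthP _ code_in). Qed.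

Lemma forward_pass pc (pcP : pc < size code) s : let i := fetch code pc in
  forall n p l ys, iter n (@tm_step M)
    (mkconf (codeQ (pcQ pc (Some (sweep_state i s p)))) l
       ([seq codeG (cell_of s p) | p <- iota p n] ++ ys)) =
  mkconf (codeQ (pcQ pc (Some (sweep_state i s (p + n)))))
    (rev [seq codeG (cell_of (exec1 i s) p) | p <- iota p n] ++ l) ys.
Proof.
move=> i; elim=> [|n IH] p l ys; first by rewrite addn0.
rewrite iter_add1 /=.
rewrite (@step_right _ (codeQ (pcQ pc (Some (sweep_state i s p.+1))))
           (codeG (cell_of (exec1 i s) p))) ?codeQ_nhalt //; last first.
  rewrite /delta codeQK !(pcQE pcP) codeGK /=.
  by rewrite -/i sweepP //; apply: fetch_in.
by rewrite IH rev_cons cat_rcons addSnnS.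
Qed.

Lemma backward_pass pc (pcP : pc < size code) (cs : seq cell) : forall l c ys,
  iter (size cs).+1 (@tm_step M)
    (mkconf (codeQ (pcQ pc None)) (rev [seq codeG c | c <- cs] ++ l) (codeG c :: ys)) =
  mkconf (codeQ (pcQ pc None)) (behead l)
    (head blank l :: [seq codeG c | c <- rcons cs c] ++ ys).
Proof.
elim/last_ind: cs => [|cs c' IH] l c ys.
  rewrite iter_add1 (@step_left _ (codeQ (pcQ pc None)) (codeG c)) ?codeQ_nhalt //.
  by rewrite /delta codeQK (pcQE pcP) codeGK.
rewrite size_rcons iter_add1 (@step_left _ (codeQ (pcQ pc None)) (codeG c)) ?codeQ_nhalt //.
  by rewrite map_rcons rev_rcons cat_cons [head _ _]/= [behead _]/= IH !map_rcons -!cats1 -!catA.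
by rewrite /delta codeQK (pcQE pcP) codeGK.
Qed.

(** The lists of a configuration are not normalized: [z] counts blanks listed explicitly after the
    last cell, and [l] is whatever is listed beyond the blank on the left. *)
Definition at_rest pc s N z l : config M :=
  mkconf (codeQ (pcQ pc None)) l (blank :: tape s N ++ nseq z blank).

Definition grows (i : instr) (st : bool) : bool := if i is IInc _ then st else false.

Lemma fits_exec1 i s N : instr_in K T (size code) i -> fits s N -> 0 < N ->
  fits (exec1 i s) (N + grows i (sweep_state i s N)).
Proof.
case: i => [r|r|r r'|t r b|t r l|r r' l|l|b] //=; rewrite ?addn0 //.
- move=> rK [f1 f2] N0; split=> [r' r'K|t p tT Np] /=; last first.
    by apply: f2 => //; apply: leq_trans Np; apply: leq_addr.
  rewrite /upd; case: eqP => _.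
    by have := f1 r rK; lia.
  by have := f1 r' r'K; lia.
- move=> rK [f1 f2] N0; split=> [r' r'K|t p tT Np] /=; last exact: f2.
  by rewrite /= /upd; case: eqP => // _; apply: f1.
- case/andP=> rK r'K [f1 f2] N0; split=> [r'' r''K|t p tT Np] /=; last exact: f2.
  by rewrite /= /upd; case: eqP => // _; apply: f1.
- case/andP=> tT rK [f1 f2] N0; split=> [r' r'K|t' p t'T Np] /=; first exact: f1.
  rewrite /upd; case: eqP => [_|_]; last exact: f2.
  case: eqP => [pE|_]; last exact: f2.
  by have := f1 r rK; rewrite -pE; lia.
Qed.

Lemma jump_lt pc s : pc < size code ->
  let i := fetch code pc in (forall b, i <> IHalt b) -> jump i s pc < size code.
Proof.
move=> pcP i nh.
have iin : instr_in K T (size code) i by apply: fetch_in.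
(* The last instruction halts, so an instruction that does not halt has a successor to fall through
   to. *)
have pcS : pc.+1 < size code.
  rewrite ltn_neqAle pcP andbT; apply/eqP => pcE.
  have [b] := code_end; rewrite -pcE /= => E; exact: (nh b).
move: iin nh; rewrite /jump.
case: i => [r|r|r r'|t r b|t r l|r r' l|l|b] //=.
- by case/and3P=> _ _ lP _; case: ifP.
- by case/and3P=> _ _ lP _; case: ifP.
Qed.

Lemma round pc s N z l : pc < size code -> fits s N -> 0 < N ->
  let i := fetch code pc in (forall b, i <> IHalt b) ->
  exists t N' z' l', [/\ t <= 2 * N + 4, N' <= N.+1, fits (exec1 i s) N', 0 < N' &
    iter t (@tm_step M) (at_rest pc s N z l) =
    at_rest (jump i s pc) (exec1 i s) N' z' l'].
Proof.
move=> pcP fsN N0 i nh.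
have iin : instr_in K T (size code) i by apply: fetch_in.
have jP : jump i s pc < size code by apply: jump_lt.
have start : tm_step (at_rest pc s N z l) =
    mkconf (codeQ (pcQ pc (Some (sweep_state i s 0)))) (blank :: l)
      ([seq codeG (cell_of s p) | p <- iota 0 N] ++ nseq z blank).
  rewrite (@step_right _ (codeQ (pcQ pc (Some false))) blank) ?codeQ_nhalt //.
    by rewrite sweep_state0.
  rewrite /delta codeQK !(pcQE pcP) decG_blank /=.
  by case Ei: (fetch code pc) => [r|r|r r'|t r b|t r lb|r r' lb|lb|b] //; case: (nh b).
have turn (y := sweep_end i (sweep_state i s N)) :
    iter N.+2 (@tm_step M) (at_rest pc s N z l) =
    mkconf (codeQ (pcQ (jump i s pc) None))
      (behead (rev (tape (exec1 i s) N) ++ blank :: l))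
      (head blank (rev (tape (exec1 i s) N) ++ blank :: l) :: y :: nseq z.-1 blank).
  rewrite iter_add1 start iterS forward_pass // add0n.
  rewrite (@step_left _ (codeQ (pcQ (jump i s pc) None)) y) ?codeQ_nhalt //.
    by case: (z).
  rewrite /delta codeQK (pcQE pcP).
  have -> : head blank (nseq z blank) = blank by case: (z).
  by rewrite decG_blank -/i sweep_jumpP.
case: N N0 fsN turn start => // N _ fsN turn start.
have splitT s' n : tape s' n.+1 = rcons (tape s' n) (codeG (cell_of s' n)).
  by rewrite /tape mkseqS.
have back ys :
    iter N.+1 (@tm_step M) (mkconf (codeQ (pcQ (jump i s pc) None))
      (behead (rev (tape (exec1 i s) N.+1) ++ blank :: l))
      (head blank (rev (tape (exec1 i s) N.+1) ++ blank :: l) :: ys)) =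
    mkconf (codeQ (pcQ (jump i s pc) None)) l
      (blank :: tape (exec1 i s) N.+1 ++ ys).
  rewrite splitT rev_rcons /=.
  have := @backward_pass _ jP (mkseq (cell_of (exec1 i s)) N) (blank :: l)
    (cell_of (exec1 i s) N) ys.
  by rewrite size_mkseq map_rcons /= /mkseq -map_comp.
have fin := fits_exec1 iin fsN (ltn0Sn N).
exists (N.+1 + N.+3), (N.+1 + grows i (sweep_state i s N.+1)).
(* The turn at the right end consumes one listed blank, if there is any, and writes one symbol,
   which is either a blank or a new cell. *)
exists (if sweep_end i (sweep_state i s N.+1) == blank then z.-1.+1 else z.-1), l.
split=> //; first by lia.
- by case: grows; lia.
rewrite iterD turn back /at_rest.
have [y0|[r Ei Es]] : sweep_end i (sweep_state i s N.+1) = blank /\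
    grows i (sweep_state i s N.+1) = false \/
    exists2 r, i = IInc r & sweep_state i s N.+1.
  case: (i) => [r|r|r r'|t r b|t r lb|r r' lb|lb|b] /=; try by left.
  by case: eqP; [right; exists r | left].
- by case: y0 => -> ->; rewrite eqxx addn0.
rewrite Ei /= in iin.
have -> : sweep_end i (sweep_state i s N.+1) = codeG (cell_of (exec1 i s) N.+1).
  rewrite Es Ei /=; congr codeG; have [f1 f2] := fsN.
  apply: eq_mkcell => [r' r'K|t tT] /=; last by rewrite f2.
  have /eqP NE : N.+1 == (reg s r).+1 by move: Es; rewrite Ei.
  rewrite /= /upd -NE; case: (r' =P r) => [_|_] /=; first by rewrite eqxx.
  by have := f1 r' r'K; case: eqP => // ->; rewrite ltnn.
rewrite codeG_nblank Es Ei -cat_rcons -splitT [grows _ _]/= addn1.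
by [].
Qed.

Lemma halted c : (cf_state c == tm_acc M) || (cf_state c == tm_rej M) ->
  forall n, iter n (@tm_step M) c = c.
Proof. by move=> h; elim=> // n IH; rewrite iterS IH /tm_step h. Qed.

Lemma halt_step pc s N z l b : pc < size code -> fetch code pc = IHalt b ->
  cf_state (tm_step (at_rest pc s N z l)) = if b then tm_acc M else tm_rej M.
Proof.
move=> pcP E; rewrite (@step_stay _ (if b then tm_acc M else tm_rej M) blank) ?codeQ_nhalt //.
by rewrite /delta codeQK (pcQE pcP) decG_blank /= E; case: b {E}.
Qed.

(** The tape grows by at most one cell per instruction, so all [k] rounds take place on at most
    [N + k] cells. A halting instruction is a fixed point of [flat_step], which covers runs that
    halt before [k] instructions. *)
Lemma rounds k : forall pc s N z l, pc < size code -> fits s N -> 0 < N ->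
  forall pc' s' b, iter k (flat_step code) (pc, s) = (pc', s') ->
  fetch code pc' = IHalt b ->
  exists2 t, t <= k * (2 * (N + k) + 4) + 1 &
    cf_state (iter t (@tm_step M) (at_rest pc s N z l)) = if b then tm_acc M else tm_rej M.
Proof.
elim: k => [|k IH] pc s N z l pcP fsN N0 pc' s' b E Eh.
  by exists 1 => //; apply: halt_step => //; case: E => ->.
have [[b' Eb]|nh] : (exists b', fetch code pc = IHalt b') \/ (forall b, fetch code pc <> IHalt b).
  by case: (fetch code pc) => [r|r|r r'|t r b'|t r lb|r r' lb|lb|b']; do [by right => ? | by left; exists b'].
  have Ek : iter k (flat_step code) (pc, s) = (pc', s').
    by rewrite -E iterSr /flat_step /= Eb.
  have [t tk Et] := IH pc s N z l pcP fsN N0 _ _ _ Ek Eh.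
  by exists t => //; apply: (leq_trans tk); nia.
have [t [N' [z' [l' [tN N'N fs' N'0 Et]]]]] := round z l pcP fsN N0 nh.
rewrite iterSr in E.
have [t' tk Et'] := IH _ _ _ z' l' (jump_lt s pcP nh) fs' N'0 _ _ _ E Eh.
by exists (t' + t); [nia | rewrite iterD Et].
Qed.

(** * Conversion of the input and the complete run *)

Lemma sym_codeE y : sym_code M y = (match y with S0 => 1 | S1 => 2 | Sep => 3 end) :> nat.
Proof. by case: y; rewrite /= inordK. Qed.

Lemma raw_cellE x p first : p < size x -> first = (p == 0) ->
  raw_cell first (sym_code M (nth S0 x p)) = cell_of (init_store x) p.
Proof.
move=> px ->; apply: eq_mkcell => [r rK|t tT] /=.
  case: (r =P 0) => [_|_] /=; last by rewrite andbT eq_sym.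
  by rewrite andbF; apply/esym/eqP; lia.
by rewrite sym_codeE; case: (nth S0 x p) => //=; rewrite ?orbF ?andbT.
Qed.

(** One pass to the right converts the symbols and appends the cell that carries the mark of
    register 0; the way back ends on the blank left of the tape. On the empty input the start state
    would turn a blank into a cell, and register 0 would become 1. *)
Lemma init_pass x : x <> [::] ->
  iter (size x + (size x).+1) (@tm_step M) (tm_init M x) =
  at_rest 0 (init_store x) (size x).+1 0 [::].
Proof.
move=> x0; set s := init_store x; have n0 : 0 < size x by case: x x0 {s}.
have conv : forall n, n < size x -> iter n.+1 (@tm_step M) (tm_init M x) =
    mkconf (codeQ None) (rev (tape s n.+1)) [seq sym_code M y | y <- drop n.+1 x].
  elim=> [|n IH] nx.
    have -> : tm_init M x = mkconf (tm_start M) [::]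
        (sym_code M (nth S0 x 0) :: [seq sym_code M y | y <- drop 1 x]).
      by rewrite -map_cons -drop_nth ?drop0 // /tm_init; case: (x).
    rewrite /=.
    rewrite (@step_right _ (codeQ None) (codeG (cell_of s 0))) //.
      by rewrite -!val_eqE /= !inordK.
    rewrite /delta /tm_start /decQ inordK //=.
    by rewrite raw_cellE.
  rewrite iterS IH ?(ltnW nx) // (drop_nth S0 nx) map_cons.
  rewrite (@step_right _ (codeQ None) (codeG (cell_of s n.+1))) ?codeQ_nhalt //.
    by rewrite [in RHS]/tape mkseqS rev_rcons.
  rewrite /delta codeQK.
  have -> : sym_code M (nth S0 x n.+1) == blank = false.
    by rewrite -val_eqE /= sym_codeE inordK //; case: nth.
  by rewrite raw_cellE.
have turn : iter (size x).+1 (@tm_step M) (tm_init M x) =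
    mkconf (codeQ (pcQ 0 None)) (behead (rev (tape s (size x))))
      (head blank (rev (tape s (size x))) :: codeG (cell_of s (size x)) :: [::]).
  rewrite iterS; have := conv (size x).-1; rewrite prednK // => -> //.
  rewrite drop_size (@step_left _ (codeQ (pcQ 0 None)) (codeG (cell_of s (size x)))) //.
    exact: codeQ_nhalt.
  rewrite /delta codeQK /= eqxx; congr (_, codeG _, _).
  apply: eq_mkcell => [r rK|t tT] /=; last by rewrite nth_default.
  by case: (r =P 0) => [_|_]; rewrite ?eqxx //; apply/esym/eqP; lia.
rewrite iterD turn.
case: (size x) n0 turn conv => // n _ _ _.
have tapeS m : tape s m.+1 = rcons (tape s m) (codeG (cell_of s m)).
  by rewrite /tape mkseqS.
rewrite tapeS rev_rcons [behead _]/= [head _ _]/=.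
have := @backward_pass _ code_gt0 (mkseq (cell_of s) n) [::] (cell_of s n)
  [:: codeG (cell_of s n.+1)].
have mk : [seq codeG c | c <- mkseq (cell_of s) n] = tape s n.
  by rewrite /mkseq -map_comp.
rewrite size_mkseq map_rcons mk cats0 => ->.
by rewrite /at_rest !tapeS cats0 cats1.
Qed.

Lemma fits_init x : x <> [::] -> fits (init_store x) (size x).+1.
Proof.
move=> x0; split=> [r rK|t p tT xp] /=; first by case: eqP.
by rewrite nth_default // ltnW.
Qed.

Lemma sweeper_run x k pc s b n : x <> [::] ->
  iter k (flat_step code) (0, init_store x) = (pc, s) -> fetch code pc = IHalt b ->
  k * (2 * ((size x).+1 + k) + 4) + 1 + (size x + (size x).+1) <= n ->
  cf_state (tm_run M n x) = if b then tm_acc M else tm_rej M.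
Proof.
move=> x0 E Eh kn; have Ei := init_pass x0.
have [t tk Et] := rounds 0 [::] code_gt0 (fits_init x0) (ltn0Sn _) E Eh.
have -> : n = (n - (t + (size x + (size x).+1))) + (t + (size x + (size x).+1)) by lia.
rewrite /tm_run iterD halted iterD Ei // Et.
by case: (b); rewrite eqxx ?orbT.
Qed.

End Machine.

(** * Structured programs *)

Inductive cmd :=
  | Skip
  | Inc of nat
  | Zero of nat
  | Mov of nat & nat
  | Wr of nat & nat & bool
  | Seq of cmd & cmd
  | IfBit of nat & nat & cmd & cmd
  | IfEq of nat & nat & cmd & cmd
  | For of nat & nat & cmd.

Notation "c ;; d" := (Seq c d) (at level 61, right associativity).

Fixpoint sem (c : cmd) (s : store) : store :=
  match c with
  | Skip => s
  | Inc r => set_reg s r (reg s r).+1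
  | Zero r => set_reg s r 0
  | Mov r r' => set_reg s r (reg s r')
  | Wr t r b => set_bit s t (reg s r) b
  | Seq c d => sem d (sem c s)
  | IfBit t r c d => if mem s t (reg s r) then sem c s else sem d s
  | IfEq r r' c d => if reg s r == reg s r' then sem c s else sem d s
  | For i j c =>
      iter (reg s j) (fun s' => set_reg (sem c s') i (reg (sem c s') i).+1)
        (set_reg s i 0)
  end.

Lemma semS c d s : sem (c;; d) s = sem d (sem c s).
Proof. by []. Qed.

Fixpoint modr (c : cmd) : seq nat :=
  match c with
  | Inc r | Zero r | Mov r _ => [:: r]
  | Seq c d | IfBit _ _ c d | IfEq _ _ c d => modr c ++ modr d
  | For i _ c => i :: modr c
  | _ => [::]
  end.

Fixpoint modt (c : cmd) : seq nat :=
  match c with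
  | Wr t _ _ => [:: t]
  | Seq c d | IfBit _ _ c d | IfEq _ _ c d => modt c ++ modt d
  | For _ _ c => modt c
  | _ => [::]
  end.

Fixpoint limits (c : cmd) : seq nat :=
  match c with
  | Seq c d | IfBit _ _ c d | IfEq _ _ c d => limits c ++ limits d
  | For _ j c => j :: limits c
  | _ => [::]
  end.

Fixpoint wf (c : cmd) : bool :=
  match c with
  | Seq c d | IfBit _ _ c d | IfEq _ _ c d => wf c && wf d
  | For i j c => [&& i != j, i \notin modr c, j \notin modr c & wf c]
  | _ => true
  end.

(** The store [s'] need not be the result of [c]: for a loop, all the stores between two rounds also
    agree with the initial one. *)
Definition agree (c : cmd) (s s' : store) :=
  (forall r, r \notin modr c -> reg s' r = reg s r) /\
  (forall t, t \notin modt c -> mem s' t = mem s t).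

Lemma frame c s : agree c s (sem c s).
Proof.
elim: c s => //=.
- move=> r s; split=> //= x; rewrite inE /upd; by case: eqP.
- move=> r s; split=> //= x; rewrite inE /upd; by case: eqP.
- move=> r r' s; split=> //= x; rewrite inE /upd; by case: eqP.
- move=> t r b s; split=> //= x; rewrite inE /upd; by case: eqP.
- move=> c IHc d IHd s; have [c1 c2] := IHc s; have [d1 d2] := IHd (sem c s).
  by split=> x /=; rewrite mem_cat negb_or => /andP[xc xd]; rewrite ?d1 ?c1 ?d2 ?c2.
- move=> t r c IHc d IHd s; have [c1 c2] := IHc s; have [d1 d2] := IHd s.
  by split=> x /=; rewrite mem_cat negb_or => /andP[xc xd]; case: ifP => _;
    rewrite ?d1 ?c1 ?d2 ?c2.
- move=> r r' c IHc d IHd s; have [c1 c2] := IHc s; have [d1 d2] := IHd s.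
  by split=> x /=; rewrite mem_cat negb_or => /andP[xc xd]; case: ifP => _;
    rewrite ?d1 ?c1 ?d2 ?c2.
- move=> i j c IHc s; elim: (reg s j) => [|n [IH1 IH2]].
    by split=> //= x; rewrite inE negb_or /upd; case: eqP.
  rewrite iterS; set s' := iter n _ _ in IH1 IH2 *; have [c1 c2] := IHc s'.
  split=> x /=; last by move=> xc; rewrite c2 // IH2.
  rewrite inE negb_or => /andP[xi xc]; rewrite {1}/upd (negbTE xi) c1 // IH1 //=.
  by rewrite inE negb_or xi.
Qed.

Lemma frame_reg c s r : r \notin modr c -> reg (sem c s) r = reg s r.
Proof. by case: (frame c s) => + _; apply. Qed.

Lemma frame_mem c s t : t \notin modt c -> mem (sem c s) t = mem s t.
Proof. by case: (frame c s) => _; apply. Qed.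

(** Invariant rule. The body modifies neither the counter nor the limit, so there are exactly
    [reg s j] rounds. The hypothesis [agree] on the intermediate store spares the invariant [I] from
    listing all that the loop leaves untouched. *)
Lemma sem_For i j c s (I : nat -> store -> Prop) : wf (For i j c) ->
  I 0 (set_reg s i 0) ->
  (forall k s', k < reg s j -> agree (For i j c) s s' -> reg s' i = k ->
     I k s' -> I k.+1 (set_reg (sem c s') i k.+1)) ->
  I (reg s j) (sem (For i j c) s).
Proof.
case/and4P=> ij ic jc _ I0 IS.
pose st n := iter n (fun s' => set_reg (sem c s') i (reg (sem c s') i).+1) (set_reg s i 0).
rewrite /= -/(st _).
suff H n : n <= reg s j -> [/\ I n (st n), agree (For i j c) s (st n) & reg (st n) i = n].
  by have [] := H _ (leqnn _).
elim: n => [|n IH] ns.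
  split=> //=; last by rewrite /upd eqxx.
  by split=> //= x; rewrite inE negb_or /upd; case: eqP.
have [In [a1 a2] ri] := IH (ltnW ns).
have stE : st n.+1 = set_reg (sem c (st n)) i n.+1.
  by rewrite {1}/st iterS -/(st n) (@frame_reg c) // ri.
rewrite stE; split; [exact: IS | | by rewrite /= /upd eqxx].
split=> x /=; last by move=> xc; rewrite frame_mem // a2.
rewrite inE negb_or => /andP[xi xc]; rewrite /upd (negbTE xi) frame_reg // a1 //=.
by rewrite inE negb_or xi.
Qed.

(** * Compilation to flat code *)

Fixpoint csize (c : cmd) : nat :=
  match c with
  | Skip => 0
  | Seq c d => csize c + csize d
  | IfBit _ _ c d | IfEq _ _ c d => 2 + csize c + csize d
  | For _ _ c => 5 + csize c
  | _ => 1
  end.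

Fixpoint compile (pc : nat) (c : cmd) : seq instr :=
  match c with
  | Skip => [::]
  | Inc r => [:: IInc r]
  | Zero r => [:: IZero r]
  | Mov r r' => [:: IMov r r']
  | Wr t r b => [:: IWr t r b]
  | Seq c d => compile pc c ++ compile (pc + csize c) d
  | IfBit t r c d =>
      IBit t r (pc + (2 + csize c)) :: compile pc.+1 c ++
      IJmp (pc + (2 + csize c + csize d)) :: compile (pc + (2 + csize c)) d
  | IfEq r r' c d =>
      IEq r r' (pc + (2 + csize c)) :: compile pc.+1 c ++
      IJmp (pc + (2 + csize c + csize d)) :: compile (pc + (2 + csize c)) d
  | For i j c =>
      [:: IZero i, IEq i j (pc + 3), IJmp (pc + (5 + csize c)) &
          compile (pc + 3) c ++ [:: IInc i; IJmp pc.+1]]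
  end.

Fixpoint cost (c : cmd) (s : store) : nat :=
  match c with
  | Skip => 0
  | Seq c d => cost c s + cost d (sem c s)
  | IfBit t r c d => 2 + (if mem s t (reg s r) then cost c s else cost d s)
  | IfEq r r' c d => 2 + (if reg s r == reg s r' then cost c s else cost d s)
  | For i j c =>
      3 + \sum_(k < reg s j) (3 + cost c
        (iter k (fun s' => set_reg (sem c s') i (reg (sem c s') i).+1) (set_reg s i 0)))
  | _ => 1
  end.

Lemma size_compile pc c : size (compile pc c) = csize c.
Proof.
elim: c pc => //=.
- by move=> c IHc d IHd pc; rewrite size_cat IHc IHd.
- by move=> t r c IHc d IHd pc; rewrite size_cat /= IHc IHd addnS.
- by move=> r r' c IHc d IHd pc; rewrite size_cat /= IHc IHd addnS.
- by move=> i j c IHc pc; rewrite size_cat /= IHc; lia.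
Qed.

Lemma iter_cat (T : Type) (f : T -> T) n m x y z :
  iter n f x = y -> iter m f y = z -> iter (n + m) f x = z.
Proof. by rewrite addnC iterD => -> ->. Qed.

Lemma iter_cat1 (T : Type) (f : T -> T) m x y z :
  f x = y -> iter m f y = z -> iter (1 + m) f x = z.
Proof. by rewrite add1n iterSr => ->. Qed.

Arguments fetch : simpl never.

Lemma fetch_cat pre i post : fetch (pre ++ i :: post) (size pre) = i.
Proof. by rewrite /fetch nth_cat ltnn subnn. Qed.

Lemma fetch_catS pre i j post : fetch (pre ++ i :: j :: post) (size pre).+1 = j.
Proof. by rewrite -cat_rcons -(size_rcons pre i) fetch_cat. Qed.

Lemma fetch_mid pre i c j post :
  fetch (pre ++ i :: c ++ j :: post) (size pre + (size c).+1) = j.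
Proof.
rewrite (_ : pre ++ _ = (pre ++ i :: c) ++ j :: post); last by rewrite -catA.
by rewrite (_ : size pre + _ = size (pre ++ i :: c)) ?fetch_cat // size_cat.
Qed.

(** Jump targets are absolute, so the induction is over fragments placed between arbitrary [pre] and
    [post]. Every fragment is left at its end, where the next one begins. *)
Lemma compile_run c : forall pre post s, wf c ->
  exists2 n, n <= cost c s &
    iter n (flat_step (pre ++ compile (size pre) c ++ post)) (size pre, s) =
    (size pre + csize c, sem c s).
Proof.
have prim i pre post s : jump i s (size pre) = (size pre).+1 ->
    exists2 n, n <= 1 &
    iter n (flat_step (pre ++ i :: post)) (size pre, s) = (size pre + 1, exec1 i s).
  by move=> ji; exists 1 => //=; rewrite /flat_step fetch_cat /= ji addn1.
elim: c => /=.
- by move=> pre post s _; exists 0 => //=; rewrite addn0.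
- by move=> r pre post s _; apply: prim.
- by move=> r pre post s _; apply: prim.
- by move=> r r' pre post s _; apply: prim.
- by move=> t r b pre post s _; apply: prim.
- move=> c IHc d IHd pre post s /andP[wc wd].
  have [n nc En] := IHc pre (compile (size pre + csize c) d ++ post) s wc.
  have [m mc Em] := IHd (pre ++ compile (size pre) c) post (sem c s) wd.
  exists (n + m); first exact: leq_add.
  apply: iter_cat; first by rewrite -catA; apply: En.
  by move: Em; rewrite size_cat size_compile -!catA addnA.
- move=> t r c IHc d IHd pre post s /andP[wc wd].
  set l1 := size pre + (2 + csize c); set l2 := size pre + (2 + _ + _).
  set code := pre ++ _.
  have first : flat_step code (size pre, s) =
      (if mem s t (reg s r) then (size pre).+1 else l1, s).
    by rewrite /flat_step /code fetch_cat.
  case: ifP first => _ first.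
    have [n nc En] := IHc (rcons pre (IBit t r l1)) (IJmp l2 :: compile l1 d ++ post) s wc.
    exists (1 + (n + 1)); first by lia.
    apply: (iter_cat1 first); apply: iter_cat.
      by move: En; rewrite size_rcons cat_rcons /code /= -!catA; apply.
    have Ej : fetch code ((size pre).+1 + csize c) = IJmp l2.
      by rewrite /code /= -catA /= addSnnS -(size_compile (size pre).+1 c) fetch_mid.
    by rewrite /= /flat_step /= Ej.
  have [n nc En] := IHd (pre ++ IBit t r l1 :: compile (size pre).+1 c ++ [:: IJmp l2]) post s wd.
  exists (1 + n); first by lia.
  apply: (iter_cat1 first).
  move: En; rewrite /code size_cat /= size_cat size_compile /= -!catA /= -!catA /=.
  rewrite (_ : size pre + _ = l1); last by rewrite /l1; lia.
  by move=> ->; congr (_, _); rewrite /l1 /l2; lia.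
- move=> r r' c IHc d IHd pre post s /andP[wc wd].
  set l1 := size pre + (2 + csize c); set l2 := size pre + (2 + _ + _).
  set code := pre ++ _.
  have first : flat_step code (size pre, s) =
      (if reg s r == reg s r' then (size pre).+1 else l1, s).
    by rewrite /flat_step /code fetch_cat.
  case: ifP first => _ first.
    have [n nc En] := IHc (rcons pre (IEq r r' l1)) (IJmp l2 :: compile l1 d ++ post) s wc.
    exists (1 + (n + 1)); first by lia.
    apply: (iter_cat1 first); apply: iter_cat.
      by move: En; rewrite size_rcons cat_rcons /code /= -!catA; apply.
    have Ej : fetch code ((size pre).+1 + csize c) = IJmp l2.
      by rewrite /code /= -catA /= addSnnS -(size_compile (size pre).+1 c) fetch_mid.
    by rewrite /= /flat_step /= Ej.
  have [n nc En] := IHd (pre ++ IEq r r' l1 :: compile (size pre).+1 c ++ [:: IJmp l2]) post s wd.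
  exists (1 + n); first by lia.
  apply: (iter_cat1 first).
  move: En; rewrite /code size_cat /= size_cat size_compile /= -!catA /= -!catA /=.
  rewrite (_ : size pre + _ = l1); last by rewrite /l1; lia.
  by move=> ->; congr (_, _); rewrite /l1 /l2; lia.
- move=> i j c IHc pre post s /and4P[ij ic jc wc].
  set l1 := size pre + 3; set l2 := size pre + (5 + _).
  set code := pre ++ _.
  pose st n := iter n (fun s' => set_reg (sem c s') i (reg (sem c s') i).+1) (set_reg s i 0).
  have stj n : reg (st n) j = reg s j.
    elim: n => [|n IH]; rewrite /= /upd [j == i]eq_sym (negbTE ij) //.
    by rewrite frame_reg.
  have sti n : reg (st n) i = n.
    by elim: n => [|n IH]; rewrite /= /upd eqxx // frame_reg // IH.
  have loop n : n <= reg s j -> exists2 m, m <= 1 + \sum_(k < n) (3 + cost c (st k)) &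
      iter m (flat_step code) (size pre, s) = ((size pre).+1, st n).
    elim: n => [|n IH] ns.
      by exists 1 => //=; rewrite /flat_step /code fetch_cat.
    have [m mc Em] := IH (ltnW ns).
    have [m' mc' Em'] := IHc (pre ++ [:: IZero i; IEq i j l1; IJmp l2])
       ([:: IInc i; IJmp (size pre).+1] ++ post) (st n) wc.
    have codeE : code = (pre ++ [:: IZero i; IEq i j l1; IJmp l2]) ++
        compile l1 c ++ [:: IInc i; IJmp (size pre).+1] ++ post.
      by rewrite /code /= -!catA.
    have szE : size (pre ++ [:: IZero i; IEq i j l1; IJmp l2]) = l1.
      by rewrite size_cat.
    rewrite szE -codeE in Em'.
    exists (m + (1 + (m' + 2))); first by move: mc mc'; rewrite big_ord_recr /=; move: (\sum_(_ < _) _) (cost _ _) => S C; lia.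
    apply: (iter_cat Em); apply: iter_cat.
      by rewrite /= /flat_step /code fetch_catS /= sti stj (ltn_eqF ns) -/l1.
    apply: (iter_cat Em').
    rewrite codeE catA /= /flat_step.
    rewrite (_ : l1 + csize c = size ((pre ++ [:: IZero i; IEq i j l1; IJmp l2]) ++ compile l1 c));
      last by rewrite size_cat szE size_compile.
    by rewrite fetch_cat /= fetch_catS.
  have [m mc Em] := loop _ (leqnn _).
  exists (m + 2); first by move: mc; rewrite -/(st _) /st; move: (\sum_(_ < _) _) => S; lia.
  apply: (iter_cat Em).
  rewrite /= /flat_step /code fetch_catS /= sti stj eqxx.
  by have := fetch_mid pre (IZero i) [:: IEq i j l1] (IJmp l2)
    ((compile l1 c ++ [:: IInc i; IJmp (size pre).+1]) ++ post); rewrite addn2 => ->.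
Qed.

Fixpoint cmd_in (K T : nat) (c : cmd) : bool :=
  match c with
  | Skip => true
  | Inc r | Zero r => r < K
  | Mov r r' => (r < K) && (r' < K)
  | Wr t r _ => (t < T) && (r < K)
  | Seq c d => cmd_in K T c && cmd_in K T d
  | IfBit t r c d => [&& t < T, r < K, cmd_in K T c & cmd_in K T d]
  | IfEq r r' c d => [&& r < K, r' < K, cmd_in K T c & cmd_in K T d]
  | For i j c => [&& i < K, j < K & cmd_in K T c]
  end.

(** A fragment may jump to the position just after its end, hence the strict inequality. *)
Lemma compile_in K T P c pc : cmd_in K T c -> pc + csize c < P ->
  all (instr_in K T P) (compile pc c).
Proof.
elim: c pc => //=.
- by move=> r pc -> _.
- by move=> r pc -> _.
- by move=> r r' pc -> _.
- by move=> t r b pc -> _.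
- move=> c IHc d IHd pc /andP[ci di] pcP.
  by rewrite all_cat IHc // ?IHd //; lia.
- move=> t r c IHc d IHd pc /and4P[-> -> ci di] pcP.
  by rewrite all_cat /= IHc // ?IHd // ?andbT /=; lia.
- move=> r r' c IHc d IHd pc /and4P[-> -> ci di] pcP.
  by rewrite all_cat /= IHc // ?IHd // ?andbT /=; lia.
- move=> i j c IHc pc /and3P[iK jK ci] pcP.
  by rewrite all_cat /= IHc // ?andbT /= ?iK ?jK /=; lia.
Qed.

(** * Polynomial cost of loops with fixed limits *)

Fixpoint kappa (c : cmd) : nat :=
  match c with
  | Skip => 0
  | Seq c d => kappa c + kappa d
  | IfBit _ _ c d | IfEq _ _ c d => 2 + kappa c + kappa d
  | For _ _ c => 6 + kappa c
  | _ => 1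
  end.

Fixpoint depth (c : cmd) : nat :=
  match c with
  | Seq c d | IfBit _ _ c d | IfEq _ _ c d => maxn (depth c) (depth d)
  | For _ _ c => (depth c).+1
  | _ => 0
  end.

(** Each level of nesting contributes a factor [B + 1]. This needs the limits to keep their initial
    values throughout [c]. The 6 in [kappa] absorbs the 3 instructions outside the rounds and the 3
    per round. *)
Lemma cost_bound B c : forall s, wf c ->
  (forall l, l \in limits c -> (l \notin modr c) && (reg s l <= B)) ->
  cost c s <= kappa c * B.+1 ^ depth c.
Proof.
have expM a b : B.+1 ^ a <= B.+1 ^ maxn a b by apply: leq_pexp2l => //; apply: leq_maxl.
have expMr a b : B.+1 ^ b <= B.+1 ^ maxn a b by apply: leq_pexp2l => //; apply: leq_maxr.
elim: c => //=.
- move=> c IHc d IHd s /andP[wc wd] lim.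
  have hc : cost c s <= kappa c * B.+1 ^ depth c.
    apply: IHc => // l lc; have := lim l; rewrite !mem_cat lc negb_or => /(_ isT).
    by case/andP=> /andP[-> _] ->.
  have hd : cost d (sem c s) <= kappa d * B.+1 ^ depth d.
    apply: IHd => // l ld; have := lim l; rewrite !mem_cat ld orbT negb_or => /(_ isT).
    by case/andP=> /andP[lc ->] H; rewrite frame_reg.
  have := expM (depth c) (depth d); have := expMr (depth c) (depth d); nia.
- move=> t r c IHc d IHd s /andP[wc wd] lim.
  have hc : cost c s <= kappa c * B.+1 ^ depth c.
    apply: IHc => // l lc; have := lim l; rewrite !mem_cat lc negb_or => /(_ isT).
    by case/andP=> /andP[-> _] ->.
  have hd : cost d s <= kappa d * B.+1 ^ depth d.
    apply: IHd => // l ld; have := lim l; rewrite !mem_cat ld orbT negb_or => /(_ isT).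
    by case/andP=> /andP[_ ->] ->.
  have := expM (depth c) (depth d); have := expMr (depth c) (depth d).
  have : 0 < B.+1 ^ maxn (depth c) (depth d) by rewrite expn_gt0.
  by case: ifP => _; nia.
- move=> r r' c IHc d IHd s /andP[wc wd] lim.
  have hc : cost c s <= kappa c * B.+1 ^ depth c.
    apply: IHc => // l lc; have := lim l; rewrite !mem_cat lc negb_or => /(_ isT).
    by case/andP=> /andP[-> _] ->.
  have hd : cost d s <= kappa d * B.+1 ^ depth d.
    apply: IHd => // l ld; have := lim l; rewrite !mem_cat ld orbT negb_or => /(_ isT).
    by case/andP=> /andP[_ ->] ->.
  have := expM (depth c) (depth d); have := expMr (depth c) (depth d).
  have : 0 < B.+1 ^ maxn (depth c) (depth d) by rewrite expn_gt0.
  by case: ifP => _; nia.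
- move=> i j c IHc s /and4P[ij ic jc wc] lim.
  pose st n := iter n (fun s' => set_reg (sem c s') i (reg (sem c s') i).+1) (set_reg s i 0).
  have stl l n : l \in limits c -> reg (st n) l = reg s l.
    move=> lc; have := lim l; rewrite !inE lc orbT negb_or => /(_ isT) /andP[/andP[li lm] _].
    by elim: n => [|n IH]; rewrite /= /upd (negbTE li) // frame_reg.
  have hc n : cost c (st n) <= kappa c * B.+1 ^ depth c.
    apply: IHc => // l lc; rewrite stl //; have := lim l; rewrite !inE lc orbT negb_or.
    by move=> /(_ isT) /andP[/andP[_ ->] ->].
  have jB : reg s j <= B by have := lim j; rewrite !inE eqxx => /(_ isT) /andP[_ ->].
  have : \sum_(k < reg s j) (3 + cost c (st k)) <=
         \sum_(k < reg s j) (3 + kappa c * B.+1 ^ depth c).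
    by apply: leq_sum => k _; rewrite leq_add2l.
  rewrite sum_nat_const card_ord.
  have E0 : 0 < B.+1 ^ depth c by rewrite expn_gt0.
  rewrite expnS; move: (B.+1 ^ depth c) E0 => E E0.
  move: (\sum_(k < _) _) => S SE; apply: (@leq_trans (3 + B * (3 + kappa c * E))).
    by rewrite leq_add2l; apply: (leq_trans SE); rewrite leq_mul2r jB orbT.
  nia.
Qed.

Lemma decider K T c f z : wf c -> cmd_in K T c -> f < K -> z < K ->
  exists M : TM, forall x n, x <> [::] ->
    let s := sem c (init_store x) in let k := (cost c (init_store x)).+1 in
    k * (2 * ((size x).+1 + k) + 4) + 1 + (size x + (size x).+1) <= n ->
    cf_state (tm_run M n x) = if reg s f == reg s z then tm_acc M else tm_rej M.
Proof.
move=> wc cK fK zK.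
pose code := compile 0 c ++ [:: IEq f z (csize c).+2; IHalt true; IHalt false].
have szE : size code = (csize c).+3 by rewrite size_cat size_compile /=; lia.
have code_gt0 : 0 < size code by rewrite szE.
have code_in : all (instr_in K T (size code)) code.
  by rewrite {2}/code all_cat compile_in //= ?szE ?fK ?zK /=; lia.
have code_end : exists b, fetch code (size code).-1 = IHalt b.
  exists false; rewrite szE /fetch nth_cat size_compile ltnNge leqW ?leqW //=.
  by rewrite -addn2 addKn.
exists (sweeper K T code) => x n x0 s k kn.
have [m mc] := compile_run [::] [:: IEq f z (csize c).+2; IHalt true; IHalt false]
  (init_store x) wc.
rewrite cat0s add0n -/code => Em.
have Em1 : iter m.+1 (flat_step code) (0, init_store x) =
    (if reg s f == reg s z then (csize c).+1 else (csize c).+2, s).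
  rewrite iterS [iter _ _ _]Em /flat_step /= -/s.
  have -> : fetch code (csize c) = IEq f z (csize c).+2.
    by rewrite -{1}(size_compile 0 c) fetch_cat.
  by [].
apply: (sweeper_run code_gt0 code_in code_end x0 Em1); last first.
  apply: leq_trans kn; rewrite !leq_add2r /k.
  by apply: leq_mul; lia.
case: ifP => _; rewrite /code /fetch nth_cat size_compile ltnNge ?leqW //=.
  by rewrite subSnn.
by rewrite -[_.+2]addn2 addKn.
Qed.

(** * Addition and multiplication of binary words *)

Definition wval (m : nat -> bool) (p n : nat) : nat := \sum_(i < n) m (p + i) * 2 ^ i.

Lemma wval0 m p : wval m p 0 = 0.
Proof. by rewrite /wval big_ord0. Qed.

Lemma wvalS m p n : wval m p n.+1 = wval m p n + m (p + n) * 2 ^ n.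
Proof. by rewrite /wval big_ord_recr. Qed.

Lemma eq_wval m m' p n :
  (forall x, p <= x < p + n -> m x = m' x) -> wval m p n = wval m' p n.
Proof.
by move=> mm; apply: eq_bigr => i _; rewrite mm // leq_addr ltn_add2l ltn_ord.
Qed.

Lemma wval_cat m p a b : wval m p (a + b) = wval m p a + 2 ^ a * wval m (p + a) b.
Proof.
elim: b => [|b IH]; first by rewrite addn0 wval0 muln0 addn0.
by rewrite addnS !wvalS IH addnA expnD; ring.
Qed.

Lemma wval_lt m p n : wval m p n < 2 ^ n.
Proof.
elim: n => [|n IH]; first by rewrite wval0.
rewrite wvalS expnS; case: (m _); lia.
Qed.

Lemma eqmod_carry d x y a b : x + a * d = y + b * d -> x = y %[mod d].
Proof. by move=> E; rewrite -(modnMDl a x d) -(modnMDl b y d) addnC E addnC. Qed.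

Lemma updE (T : Type) (f : nat -> T) i v x : upd f i v x = if x == i then v else f x.
Proof. by []. Qed.

Lemma notin_below b r (l : seq nat) : r < b -> all (leq b) l -> r \notin l.
Proof. by move=> rb /allP bl; apply/negP => /bl; rewrite leqNgt rb. Qed.

(* Fixed registers of all programs below:
     0 length of the input     1 zero                   2 word size [W]
     3 number [n] of states    4 number [k] of letters  5-8 [(n+1)^1 .. (n+1)^4]
     9 number of entries      10 one                   11 [k (n+1)^2]
    15 the answer, 0 if the automaton is image-binary  16 position in the input
    18 next entry             19 [(n+1)^4 W]           20 length of the words
    22 current matrix         23-25 the vectors alpha, (eta, 0), (eta, -1)
   and tracks:
     0 marks of [S1]           1 marks of [Sep]         2 the word 1
     3 the word -1             4, 6, 7, 10 temporary words
     8 numerators              9 denominators          11 scaled entries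
    12, 13 temporary tensors  14 tensor of the words of the current length
    15 tensor under construction *)

(** Pointers hold bit positions, so this advances [p] by [reg l] words of [W] bits; with [l = 10] it
    moves to the next word. *)
Definition addw (p l : nat) : cmd := For 60 l (For 61 2 (Inc p)).

Lemma addwP p l s : p < 60 -> l < 60 -> p != l -> p != 2 ->
  reg (sem (addw p l) s) p = reg s p + reg s l * reg s 2.
Proof.
move=> p60 l60 pl p2.
have w1 : wf (For 61 2 (Inc p)) by rewrite /= !inE; lia.
have w2 : wf (addw p l) by rewrite /= !inE; lia.
apply: (@sem_For _ _ _ _ (fun k s' => reg s' p = reg s p + k * reg s 2)) => //.
  by rewrite /= updE ltn_eqF // addn0.
move=> k s' ks [ag _] _ Ip.
have s2 : reg s' 2 = reg s 2 by apply: ag; rewrite /= !inE; lia.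
rewrite [reg _ _]/= updE ltn_eqF //.
have : reg (sem (For 61 2 (Inc p)) s') p = reg s' p + reg s' 2.
  apply: (@sem_For _ _ _ _ (fun k s'' => reg s'' p = reg s' p + k)) => //.
    by rewrite /= updE; case: eqP => [?|_]; lia.
  move=> k' s'' _ _ _ E /=; rewrite !updE eqxx E.
  by case: eqP => [?|_]; lia.
by move=> ->; rewrite Ip s2; lia.
Qed.

(** * Multiplication with addition, modulo [2 ^ W] *)

Section Fma.
Variables (d x y pd px py : nat).
Hypothesis (xd : x != d) (yd : y != d).
Hypothesis (pd50 : pd < 50) (px50 : px < 50) (py50 : py < 50).

(** A full adder with the carry in register 56. If the bit of [y] equals the carry, the target bit
    does not change. *)
Definition addbit : cmd :=
  IfBit y 55
    (IfEq 56 1 (IfBit d 54 (Wr d 54 false;; Inc 56) (Wr d 54 true)) Skip)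
    (IfEq 56 1 Skip (IfBit d 54 (Wr d 54 false) (Wr d 54 true;; Zero 56))).

(** The loop always makes [W] rounds. Register 57 is the end of the target word; once the target
    position reaches it, the remaining rounds are idle, and this truncates the shifted summand
    modulo [2 ^ W]. *)
Definition add_shifted : cmd :=
  Mov 54 53;; Mov 55 py;; Zero 56;;
  For 51 2 (IfEq 54 57 Skip (addbit;; Inc 54;; Inc 55)).

Definition fma : cmd :=
  Mov 52 px;; Mov 53 pd;; Mov 57 pd;; For 50 2 (Inc 57);;
  For 50 2 (IfBit x 52 add_shifted Skip;; Inc 52;; Inc 53).

Lemma addbitP s : reg s 1 = 0 -> reg s 56 <= 1 ->
  let s' := sem addbit s in
  [/\ reg s' 56 <= 1,
      mem s' d (reg s 54) + 2 * reg s' 56 =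
        mem s d (reg s 54) + mem s y (reg s 55) + reg s 56,
      forall a, a != reg s 54 -> mem s' d a = mem s d a &
      forall r, r != 56 -> reg s' r = reg s r].
Proof.
move=> z c1; rewrite /addbit /= z.
have E1 : reg s 56 <> 0 -> reg s 56 = 1 by lia.
case: ifP => Ey; case: eqP => [E0|/E1 {}E1]; [case: ifP => Ed | | | case: ifP => Ed].
all: split; rewrite /= ?updE ?eqxx ?updE ?eqxx ?E0 ?E1 ?Ed ?Ey //; try lia.
all: try by move=> a /negbTE na; rewrite ?updE ?eqxx ?updE na.
Qed.

Lemma add_shiftedP s n : reg s 1 = 0 -> reg s 53 + n = reg s 57 -> n <= reg s 2 ->
  let s' := sem add_shifted s in
  (exists c, wval (mem s' d) (reg s 53) n + c * 2 ^ n =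
      wval (mem s d) (reg s 53) n + wval (mem s y) (reg s py) n) /\
  (forall a, ~~ (reg s 53 <= a < reg s 57) -> mem s' d a = mem s d a).
Proof.
move=> z En nW s'.
set s1 := sem (Mov 54 53;; Mov 55 py;; Zero 56) s.
have s'E : s' = sem (For 51 2 (IfEq 54 57 Skip (addbit;; Inc 54;; Inc 55))) s1 by [].
have r1 : reg s1 53 = reg s 53 by [].
have r54 : reg s1 54 = reg s 53 by [].
have r55 : reg s1 55 = reg s py by rewrite /= !updE /= (ltn_eqF (ltn_trans py50 _)).
have rw : reg s1 2 = reg s 2 by [].
have r57 : reg s1 57 = reg s 57 by [].
have r56 : reg s1 56 = 0 by [].
have rz : reg s1 1 = 0 by [].
have m1 : mem s1 = mem s by [].
clearbody s1.
pose I k s2 := let j := minn k n in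
  [/\ reg s2 54 = reg s 53 + j, reg s2 55 = reg s py + j, reg s2 56 <= 1,
   wval (mem s2 d) (reg s 53) j + reg s2 56 * 2 ^ j =
     wval (mem s d) (reg s 53) j + wval (mem s y) (reg s py) j &
   forall a, ~~ (reg s 53 <= a < reg s 53 + j) -> mem s2 d a = mem s d a].
have H : I (reg s1 2) s'.
  rewrite s'E; apply: sem_For => //.
    rewrite /I min0n /= !updE /= r54 r55 r56 m1 !wval0 !addn0.
    by split=> // a _; rewrite m1.
  move=> k s2 kW [ag am] _ [e54 e55 e56 ev em].
  have e57 : reg s2 57 = reg s 57 by rewrite ag.
  have ez : reg s2 1 = 0 by rewrite ag.
  have ey : mem s2 y = mem s y by rewrite am -?m1 //= !inE /= !negb_or !yd.
  rewrite -[sem _ s2]/(if reg s2 54 == reg s2 57 then s2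
    else sem (Inc 54;; Inc 55) (sem addbit s2)).
  rewrite e57 e54 -En eqn_add2l; case: eqP => [kn|/eqP kn].
    have kE : minn k.+1 n = minn k n by lia.
    by rewrite /I kE /= !updE /= e54 e55; split.
  have kn' : k < n by lia.
  have kE : minn k n = k by lia.
  have kE' : minn k.+1 n = k.+1 by lia.
  have := addbitP ez e56; set s3 := sem addbit s2; clearbody s3; move=> [c1 cE cm cr].
  rewrite /I kE' /= !updE /= (cr 54) // (cr 55) // e54 e55 kE !addnS; split=> //.
    rewrite !wvalS expnS; rewrite kE in ev e54 e55 em.
    have -> : wval (mem s3 d) (reg s 53) k = wval (mem s2 d) (reg s 53) k.
      by apply: eq_wval => a ak; rewrite cm // e54; lia.
    move: cE; rewrite e54 e55 ey (em (reg s 53 + k)); last by lia.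
    set b1 := nat_of_bool (mem s3 d _); move: ev.
    move: (wval _ _ _) (wval _ _ _) (wval _ _ _) (reg s3 56) (reg s2 56) b1 (2 ^ k).
    move=> A B C c' c b1 P E1 E2.
    have : (b1 + 2 * c') * P = (mem s d (reg s 53 + k) + mem s y (reg s py + k) + c) * P.
      by rewrite E2.
    lia.
  rewrite kE in e54 em.
  by move=> a na; rewrite cm ?em // ?e54; lia.
have [h54 _ _ hv hm] := H.
have WE : minn (reg s1 2) n = n by lia.
rewrite WE in hv hm; split; first by exists (reg s' 56).
by move=> a na; rewrite hm // En.
Qed.

Lemma fmaP s : reg s 1 = 0 ->
  let W := reg s 2 in let s' := sem fma s in
  (wval (mem s' d) (reg s pd) W = wval (mem s d) (reg s pd) W +
     wval (mem s x) (reg s px) W * wval (mem s y) (reg s py) W %[mod 2 ^ W]) /\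
  (forall a, ~~ (reg s pd <= a < reg s pd + W) -> mem s' d a = mem s d a).
Proof.
move=> z W s'.
set s0 := sem (Mov 52 px;; Mov 53 pd;; Mov 57 pd) s.
set s1 := sem (For 50 2 (Inc 57)) s0.
have s'E : s' = sem (For 50 2 (IfBit x 52 add_shifted Skip;; Inc 52;; Inc 53)) s1 by [].
have lt50 r v : r < 50 -> 50 <= v -> (r == v) = false by lia.
have r0 r : r < 50 -> reg s0 r = reg s r by move=> r50; rewrite /= !updE !lt50.
have r52 : reg s1 52 = reg s px by rewrite frame_reg.
have r53 : reg s1 53 = reg s pd by rewrite frame_reg //= !updE /= lt50.
have r57 : reg s1 57 = reg s pd + W.
  have e57 : reg s0 57 = reg s pd by rewrite /= !updE /= !lt50.
  rewrite -e57; apply: (@sem_For 50 2 (Inc 57) s0 (fun k s'' => reg s'' 57 = reg s0 57 + k)) => //.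
    by rewrite addn0.
  by move=> k s'' _ _ _ E; rewrite /= !updE /= E addnS.
have rz : reg s1 1 = 0 by rewrite frame_reg // r0.
have rW : reg s1 2 = W by rewrite frame_reg // r0.
have ry : reg s1 py = reg s py by rewrite frame_reg ?r0 //; apply: (notin_below py50).
have m1 : mem s1 = mem s.
  apply: (@sem_For 50 2 (Inc 57) s0 (fun _ s'' => mem s'' = mem s)) => //.
clearbody s1.
pose I k s2 :=
  [/\ reg s2 52 = reg s px + k, reg s2 53 = reg s pd + k,
   wval (mem s2 d) (reg s pd) W = wval (mem s d) (reg s pd) W +
     wval (mem s x) (reg s px) k * wval (mem s y) (reg s py) W %[mod 2 ^ W] &
   forall a, ~~ (reg s pd <= a < reg s pd + W) -> mem s2 d a = mem s d a].
suff [_ _ h1 h2] : I (reg s1 2) s' by rewrite rW in h1; split.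
rewrite s'E; apply: sem_For => //.
  rewrite /I /= !updE /= r52 r53 m1 wval0 mul0n !addn0.
  by split=> // a _; rewrite m1.
move=> k s2 kW [ag am] _ [e52 e53 ev em]; rewrite rW in kW.
have nin r : r < 50 -> r \notin modr (For 50 2 (IfBit x 52 add_shifted Skip;; Inc 52;; Inc 53)).
  by move=> r50; apply: (notin_below r50).
have e57 : reg s2 57 = reg s pd + W by rewrite ag.
have ez : reg s2 1 = 0 by rewrite ag.
have eW : reg s2 2 = W by rewrite ag.
have epy : reg s2 py = reg s py by rewrite ag ?nin.
have ey : mem s2 y = mem s y by rewrite am -?m1 //= !inE /= !negb_or !yd.
have ex : mem s2 x = mem s x by rewrite am -?m1 //= !inE /= !negb_or !xd.
rewrite -[sem _ s2]/(sem (Inc 52;; Inc 53)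
  (if mem s2 x (reg s2 52) then sem add_shifted s2 else s2)).
rewrite e52 ex; case: ifP => xk; last first.
  rewrite /I /= !updE /= e52 e53 !addnS wvalS xk mul0n addn0.
  by split.
set s3 := sem add_shifted s2.
have f52 : reg s3 52 = reg s2 52 by rewrite frame_reg.
have f53 : reg s3 53 = reg s2 53 by rewrite frame_reg.
have [||| [c hc] hm] := @add_shiftedP s2 (W - k) => //.
- by rewrite e53 e57; lia.
- by rewrite eW; lia.
rewrite -/s3 e53 e57 epy ey in hc hm; clearbody s3.
rewrite /I /= !updE /= !f52 !f53 e52 e53 !addnS wvalS xk mul1n; split=> //; last first.
  by move=> a na; rewrite hm ?em //; lia.
rewrite mulnDl addnA -modnDml -ev modnDml.
have WE : W = k + (W - k) by lia.
rewrite {1 3}WE !wval_cat.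
have -> : wval (mem s3 d) (reg s pd) k = wval (mem s2 d) (reg s pd) k.
  by apply: eq_wval => a ak; rewrite hm //; lia.
(* After the shift by [k] places the upper [k] bits of [y] have weight at least [2 ^ W]. Together
   with the outgoing carry [c] they form the multiple of [2 ^ W] that is discarded. *)
have -> : wval (mem s y) (reg s py) W = wval (mem s y) (reg s py) (W - k) +
    2 ^ (W - k) * wval (mem s y) (reg s py + (W - k)) k.
  by rewrite -wval_cat subnK // ltnW.
have P : 2 ^ W = 2 ^ k * 2 ^ (W - k) by rewrite -expnD -WE.
apply: (@eqmod_carry _ _ _ (c + wval (mem s y) (reg s py + (W - k)) k) 0).
rewrite P -addnA; move: hc.
move: (wval _ _ _) (wval _ _ _) (wval _ _ _) (wval _ _ _) (wval _ _ _) (2 ^ k) (2 ^ (W - k)).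
move=> A B C D E F G.
move=> hc.
have := congr1 (muln F) hc; lia.
Qed.

End Fma.

(** * Arrays of words *)

Import GRing.Theory.

Section Words.
Local Open Scope ring_scope.

(* The first [N] words of a track represent the integers [f e] modulo [2 ^ W]. *)
Definition arr (N W : nat) (m : nat -> bool) (f : nat -> int) : Prop :=
  forall e, (e < N)%N -> ((wval m (e * W) W)%:Z = f e %[mod (2 ^ W)%:Z])%Z.

Lemma eq_arr N W m f g : (forall e, (e < N)%N -> f e = g e) -> arr N W m f -> arr N W m g.
Proof. by move=> fg mf e eN; rewrite -fg // mf. Qed.

Lemma arr_sub N N' W m f : (N' <= N)%N -> arr N W m f -> arr N' W m f.
Proof. by move=> NN mf e eN; apply: mf; apply: leq_trans NN. Qed.

Lemma fma_arr d x y pd px py s N Nx Ny f g h e a b :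
  x != d -> y != d -> (pd < 50)%N -> (px < 50)%N -> (py < 50)%N -> reg s 1 = 0%N ->
  let W := reg s 2 in
  reg s pd = (e * W)%N -> reg s px = (a * W)%N -> reg s py = (b * W)%N ->
  arr N W (mem s d) f -> arr Nx W (mem s x) g -> arr Ny W (mem s y) h ->
  (a < Nx)%N -> (b < Ny)%N ->
  arr N W (mem (sem (fma d x y pd px py) s) d) (upd f e (f e + g a * h b)).
Proof.
move=> xd yd pd50 px50 py50 z W ed ex ey hf hg hh aN bN.
have [hv hm] := @fmaP d x y pd px py xd yd pd50 px50 py50 s z.
move: (sem _ s) hv hm => s'; rewrite ed ex ey -/W => hv hm e' eN; rewrite updE.
case: eqP => [Ee|/eqP ne].
  rewrite Ee in eN *; rewrite modz_nat hv -modz_nat PoszD PoszM -[LHS]modzDm -[in LHS]modzMm.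
  by rewrite hf // hg // hh // modzMm modzDm.
rewrite -hf //; congr (Posz _ %% _)%Z; apply: eq_wval => c ce; apply: hm.
by case: (ltngtP e' e) ne ce => // ee _; nia.
Qed.

Definition zero_arr (t l : nat) : cmd := For 62 l (Wr t 62 false).

Lemma zero_arrP t l s : (l < 62)%N ->
  forall a, (a < reg s l)%N -> mem (sem (zero_arr t l) s) t a = false.
Proof.
move=> l62.
apply: (@sem_For _ _ _ _ (fun k s' => forall a, (a < k)%N -> mem s' t a = false)) => //.
  by rewrite /= andbT; lia.
move=> k s' kl ag e62 IH a; rewrite ltnS leq_eqVlt /= !updE eqxx e62 updE.
by case: eqP => //= _; apply: IH.
Qed.

Lemma wval_zero m p n : (forall a, (p <= a < p + n)%N -> m a = false) -> wval m p n = 0%N.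
Proof.
move=> m0; rewrite (@eq_wval _ pred0) // /wval big1 // => i _.
Qed.

Lemma zero_arr_arr t l s N W : (l < 62)%N -> reg s l = (N * W)%N ->
  arr N W (mem (sem (zero_arr t l) s) t) (fun=> 0).
Proof.
move=> l62 El e eN; rewrite wval_zero // => a ae; apply: zero_arrP => //.
by rewrite El; nia.
Qed.

Definition nonzero (t f : nat) : cmd := For 62 2 (IfBit t 62 (Mov f 10) Skip).

Lemma nonzeroP t f s : (f < 62)%N -> f != 2%N -> f != 10%N -> reg s 10 = 1%N ->
  reg (sem (nonzero t f) s) f = if wval (mem s t) 0 (reg s 2) == 0%N then reg s f else 1%N.
Proof.
move=> f62 f2 f10 s10; rewrite /nonzero.
apply: (@sem_For _ _ _ _ (fun k s' =>
  reg s' f = if wval (mem s t) 0 k == 0%N then reg s f else 1%N)) => //.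
- by rewrite /= !inE; lia.
- by rewrite wval0 /= updE ltn_eqF.
move=> k s' kW [ag am] e62 IH.
have E10 : reg s' 10 = 1%N by rewrite ag //= !inE; lia.
rewrite /= e62 wvalS addn_eq0 add0n am //; case: ifP => _ /=.
  by rewrite !updE ltn_eqF // eqxx E10 mul1n expn_eq0 andbF.
by rewrite updE ltn_eqF // IH eqxx andbT.
Qed.

(* Applies an [m] x [n] matrix [g] to the leading index of a tensor [f] and
   makes it the last index; [R] is the number of values of the other indices. *)
Definition rotf (m R n : nat) (f g : nat -> int) (e : nat) : int :=
  \sum_(p < m) f (p * R + e %/ n)%N * g (p * n + e %% n)%N.

(** * The rotation of a tensor as a program *)

Section Rot.
Variables (src dst mat pm m R n : nat).
Hypothesis (sd : src != dst) (md : mat != dst).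
Hypothesis (pm40 : (pm < 40)%N) (m40 : (m < 40)%N) (R40 : (R < 40)%N) (n40 : (n < 40)%N).

(** Register 40 points to the target entry, 41 to the entry of the source with leading index 0, and
    45 to the top of the current matrix column. The copies 46 and 47 run over the summands in
    strides of [R] and [n] words. The target is not cleared, so the result is added to it. *)
Definition rot_entry : cmd :=
  For 44 m (fma dst src mat 40 46 47;; addw 46 R;; addw 47 n).
Definition rot_row : cmd :=
  For 43 n (Mov 46 41;; Mov 47 45;; rot_entry;; addw 40 10;; addw 45 10).
Definition rot : cmd :=
  Zero 40;; Zero 41;; For 42 R (Mov 45 pm;; rot_row;; addw 41 10).

Lemma wf_below b i j c : (b <= i)%N -> (j < b)%N -> i \notin modr c ->
  all (leq b) (modr c) -> wf c -> wf (For i j c).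
Proof.
move=> bi jb ic bc wc; apply/and4P; split=> //; last exact: notin_below bc.
by rewrite gtn_eqF // (leq_trans jb).
Qed.

Lemma wf_addw p l : (p < 60)%N -> (l < 60)%N -> p != l -> p != 2%N -> wf (addw p l).
Proof. by move=> ????; rewrite /= !inE; lia. Qed.

Lemma rot_entry_wf : wf rot_entry.
Proof.
apply: (@wf_below 40) => //; apply/andP; split=> //; apply/andP.
by split; apply: wf_addw => //; lia.
Qed.

Lemma rot_row_wf : wf rot_row.
Proof.
apply: (@wf_below 40) => //.
by do 2 ![apply/andP; split=> //]; apply/andP; split=> //; apply: rot_entry_wf.
Qed.

Lemma rot_wf : wf rot.
Proof.
apply/andP; split=> //; apply/andP; split=> //.
apply: (@wf_below 40) => //.
by apply/andP; split=> //; apply/andP; split=> //; apply: rot_row_wf.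
Qed.

Lemma rot_modt c t : c \in [:: 0; 1; 2]%N -> t != dst ->
  t \notin modt (nth Skip [:: rot; rot_row; rot_entry] c).
Proof. by rewrite !inE => /or3P[] /eqP -> td /=; rewrite !inE !(negbTE td). Qed.

Definition rot_regs (s : store) W mv Rv nv b :=
  [/\ reg s 1 = 0%N, reg s 2 = W, reg s 10 = 1%N & [/\ reg s pm = (b * W)%N,
    reg s m = mv, reg s R = Rv & reg s n = nv]].

Lemma rot_regs_agree c s s' W mv Rv nv b : all (leq 40) (modr c) -> agree c s s' ->
  rot_regs s W mv Rv nv b -> rot_regs s' W mv Rv nv b.
Proof.
move=> c40 [ag _] [r1 r2 r10 [rp rm rR rn]].
have lt40 r : (r < 40)%N -> reg s' r = reg s r by move=> r40; rewrite ag ?(notin_below r40).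
by split; rewrite ?lt40 //; split; rewrite lt40.
Qed.

Variables (s0 : store) (W mv Rv nv b N Ns Nm : nat) (f g h : nat -> int).
Hypothesis regs0 : rot_regs s0 W mv Rv nv b.
Hypothesis arr_src : arr Ns W (mem s0 src) f.
Hypothesis arr_mat : arr Nm W (mem s0 mat) g.
Hypothesis arr_dst : arr N W (mem s0 dst) h.
Hypothesis src_size : (mv * Rv <= Ns)%N.
Hypothesis mat_size : (b + mv * nv <= Nm)%N.

Let g' i := g (b + i)%N.
Let inputs s := mem s src = mem s0 src /\ mem s mat = mem s0 mat.

Lemma inputs_agree c i s s' : i \in [:: 0; 1; 2]%N ->
  c = nth Skip [:: rot; rot_row; rot_entry] i ->
  agree c s s' -> inputs s -> inputs s'.
Proof. by move=> i3 -> [_ am] [i1 i2]; split; rewrite am ?rot_modt. Qed.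

Lemma rot_entryP s r q H : rot_regs s W mv Rv nv b -> inputs s ->
  (r < Rv)%N -> (q < nv)%N ->
  let e := (r * nv + q)%N in
  reg s 40 = (e * W)%N -> reg s 46 = (r * W)%N -> reg s 47 = ((b + q) * W)%N ->
  arr N W (mem s dst) H ->
  arr N W (mem (sem rot_entry s) dst) (upd H e (H e + rotf mv Rv nv f g' e)).
Proof.
move=> regs inp rR qn e e40 e46 e47 hH.
have [_ _ _ [_ Em _ _]] := regs.
pose part k := \sum_(p < k) f (p * Rv + r)%N * g' (p * nv + q)%N.
pose I k s' := [/\ reg s' 46 = ((k * Rv + r) * W)%N, reg s' 47 = ((b + (k * nv + q)) * W)%N &
  arr N W (mem s' dst) (upd H e (H e + part k))].
suff [_ _] : I mv (sem rot_entry s).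
  apply: eq_arr => e' _; rewrite !updE; case: eqP => // _; congr (_ + _).
  apply: eq_bigr => p _; rewrite /e divnMDl; last by lia.
  by rewrite modnMDl divn_small // modn_small // addn0.
rewrite -Em; apply: sem_For; first exact: rot_entry_wf.
  rewrite /I /= !updE /= mul0n add0n e46 e47; split=> //.
  apply: eq_arr hH => e' _; rewrite updE /part big_ord0 addr0.
  by case: eqP => // ->.
move=> k s' kW ag _ [i46 i47 ia].
have [z EW E10 [_ Em' ER En]] := rot_regs_agree (c := rot_entry) isT ag regs.
have [im is'] : inputs s' by apply: (@inputs_agree rot_entry 2) ag inp.
have e40' : reg s' 40 = (e * W)%N by case: ag => -> //.
have ia' := @fma_arr dst src mat 40 46 47 s' N Ns Nm _ f g e (k * Rv + r)%N
  (b + (k * nv + q))%N sd md isT isT isT z.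
rewrite EW im is' in ia'; rewrite Em in kW.
have {}ia' := ia' _ e40' i46 i47 ia arr_src arr_mat.
have {}ia' : arr N W (mem (sem (fma dst src mat 40 46 47) s') dst)
    (upd H e (H e + part k.+1)).
  apply: eq_arr (ia' _ _); try by nia.
  move=> e' _; rewrite !updE eqxx; case: eqP => // _.
  by rewrite /part big_ord_recr /= addrA.
set s1 := sem (fma dst src mat 40 46 47) s' in ia'.
have fr r' : (r' < 50)%N -> reg s1 r' = reg s' r'.
  by move=> r50; rewrite frame_reg // (notin_below r50).
rewrite -[sem _ s']/(sem (addw 47 n) (sem (addw 46 R) s1)).
have R46 : (46 == R) = false by lia.
have R47 : (47 == n) = false by lia.
set s2 := sem (addw 46 R) s1; set s3 := sem (addw 47 n) s2.
have s2E r' : (r' < 40)%N || (r' == 47%N) -> reg s2 r' = reg s1 r'.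
  by move=> hr; rewrite frame_reg //= !inE; lia.
have f46 : reg s3 46 = ((k.+1 * Rv + r) * W)%N.
  rewrite frame_reg // addwP //; try lia.
  by rewrite !fr //; lia.
have f47 : reg s3 47 = ((b + (k.+1 * nv + q)) * W)%N.
  rewrite addwP //; try lia.
  by rewrite !s2E ?n40 // !fr //; lia.
have m3 : mem s3 dst = mem s1 dst by rewrite frame_mem // frame_mem.
by clearbody s3; rewrite /I /= !updE /= f46 f47 m3; split.
Qed.

Definition filled (H : nat -> int) lo hi e :=
  if (lo <= e < hi)%N then H e + rotf mv Rv nv f g' e else H e.

Lemma filledS H lo hi e : (lo <= hi)%N ->
  upd (filled H lo hi) hi (filled H lo hi hi + rotf mv Rv nv f g' hi) e = filled H lo hi.+1 e.
Proof.
move=> lh; rewrite updE /filled ltnn andbF ltnS (leq_eqVlt e).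
by case: eqP => [->|_]; rewrite ?lh.
Qed.

Lemma rot_rowP s r H : rot_regs s W mv Rv nv b -> inputs s -> (r < Rv)%N ->
  reg s 40 = (r * nv * W)%N -> reg s 41 = (r * W)%N -> reg s 45 = (b * W)%N ->
  arr N W (mem s dst) H ->
  arr N W (mem (sem rot_row s) dst) (filled H (r * nv) (r.+1 * nv)) /\
  reg (sem rot_row s) 40 = (r.+1 * nv * W)%N.
Proof.
move=> regs inp rR e40 e41 e45 hH.
have [_ _ _ [_ _ _ En]] := regs.
pose I k s' := [/\ reg s' 40 = ((r * nv + k) * W)%N, reg s' 45 = ((b + k) * W)%N &
  arr N W (mem s' dst) (filled H (r * nv) (r * nv + k))].
suff [h1 _ h2] : I nv (sem rot_row s) by rewrite mulSn [(nv + _)%N]addnC.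
rewrite -En; apply: sem_For; first exact: rot_row_wf.
  rewrite /I /= !updE /= !addn0 e40 e45; split=> //.
  by apply: eq_arr hH => e _; rewrite /filled; case: ltngtP.
move=> k s' kn ag _ [i40 i45 ia].
have regs' := rot_regs_agree (c := rot_row) isT ag regs.
have inp' : inputs s' by apply: (@inputs_agree rot_row 1) ag inp.
have e41' : reg s' 41 = (r * W)%N by case: ag => -> //.
rewrite En in kn.
pose s1 := sem (Mov 46 41;; Mov 47 45) s'; pose s2 := sem rot_entry s1.
pose s3 := sem (addw 40 10) s2; pose s4 := sem (addw 45 10) s3.
rewrite -[sem _ s']/s4.
have regs1 : rot_regs s1 W mv Rv nv b.
  by apply: (rot_regs_agree (c := Mov 46 41;; Mov 47 45)) regs' => //; apply: frame.
have regs2 : rot_regs s2 W mv Rv nv b.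
  by apply: (rot_regs_agree (c := rot_entry)) regs1 => //; apply: frame.
have regs3 : rot_regs s3 W mv Rv nv b.
  by apply: (rot_regs_agree (c := addw 40 10)) regs2 => //; apply: frame.
have hE := @rot_entryP s1 r k _ regs1 inp' rR kn i40 e41' i45 ia.
have m4 : mem s4 dst = mem s2 dst by rewrite frame_mem // frame_mem.
have [_ W2 T2 _] := regs2; have [_ W3 T3 _] := regs3.
have e4 : reg s4 40 = ((r * nv + k.+1) * W)%N.
  have -> : reg s4 40 = reg s3 40 by rewrite frame_reg.
  rewrite addwP // T2 W2; have -> : reg s2 40 = reg s' 40 by rewrite frame_reg.
  by rewrite i40; lia.
have e5 : reg s4 45 = ((b + k.+1) * W)%N.
  rewrite addwP // T3 W3; have -> : reg s3 45 = reg s' 45 by rewrite frame_reg // frame_reg.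
  by rewrite i45; lia.
have {}hE : arr N W (mem s4 dst) (filled H (r * nv) (r * nv + k.+1)).
  rewrite m4; apply: eq_arr hE => e _.
  by rewrite filledS ?leq_addr // addnS.
by clearbody s4; rewrite /I /= !updE /= e4 e5; split.
Qed.

Lemma rotP : arr N W (mem (sem rot s0) dst)
  (fun e => if (e < Rv * nv)%N then h e + rotf mv Rv nv f g' e else h e).
Proof.
pose I k s' := [/\ reg s' 40 = (k * nv * W)%N, reg s' 41 = (k * W)%N &
  arr N W (mem s' dst) (filled h 0 (k * nv))].
have [_ _ _ [Ep _ ER _]] := regs0.
pose si := sem (Zero 40;; Zero 41) s0.
have regsi : rot_regs si W mv Rv nv b.
  by apply: (rot_regs_agree (c := Zero 40;; Zero 41)) regs0 => //; apply: frame.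
suff [_ _] : I Rv (sem (For 42 R (Mov 45 pm;; rot_row;; addw 41 10)) si) by [].
have [_ _ _ [_ _ ERi _]] := regsi.
rewrite -[in I _]ERi; apply: sem_For; first by case/and3P: rot_wf.
  rewrite /I /= !updE /= mul0n; split=> //.
move=> k s' kR ag _ [i40 i41 ia]; rewrite ERi in kR.
have regs' := rot_regs_agree (c := For 42 R (Mov 45 pm;; rot_row;; addw 41 10)) isT ag regsi.
have inp' : inputs s'.
  by case: ag => _ am; split; rewrite am //; apply: (@rot_modt 0).
pose s1 := sem (Mov 45 pm) s'; pose s2 := sem rot_row s1; pose s3 := sem (addw 41 10) s2.
rewrite -[sem _ s']/s3.
have regs1 : rot_regs s1 W mv Rv nv b.
  by apply: (rot_regs_agree (c := Mov 45 pm)) regs' => //; apply: frame.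
have regs2 : rot_regs s2 W mv Rv nv b.
  by apply: (rot_regs_agree (c := rot_row)) regs1 => //; apply: frame.
have [_ W2 T2 _] := regs2; have [_ _ _ [Ep' _ _ _]] := regs'.
have [h1 h2] := @rot_rowP s1 k _ regs1 inp' kR i40 i41 Ep' ia.
have e40 : reg s3 40 = (k.+1 * nv * W)%N by rewrite frame_reg.
have e41 : reg s3 41 = (k.+1 * W)%N.
  rewrite addwP // T2 W2; have -> : reg s2 41 = reg s' 41 by rewrite frame_reg.
  by rewrite i41; lia.
have {}h1 : arr N W (mem s3 dst) (filled h 0 (k.+1 * nv)).
  rewrite frame_mem //; apply: eq_arr h1 => e _; rewrite /filled /=.
  have kk : (k * nv <= k.+1 * nv)%N by rewrite leq_mul2r leqnSn orbT.
  case: (ltnP e (k * nv)) => ek; last by [].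
  by rewrite (leq_trans ek kk).
by clearbody s3; rewrite /I /= !updE /= e40 e41; split.
Qed.

End Rot.
End Words.

(** * Parsing *)

Section Parsing.
Local Open Scope ring_scope.

Definition isS1 (y : sym) : bool := if y is S1 then true else false.
Definition isSep (y : sym) : bool := if y is Sep then true else false.

Definition bval (bs : seq sym) : nat := (\sum_(i < size bs) isS1 (nth S0 bs i) * 2 ^ i)%N.

Lemma bval_cons y bs : bval (y :: bs) = (isS1 y + 2 * bval bs)%N.
Proof.
rewrite /bval big_ord_recl /= expn0 muln1; congr addn.
by rewrite big_distrr; apply: eq_bigr => i _ /=; rewrite expnS; ring.
Qed.

Lemma binf_val f n : (n <= f)%N -> bval (binf f n) = n.
Proof.
elim: f n => [|f IH] n nf; first by rewrite /bval big_ord0; lia.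
rewrite /=; case: eqP => [->|/eqP n0]; first by rewrite /bval big_ord0.
rewrite bval_cons IH; last by lia.
by rewrite -[RHS]odd_double_half -mul2n; case: odd.
Qed.

Lemma bin_val n : bval (bin n) = n.
Proof. exact: binf_val. Qed.

Lemma bin_nosep n : all (fun y => ~~ isSep y) (bin n).
Proof.
rewrite /bin; elim: n {2}n => //= f IH n.
by case: ifP => //= _; rewrite IH andbT; case: odd.
Qed.

Lemma wval_bits m W bs : (size bs <= W)%N ->
  (forall a, (a < W)%N -> m a = (a < size bs)%N && isS1 (nth S0 bs a)) ->
  wval m 0 W = bval bs.
Proof.
move=> sW mb; rewrite -(subnKC sW) wval_cat [X in (_ + _ * X)%N]wval_zero; last first.
  by move=> a aW; rewrite mb ?ltnNge; case: ltnP => //=; lia.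
rewrite muln0 addn0 /wval /bval; apply: eq_bigr => i _.
by rewrite mb ?add0n ?ltn_ord // (leq_trans (ltn_ord i)).
Qed.

Variables (x : seq sym) (W n k : nat).
Hypothesis xW : (size x <= W)%N.

Record env (s : store) : Prop := Env {
  env0 : reg s 0 = size x;
  env1 : reg s 1 = 0%N;
  env2 : reg s 2 = W;
  env3 : reg s 3 = n;
  env4 : reg s 4 = k;
  env10 : reg s 10 = 1%N;
  env_in : forall p, mem s 0 p = isS1 (nth S0 x p) /\ mem s 1 p = isSep (nth S0 x p);
  env_one : arr 1 W (mem s 2) (fun=> 1);
  env_mone : arr 1 W (mem s 3) (fun=> -1)
}.

Definition keeps_env (c : cmd) : bool :=
  all (fun r => r \notin modr c) [:: 0; 1; 2; 3; 4; 10]%N &&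
  all (fun t => t \notin modt c) [:: 0; 1; 2; 3]%N.

Lemma env_agree c s s' : keeps_env c -> agree c s s' -> env s -> env s'.
Proof.
case/andP => /allP rc /allP tc [ar am] [e0 e1 e2 e3 e4 e10 ei eo em].
split; rewrite ?ar ?rc //; rewrite ?am ?tc //.
Qed.

Lemma env_sem c s : keeps_env c -> env s -> env (sem c s).
Proof. by move=> kc; apply: env_agree kc (frame c s). Qed.

Definition rest (s : store) := drop (reg s 16) x.

Lemma rest_nth s p y : rest s = p ++ y -> forall i, (i < size p)%N ->
  nth S0 x (reg s 16 + i) = nth S0 p i.
Proof. by move=> E i ip; rewrite -nth_drop -/(rest s) E nth_cat ip. Qed.

(** The only available limit is the input length, so after the separator is reached the remaining
    rounds are idle. The final increment skips the separator. *)
Definition parse_nat : cmd :=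
  zero_arr 4 2;; Zero 33;;
  For 32 0 (IfBit 1 16 Skip (IfBit 0 16 (Wr 4 33 true) Skip;; Inc 33;; Inc 16));; Inc 16.

Lemma parse_natP s bs post : env s -> rest s = bs ++ Sep :: post ->
  all (fun y => ~~ isSep y) bs ->
  rest (sem parse_nat s) = post /\ arr 1 W (mem (sem parse_nat s) 4) (fun=> (bval bs)%:Z).
Proof.
move=> es Er bsep.
have sx : (reg s 16 + size bs < size x)%N.
  have := congr1 size Er; rewrite size_drop size_cat /=; lia.
pose s1 := sem (zero_arr 4 2;; Zero 33) s.
have es1 : env s1 by apply: (env_sem (c := zero_arr 4 2;; Zero 33)).
have p1 : reg s1 16 = reg s 16 by rewrite (@frame_reg (zero_arr 4 2;; Zero 33)).
pose c := For 32 0 (IfBit 1 16 Skip (IfBit 0 16 (Wr 4 33 true) Skip;; Inc 33;; Inc 16)).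
pose s2 := sem c s1.
pose I j s' := let jj := minn j (size bs) in
  [/\ reg s' 33 = jj, reg s' 16 = (reg s 16 + jj)%N &
   forall a, (a < W)%N -> mem s' 4 a = (a < jj)%N && isS1 (nth S0 bs a)].
have : I (reg s1 0) s2.
  apply: sem_For => //.
    rewrite /I min0n addn0; split=> // a aW; rewrite ltn0 /=.
    apply: (@zero_arrP 4 2 s) => //; by rewrite (env2 es).
  move=> j s' jx ag _ [i33 i16 im].
  have es' : env s' by apply: env_agree ag es1.
  rewrite (env0 es1) in jx.
  have [t0 t1] := env_in es' (reg s' 16).
  rewrite /= t1 i16; have [jb|jb] := ltnP j (size bs).
    have jj : minn j (size bs) = j by lia.
    have jj' : minn j.+1 (size bs) = j.+1 by lia.
    rewrite ?jj (rest_nth Er jb) (negbTE (all_nthP S0 bsep _ jb)).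
    rewrite i16 jj (rest_nth Er jb) in t0.
    rewrite t0 /I jj' /=; rewrite jj in i33 i16 im.
    case: ifP => b1; rewrite /= !updE /= i33 i16 addnS; split=> // a aW.
      rewrite updE; case: (a =P j) => [->|aj]; first by rewrite ltnSn b1.
      by rewrite im // ltnS [(a <= j)%N]leq_eqVlt; case: eqP aj.
    rewrite im // ltnS [(a <= j)%N]leq_eqVlt; case: eqP => //= ->.
    by rewrite ltnn b1.
  have jj : minn j (size bs) = size bs by lia.
  have jj' : minn j.+1 (size bs) = size bs by lia.
  rewrite ?jj -nth_drop -/(rest s) Er nth_cat ltnn subnn /=.
  by rewrite /I jj' /= !updE /= i33 i16 jj; split=> //; rewrite -jj.
rewrite /I (env0 es1) (_ : minn _ _ = size bs); last by lia.
case=> _ f16 fm.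
rewrite -[sem parse_nat s]/(set_reg s2 16 (reg s2 16).+1).
clearbody s2; split.
  by rewrite /rest /= updE /= f16 -addnS addnC -drop_drop -/(rest s) Er -cat_rcons drop_size_cat ?size_rcons.
move=> e; rewrite ltnS leqn0 => /eqP ->; rewrite mul0n (@wval_bits _ _ bs) //; lia.
Qed.

(** The sign selects the constant word, 1 or -1, by which the magnitude is multiplied before it is
    added to the target. *)
Definition parse_int (dst : nat) : cmd :=
  IfBit 0 16 (Mov 34 10) (Zero 34);; Inc 16;; parse_nat;;
  IfEq 34 1 (fma dst 4 2 18 1 1) (fma dst 4 3 18 1 1).

Lemma parse_intP dst s z post N f e : (4 < dst)%N -> env s ->
  rest s = enc_int z ++ Sep :: post -> reg s 18 = (e * W)%N ->
  arr N W (mem s dst) f ->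
  rest (sem (parse_int dst) s) = post /\
  arr N W (mem (sem (parse_int dst) s) dst) (upd f e (f e + z)).
Proof.
move=> d4 es Er e18 af.
pose c := IfBit 0 16 (Mov 34 10) (Zero 34);; Inc 16.
pose s1 := sem c s; pose s2 := sem parse_nat s1.
have es1 : env s1 by apply: (env_sem (c := c)).
have es2 : env s2 by apply: (env_sem (c := parse_nat)).
have [b [bs [Ez bsep]]] : exists b bs, enc_int z = (if b then S1 else S0) :: bs /\
    all (fun y => ~~ isSep y) bs.
  by case: z Er => m _; [exists false, (bin m) | exists true, (bin m.+1)]; rewrite bin_nosep.
have Vz : z = (if b then - (bval bs)%:Z else (bval bs)%:Z).
  by case: z Er Ez => m _ []; case: b => // _ <-; rewrite bin_val ?NegzE.
have s1E : reg s1 34 = b /\ reg s1 16 = (reg s 16).+1.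
  have [t0 _] := env_in es (reg s 16).
  rewrite -[reg s 16]addn0 (rest_nth (p := enc_int z) Er) ?Ez // addn0 in t0.
  rewrite /s1 /= t0 /=; case: b {Ez Vz t0} => /=; rewrite !updE /= ?updE //=.
  by rewrite (env10 es).
have r1 : rest s1 = bs ++ Sep :: post.
  by rewrite /rest (s1E.2) -addn1 addnC -drop_drop -/(rest s) Er Ez /= drop0.
have [r2 m2] := parse_natP es1 r1 bsep.
have d34 : reg s2 34 = b by rewrite frame_reg // (s1E.1).
have e18' : reg s2 18 = (e * W)%N.
  rewrite frame_reg // -e18; have := frame_reg (c := c) s (r := 18); exact.
have dn : dst != 4%N by lia.
have md : mem s2 dst = mem s dst.
  rewrite frame_mem; last by rewrite /= !inE (negbTE dn).
  by apply: (@frame_mem c).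
rewrite -[sem (parse_int dst) s]/(if reg s2 34 == reg s2 1
  then sem (fma dst 4 2 18 1 1) s2 else sem (fma dst 4 3 18 1 1) s2).
rewrite d34 (env1 es2) -md in af *.
have e0 : reg s2 1 = (0 * W)%N by rewrite (env1 es2).
pose o : nat := if b then 3%N else 2%N; pose sg : int := if b then -1 else 1.
have -> : (if b == 0%N :> nat then sem (fma dst 4 2 18 1 1) s2
    else sem (fma dst 4 3 18 1 1) s2) = sem (fma dst 4 o 18 1 1) s2 by rewrite /o; case: b {o sg Ez s1E d34 Vz}.
have ao : arr 1 W (mem s2 o) (fun=> sg).
  by rewrite /o /sg; case: (b); [apply: env_mone es2 | apply: env_one es2].
have od : o != dst by rewrite /o; case: (b); lia.
split; first by rewrite /rest frame_reg.
have -> : z = (bval bs)%:Z * sg by rewrite Vz /sg; case: (b); rewrite ?mulrN1 ?mulr1.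
have := @fma_arr dst 4 o 18 1 1 s2 N 1 1 f (fun=> (bval bs)%:Z) (fun=> sg) e 0 0.
by rewrite (env2 es2); apply => //; try exact: (env1 es2); rewrite 1?eq_sym //; lia.
Qed.

(** * Lists of fractions in memory *)

Definition fields (l : seq (int * int)) (e : nat) : int * int := nth (0, 0) l e.

(** Quantifying over all [N] says that the words after the last entry are zero modulo [2 ^ W], in
    accordance with the default [(0, 0)] of [fields]. Adding to the next word therefore sets it. *)
Definition ents (s : store) (l : seq (int * int)) :=
  reg s 18 = (size l * W)%N /\
  forall N, arr N W (mem s 8) (fun e => (fields l e).1) /\
            arr N W (mem s 9) (fun e => (fields l e).2).

(** Such specifications compose by concatenating both the consumed input and the produced fractions;
    padding is the case of empty [X]. *)
Definition proc (c : cmd) (X : seq sym) (ys : seq (int * int)) :=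
  forall s l post, env s -> ents s l -> rest s = X ++ post ->
    ents (sem c s) (l ++ ys) /\ rest (sem c s) = post.

Lemma proc_seq c d X X' ys ys' : keeps_env c -> proc c X ys -> proc d X' ys' ->
  proc (c;; d) (X ++ X') (ys ++ ys').
Proof.
move=> kc pc pd s l post es hl; rewrite -catA => Er.
have [hl' Er'] := pc s l _ es hl Er.
by have := pd _ _ post (env_sem kc es) hl' Er'; rewrite catA.
Qed.

Lemma ents_reg s l r v : r != 18%N -> ents s l -> ents (set_reg s r v) l.
Proof. by move=> r18 [h1 h2]; split=> //=; rewrite updE eq_sym (negbTE r18). Qed.

Lemma rest_reg s r v : r != 16%N -> rest (set_reg s r v) = rest s.
Proof. by move=> r16; rewrite /rest /= updE eq_sym (negbTE r16). Qed.

Lemma proc_for i j c m F G : wf (For i j c) -> keeps_env (For i j c) ->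
  (i \notin [:: 16; 18])%N -> (forall s, env s -> reg s j = m) ->
  (forall a, (a < m)%N -> proc c (F a) (G a)) ->
  proc (For i j c) (flatten (map F (iota 0 m))) (flatten (map G (iota 0 m))).
Proof.
move=> wc kc; rewrite !inE negb_or => /andP[i16 i18] jm pc s l post es hl Er.
pose I a s' := ents s' (l ++ flatten (map G (iota 0 a))) /\
  rest s' = flatten (map F (iota a (m - a))) ++ post.
suff [h1] : I m (sem (For i j c) s) by rewrite subnn.
rewrite -(jm _ es); apply: sem_For => //.
  by rewrite /I cats0 subn0 rest_reg //; split=> //; apply: ents_reg.
rewrite jm // => a s' am ag _ [hl' Er'].
have es' := env_agree kc ag es.
rewrite (_ : m - a = (m - a.+1).+1)%N /= in Er'; last by lia.
rewrite -catA in Er'.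
have [h1 h2] := pc a am _ _ _ es' hl' Er'.
split; last by rewrite rest_reg.
by apply: ents_reg => //; rewrite -[a.+1]addn1 iotaD map_cat flatten_cat /= cats0 catA.
Qed.

Lemma ents_next s l z d : env s -> reg s 18 = (size l * W)%N ->
  (forall N, arr N W (mem s 8) (upd (fun e => (fields l e).1) (size l) z)) ->
  (forall N, arr N W (mem s 9) (upd (fun e => (fields l e).2) (size l) d)) ->
  ents (sem (addw 18 10) s) (l ++ [:: (z, d)]).
Proof.
move=> es e18 h8 h9; split.
  by rewrite addwP // (env10 es) (env2 es) e18 size_cat /=; lia.
have F e : fields (l ++ [:: (z, d)]) e = if e == size l then (z, d) else fields l e.
  rewrite /fields nth_cat; case: (ltngtP e (size l)) => [//|le|->]; last by rewrite subnn.
  by rewrite !nth_default //= ?subn_gt0 // ltnW.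
move=> N; rewrite !frame_mem //; split.
  by apply: eq_arr (h8 N) => e _; rewrite F updE; case: eqP.
by apply: eq_arr (h9 N) => e _; rewrite F updE; case: eqP.
Qed.

Definition parse_entry : cmd := parse_int 8;; parse_int 9;; addw 18 10.

Lemma fields_default l : fields l (size l) = (0, 0).
Proof. exact: nth_default. Qed.

Lemma proc_entry q : proc parse_entry (enc_rat q) [:: (numq q, denq q)].
Proof.
move=> s l post es [e18 hl] Er0.
have Er : rest s = enc_int (numq q) ++ Sep :: (enc_int (denq q) ++ [:: Sep]) ++ post.
  by rewrite Er0 /enc_rat -catA.
pose s1 := sem (parse_int 8) s; pose s2 := sem (parse_int 9) s1.
have es1 : env s1 by apply: env_sem.
have es2 : env s2 by apply: env_sem.
have r1 : rest s1 = enc_int (denq q) ++ Sep :: post.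
  have [-> _] := parse_intP (N := 0) (dst := 8) isT es Er e18 (hl 0).1.
  by rewrite -catA.
have e18' : reg s1 18 = (size l * W)%N by rewrite frame_reg.
have m9 : mem s1 9 = mem s 9 by rewrite frame_mem.
have h8 N := (parse_intP (dst := 8) isT es Er e18 (hl N).1).2.
have h9 N : arr N W (mem s2 9) (upd (fun e => (fields l e).2) (size l) (denq q)).
  have a9 : arr N W (mem s1 9) (fun e => (fields l e).2) by rewrite m9; case: (hl N).
  have [_] := parse_intP (dst := 9) isT es1 r1 e18' a9.
  by rewrite fields_default add0r.
have r2 : rest s2 = post.
  have a0 : arr 0 W (mem s1 9) (fun=> 0) by move=> e; rewrite ltn0.
  exact: (parse_intP (dst := 9) isT es1 r1 e18' a0).1.
have e18'' : reg s2 18 = (size l * W)%N by rewrite frame_reg.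
have m8 : mem s2 8 = mem s1 8 := @frame_mem (parse_int 9) s1 8 isT.
have h8' N : arr N W (mem s2 8) (upd (fun e => (fields l e).1) (size l) (numq q)).
  by rewrite m8 -[numq q]add0r -[X in X + _](congr1 fst (fields_default l)); apply: h8.
rewrite /parse_entry 2!semS -/s1 -/s2; move: s2 es2 e18'' r2 {m8} h8' h9 => s2 es2 q18 r2 h8' h9.
by split; [apply: ents_next | rewrite /rest frame_reg].
Qed.

(** Appends the fraction 0/1. The numerator word is already zero, so only the denominator is
    written. *)
Definition pad : cmd := fma 9 2 2 18 1 1;; addw 18 10.

Lemma pad_ents s l z : env s -> reg s 18 = (size l * W)%N ->
  (forall N, arr N W (mem s 8) (upd (fun e => (fields l e).1) (size l) z)) ->
  (forall N, arr N W (mem s 9) (fun e => (fields l e).2)) ->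
  ents (sem pad s) (l ++ [:: (z, 1)]).
Proof.
move=> es e18 h8 h9; pose s1 := sem (fma 9 2 2 18 1 1) s.
rewrite -[sem _ s]/(sem (addw 18 10) s1).
have es1 : env s1 by apply: env_sem.
have e18' : reg s1 18 = (size l * W)%N by rewrite frame_reg.
have m8 : mem s1 8 = mem s 8 by rewrite frame_mem.
suff h9' N : arr N W (mem s1 9) (upd (fun e => (fields l e).2) (size l) 1).
  move: s1 es1 e18' m8 h9' => s1 es1 q18 m8 h9'; apply: ents_next => // N.
  by rewrite m8; apply: h8.
have := @fma_arr 9 2 2 18 1 1 s N 1 1 _ (fun=> 1) (fun=> 1) (size l) 0 0 isT isT isT isT isT (env1 es).
rewrite (env2 es) (env1 es) => /(_ _ e18 erefl erefl (h9 N) (env_one es) (env_one es) isT isT).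
by rewrite fields_default add0r mulr1.
Qed.

Lemma proc_pad : proc pad [::] [:: (0, 1)].
Proof.
move=> s l post es [e18 hl] Er; split; last by rewrite /rest frame_reg.
apply: pad_ents => // N; last by case: (hl N).
have [h _] := hl N; apply: eq_arr h => e _; rewrite updE; case: eqP => // ->.
by rewrite fields_default.
Qed.

Definition pad_with (o : nat) : cmd := fma 8 2 o 18 1 1;; pad.

Lemma proc_pad_with o z : (o \in [:: 2; 3])%N ->
  (forall s, env s -> arr 1 W (mem s o) (fun=> z)) -> proc (pad_with o) [::] [:: (z, 1)].
Proof.
move=> o23 oz s l post es [e18 hl] Er.
have o8 : o != 8%N by move: o23; rewrite !inE; lia.
split; last by rewrite /rest frame_reg.
pose s1 := sem (fma 8 2 o 18 1 1) s; rewrite -[sem _ s]/(sem pad s1).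
have es1 : env s1 by apply: env_sem.
have e18' : reg s1 18 = (size l * W)%N by rewrite frame_reg.
apply: pad_ents => // N; last by rewrite frame_mem //; case: (hl N).
have [h _] := hl N.
have := @fma_arr 8 2 o 18 1 1 s N 1 1 _ (fun=> 1) (fun=> z) (size l) 0 0 isT o8 isT isT isT (env1 es).
  rewrite (env2 es) (env1 es) => /(_ _ e18 erefl erefl h (env_one es) (oz s es) isT isT).
by rewrite fields_default add0r mul1r.
Qed.

End Parsing.

(** * Image-binary automata and sums of squares *)

Import Order.TTheory Num.Theory.

(** * The chain of reachable spaces *)

Section Reachable.
Local Open Scope ring_scope.
Variables (F : fieldType) (N : nat) (T : finType) (M : T -> 'M[F]_N) (u : seq T -> 'rV[F]_N).
Hypothesis u_rcons : forall w a, u (rcons w a) = u w *m M a.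

(** The matrix stands for its row space, the span of the [u w] with [size w <= i]; [sub_reach] and
    [reach_kill] express the two inclusions. *)
Fixpoint reach (i : nat) : 'M[F]_N :=
  if i is i'.+1 then (reach i' + \sum_a (reach i' *m M a))%MS else <<u [::]>>%MS.

Lemma sub_reach w i : (size w <= i)%N -> (u w <= reach i)%MS.
Proof.
elim: i w => [|i IH] w; first by case: w => // _; rewrite genmxE.
case/lastP: w => [_|w a]; first by apply: submx_trans (IH [::] _) (addsmxSl _ _).
rewrite size_rcons ltnS => wi; rewrite u_rcons.
apply: submx_trans (addsmxSr _ _); apply: (sumsmx_sup a) => //.
by apply: submxMr; apply: IH.
Qed.

(** [X] is general because the induction replaces it by [M a *m X]. *)
Lemma reach_kill i p (X : 'M[F]_(N, p)) :
  (forall w, (size w <= i)%N -> u w *m X = 0) -> reach i *m X = 0.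
Proof.
elim: i p X => [|i IH] p X uX.
  by apply/eqP; rewrite -sub_kermx genmxE sub_kermx uX.
apply/eqP; rewrite -sub_kermx addsmx_sub sub_kermx IH ?eqxx /=; last first.
  by move=> w wi; apply: uX; apply: leqW.
apply/sumsmx_subP => a _; rewrite sub_kermx -mulmxA IH // => w wi.
by rewrite mulmxA -u_rcons uX // size_rcons.
Qed.

Lemma reach_stable i j : (reach i.+1 <= reach i)%MS -> (reach (i + j) <= reach i)%MS.
Proof.
move=> st; elim: j => [|j IH]; first by rewrite addn0.
rewrite addnS /= addsmx_sub IH /=; apply/sumsmx_subP => a _.
apply: submx_trans (submxMr _ IH) _; apply: submx_trans st.
by apply: submx_trans (addsmxSr _ _); apply: (sumsmx_sup a).
Qed.

(* The chain of reachable spaces must stop growing before its [N]-th step. *)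
Lemma reach_all i : u [::] != 0 -> (reach i <= reach N.-1)%MS.
Proof.
move=> u0.
have mono j l : (reach j <= reach (j + l))%MS.
  elim: l => [|l IH]; first by rewrite addn0.
  by rewrite addnS; apply: submx_trans IH (addsmxSl _ _).
have [/existsP[j st]|/existsPn nst] := boolP [exists j : 'I_N, (reach j.+1 <= reach j)%MS].
  have jN : (j <= N.-1)%N by have := ltn_ord j; lia.
  apply: submx_trans (mono i j) _; rewrite addnC.
  by apply: submx_trans (reach_stable i st) _; rewrite -(subnKC jN).
suff : (N.+1 <= \rank (reach N))%N by rewrite ltnNge rank_leq_row.
suff rk j : (j <= N)%N -> (j.+1 <= \rank (reach j))%N by apply: rk.
elim: j => [_|j IH jN]; first by rewrite /= mxrank_gen lt0n mxrank_eq0.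
apply: leq_ltn_trans (IH (ltnW jN)) _.
rewrite ltnNge; apply: contra (nst (Ordinal jN)) => rk.
have [_] := mxrank_leqif_sup (addsmxSl (reach j) (\sum_a (reach j *m M a))%MS).
by move=> <-; rewrite eqn_leq rk andbT mxrankS // addsmxSl.
Qed.

Lemma vanish_short p (X : 'M[F]_(N, p)) :
  (forall w, (size w < N)%N -> u w *m X = 0) -> forall w, u w *m X = 0.
Proof.
(* Unless [u [::]] vanishes, the chain starts in rank at least 1. It is then constant from step
   [N - 1] on, which makes the lengths below [N] sufficient. *)
move=> short w; have [u0|u0] := eqVneq (u [::]) 0.
  suff -> : u w = 0 by rewrite mul0mx.
  by elim/last_ind: w => // w a IH; rewrite u_rcons IH mul0mx.
have N0 : (0 < N)%N.
  by rewrite lt0n; apply: contraNneq u0 => N0; move: (u [::]); rewrite N0 => v; rewrite thinmx0.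
apply/eqP; rewrite -sub_kermx; apply: submx_trans (sub_reach (leqnn (size w))) _.
apply: submx_trans (reach_all _ u0) _; rewrite sub_kermx reach_kill // => v vN.
by apply: short; lia.
Qed.

End Reachable.

Section Automaton.
Local Open Scope ring_scope.
Variable A : wautomaton.
Notation n := (wa_n A).
Notation k := (wa_k A).

Lemma wa_Mw_rcons w a : wa_Mw A (rcons w a) = wa_Mw A w *m wa_M A a.
Proof.
rewrite /wa_Mw; elim: w => [|b w IH] /=; first by rewrite mulmx1 mul1mx.
by rewrite IH mulmxA.
Qed.

(* [L w * (L w - 1)] is a linear function of the square of the vector
   [(alpha M(w), 1)], which lives in dimension [(n+1)^2]. *)
Lemma is_IFA_short :
  (forall w, (size w < n.+1 * n.+1)%N -> wa_L A w * (wa_L A w - 1) = 0) -> is_IFA A.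
Proof.
move=> short.
pose v w : 'rV[rat]_(n + 1) := row_mx (wa_alpha A *m wa_Mw A w) 1%:M.
pose B a : 'M[rat]_(n + 1) := block_mx (wa_M A a) 0 0 1%:M.
pose e1 : 'cV[rat]_(n + 1) := col_mx (wa_eta A) 0.
pose e2 : 'cV[rat]_(n + 1) := col_mx (wa_eta A) (- 1%:M).
pose u w := mxvec ((v w)^T *m v w).
pose U a := lin_mx (mulmxr (B a) \o mulmx (B a)^T).
(* The linear form [Y |-> e1^T Y e2], whose value on [(v w)^T *m v w] is the product of [v w *m e1]
   and [v w *m e2]. *)
pose X : 'M[rat]_((n + 1) * (n + 1), 1 * 1) := lin_mx (mulmxr e2 \o mulmx e1^T).
have vB w a : v (rcons w a) = v w *m B a.
  by rewrite /v /B mul_row_block !mulmx0 addr0 add0r mulmx1 wa_Mw_rcons mulmxA.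
have uU w a : u (rcons w a) = u w *m U a.
  by rewrite /u /U mul_vec_lin /= vB trmx_mul !mulmxA.
have v1 w : v w *m e1 = (wa_L A w)%:M.
  by rewrite mul_row_col mulmx0 addr0 [LHS]mx11_scalar.
have v2 w : v w *m e2 = (wa_L A w - 1)%:M.
  by rewrite mul_row_col mul1mx [LHS]mx11_scalar mxE [X in _ + X]mxE [X in - X]mxE.
have uX w : u w *m X = mxvec (wa_L A w * (wa_L A w - 1))%:M.
  rewrite /u /X mul_vec_lin /= mulmxA -trmx_mul v1 tr_scalar_mx -mulmxA v2.
  by rewrite -scalar_mxM.
have all0 w : u w *m X = 0.
  apply: (vanish_short uU) => w' sw; rewrite uX short ?raddf0 //.
  by move: sw; rewrite !addn1.
move=> w; have /eqP := all0 w; rewrite uX mxvec_eq0 => /eqP/matrixP/(_ 0 0).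
rewrite !mxE mulr1n => /eqP; rewrite mulf_eq0 subr_eq0.
by case/orP => /eqP; [left | right].
Qed.

(** The value 0 outside the range is what fills the last column of the augmented matrices, above the
    corner entry 1. *)
Definition ent m p (X : 'M[rat]_(m, p)) (i j : nat) : rat :=
  if insub i is Some i' then if insub j is Some j' then X i' j' else 0 else 0.

Lemma entE m p (X : 'M[rat]_(m, p)) (i : 'I_m) (j : 'I_p) : ent X i j = X i j.
Proof. by rewrite /ent !valK. Qed.

Definition letter (a : nat) : 'M[rat]_n := if insub a is Some a' then wa_M A a' else 0.

(* The automaton augmented by a state of constant value 1. *)
Definition aug_M (a p q : nat) : rat :=
  if (p < n)%N then ent (letter a) p q else (q == n)%:R.
Definition aug_alpha (q : nat) : rat := if (q < n)%N then ent (wa_alpha A) 0 q else 1.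
Definition aug_eta (z : rat) (q : nat) : rat := if (q < n)%N then ent (wa_eta A) q 0 else z.

End Automaton.

(** * Vectors indexed by words and the integer sums of squares *)

Section Vectors.
Local Open Scope ring_scope.
Variables (R : comRingType) (n1 : nat).

Definition dot (v g : nat -> R) : R := \sum_(p < n1) v p * g p.
Definition vecmat (g : nat -> nat -> R) (v : nat -> R) (q : nat) : R := dot v (g ^~ q).
Definition vec (g : nat -> nat -> nat -> R) (v : nat -> R) (w : seq nat) : nat -> R :=
  foldl (fun v a => vecmat (g a) v) v w.

Lemma vec_rcons g v w a : vec g v (rcons w a) = vecmat (g a) (vec g v w).
Proof. by rewrite /vec foldl_rcons. Qed.

End Vectors.

Section AutomatonVec.
Local Open Scope ring_scope.
Variable A : wautomaton.
Notation n := (wa_n A).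
Notation k := (wa_k A).

Definition ratvec (w : seq nat) : nat -> rat := vec n.+1 (aug_M A) (aug_alpha A) w.

Lemma ratvecE (w : seq 'I_k) :
  (forall q : 'I_n, ratvec (map val w) q = (wa_alpha A *m wa_Mw A w) 0 q) /\
  ratvec (map val w) n = 1.
Proof.
elim/last_ind: w => [|w a [IH1 IH2]].
  split=> [q|]; rewrite /ratvec /= /aug_alpha ?ltnn //.
  by rewrite ltn_ord mulmx1; apply: (entE (wa_alpha A) 0 q).
rewrite map_rcons /ratvec vec_rcons -/(ratvec _); split=> [q|].
  rewrite wa_Mw_rcons mulmxA mxE /vecmat /dot big_ord_recr /= {2}/aug_M ltnn.
  rewrite ltn_eqF // mulr0 addr0; apply: eq_bigr => p _.
  by rewrite IH1 /aug_M ltn_ord /letter valK entE.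
rewrite /vecmat /dot big_ord_recr /= IH2 {2}/aug_M ltnn eqxx mulr1 big1 ?add0r // => p _.
rewrite /aug_M ltn_ord /ent; case: insub => [p'|]; last by rewrite mulr0.
by rewrite insubN ?ltnn // mulr0.
Qed.

Lemma dot_eta (w : seq 'I_k) z :
  dot n.+1 (ratvec (map val w)) (aug_eta A z) = wa_L A w + z.
Proof.
have [h1 h2] := ratvecE w.
rewrite /dot big_ord_recr /= h2 {2}/aug_eta ltnn mul1r; congr (_ + _).
rewrite /wa_L mxE; apply: eq_bigr => q _.
by rewrite h1 /aug_eta ltn_ord (entE (wa_eta A) q 0).
Qed.

Fixpoint words (i : nat) : seq (seq nat) :=
  if i is i'.+1 then [seq rcons w a | w <- words i', a <- iota 0 k] else [:: [::]].

Lemma words_ord i (w : seq 'I_k) : size w = i -> map val w \in words i.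
Proof.
elim: i w => [|i IH] w; first by move=> /size0nil ->; rewrite inE.
case/lastP: w => // w a; rewrite size_rcons map_rcons => -[sw].
by apply: allpairs_f; [apply: IH | rewrite mem_iota /= add0n].
Qed.

Lemma ord_words i w : w \in words i -> exists2 w' : seq 'I_k, size w' = i & w = map val w'.
Proof.
elim: i w => [|i IH] w; first by rewrite inE => /eqP ->; exists [::].
case/allpairsP => -[v a] /= [/IH [v' sv ->]]; rewrite mem_iota => /andP[_ ak] ->.
by exists (rcons v' (Ordinal ak)); rewrite ?size_rcons ?sv // map_rcons.
Qed.

Lemma size_words i : size (words i) = (k ^ i)%N.
Proof. by elim: i => // i IH; rewrite size_allpairs IH size_iota expnSr. Qed.

Variables (D : int) (gM : nat -> nat -> nat -> int) (gA g1 g2 : nat -> int).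
Hypothesis D0 : D != 0.
Hypothesis gME : forall a p q, (a < k)%N -> (p < n.+1)%N -> (q < n.+1)%N ->
  (gM a p q)%:~R = D%:~R * aug_M A a p q.
Hypothesis gAE : forall q, (q < n.+1)%N -> (gA q)%:~R = D%:~R * aug_alpha A q.
Hypothesis g1E : forall q, (q < n.+1)%N -> (g1 q)%:~R = D%:~R * aug_eta A 0 q.
Hypothesis g2E : forall q, (q < n.+1)%N -> (g2 q)%:~R = D%:~R * aug_eta A (-1) q.

Definition intvec (w : seq nat) : nat -> int := vec n.+1 gM gA w.

(** The initial vector and each letter contribute one factor [D]. *)
Lemma intvecE (w : seq nat) q : all (ltn^~ k) w -> (q < n.+1)%N ->
  (intvec w q)%:~R = D%:~R ^+ (size w).+1 * ratvec w q :> rat.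
Proof.
elim/last_ind: w q => [|w a IH] q; first by rewrite expr1 => _; apply: gAE.
rewrite all_rcons => /andP[ak wk] qn.
rewrite /intvec /ratvec !vec_rcons -/(intvec w) -/(ratvec w) /vecmat /dot.
rewrite rmorph_sum size_rcons mulr_sumr; apply: eq_bigr => p _.
by rewrite rmorphM /= IH // gME // [in RHS]exprS; ring.
Qed.

Lemma intdotE (w : seq 'I_k) g z :
  (forall q, (q < n.+1)%N -> (g q)%:~R = D%:~R * aug_eta A z q) ->
  (dot n.+1 (intvec (map val w)) g)%:~R = D%:~R ^+ (size w).+2 * (wa_L A w + z) :> rat.
Proof.
move=> gE; rewrite -dot_eta /dot rmorph_sum mulr_sumr; apply: eq_bigr => q _.
rewrite rmorphM /= intvecE // ?gE // ?size_map; first by rewrite [in RHS]exprS; ring.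
by apply/allP => _ /mapP[a _ ->] /=.
Qed.

(** By [intdotE] a summand is the square of [L * (L - 1)] times a power of [D]. The summands are
    nonnegative integers, so the sum vanishes only if each of them does. *)
Definition defect (i : nat) : int :=
  \sum_(w <- words i) (dot n.+1 (intvec w) g1 * dot n.+1 (intvec w) g2) ^+ 2.

Lemma defectP : (forall i, (i < n.+1 * n.+1)%N -> defect i = 0) <-> is_IFA A.
Proof.
have D0' : (D%:~R : rat) != 0 by rewrite intr_eq0.
have key (w : seq 'I_k) :
    (dot n.+1 (intvec (map val w)) g1 * dot n.+1 (intvec (map val w)) g2 == 0) =
    (wa_L A w * (wa_L A w - 1) == 0).
  rewrite -(intr_eq0 rat) rmorphM /= (intdotE _ g1E) (intdotE _ g2E) addr0.
  have : (D%:~R : rat) ^+ (size w).+2 != 0 by apply: expf_neq0.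
  by move: (_ ^+ _) => E /negbTE E0; rewrite !mulf_eq0 !E0.
split=> [d0|ifa i _]; last first.
  rewrite /defect big_seq big1 // => _ /ord_words[w _ ->].
  apply/eqP; rewrite sqrf_eq0 key mulf_eq0 subr_eq0.
  by case: (ifa w) => ->; rewrite eqxx ?orbT.
apply: is_IFA_short => w sw; apply/eqP; rewrite -key.
have /eqP := d0 _ sw; rewrite /defect psumr_eq0; last by move=> *; apply: sqr_ge0.
by move/allP => /(_ _ (words_ord (erefl (size w)))); rewrite sqrf_eq0.
Qed.

Variable G : nat.
Hypothesis gMG : forall a p q, (a < k)%N -> (p < n.+1)%N -> (q < n.+1)%N -> `|gM a p q| <= G%:Z.
Hypothesis gAG : forall q, (q < n.+1)%N -> `|gA q| <= G%:Z.
Hypothesis g1G : forall q, (q < n.+1)%N -> `|g1 q| <= G%:Z.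
Hypothesis g2G : forall q, (q < n.+1)%N -> `|g2 q| <= G%:Z.

Lemma dot_le (v g : nat -> int) (B C : nat) :
  (forall q, (q < n.+1)%N -> `|v q| <= B%:Z) -> (forall q, (q < n.+1)%N -> `|g q| <= C%:Z) ->
  `|dot n.+1 v g| <= (n.+1 * C * B)%N%:Z.
Proof.
move=> vB gC; apply: le_trans (ler_norm_sum _ _ _) _.
apply: (@le_trans _ _ (\sum_(p < n.+1) (C * B)%N%:Z)).
  by apply: ler_sum => p _; rewrite normrM mulnC PoszM ler_pM ?vB ?gC.
by rewrite sumr_const card_ord -mulnA PoszM -mulr_natl natz.
Qed.

Lemma intvec_le w q : all (ltn^~ k) w -> (q < n.+1)%N ->
  `|intvec w q| <= ((n.+1 * G) ^ (size w).+1)%N%:Z.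
Proof.
elim/last_ind: w q => [|w a IH] q.
  by move=> _ qn; apply: le_trans (gAG qn) _; rewrite expn1 lez_nat leq_pmull.
rewrite all_rcons => /andP[ak wk] qn; rewrite /intvec vec_rcons size_rcons expnS.
by apply: dot_le => p pn; [apply: IH | apply: gMG].
Qed.

(** There are [k ^ i] words, and a summand is a product of four scalar products, each involving
    [i + 2] factors bounded by [n.+1 * G]. *)
Lemma defect_le i : `|defect i| <= (k ^ i * (n.+1 * G) ^ (4 * i.+2))%N%:Z.
Proof.
apply: le_trans (ler_norm_sum _ _ _) _; rewrite big_seq.
apply: (@le_trans _ _ (\sum_(w <- words i | w \in words i) ((n.+1 * G) ^ (4 * i.+2))%N%:Z)).
  apply: ler_sum => _ /ord_words[w sw ->].
  have dl g : (forall q, (q < n.+1)%N -> `|g q| <= G%:Z) ->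
      `|dot n.+1 (intvec (map val w)) g| <= ((n.+1 * G) ^ i.+2)%N%:Z.
    move=> gG; rewrite expnS; apply: dot_le => // q qn.
    rewrite -sw -(size_map val); apply: intvec_le => //.
    by apply/allP => _ /mapP[a _ ->] /=.
  rewrite normrX normrM (_ : 4 * i.+2 = (i.+2 + i.+2) * 2)%N; last first.
    by rewrite addnn -muln2 -mulnA mulnC.
  rewrite expnM -!natz natrX lerXn2r ?nnegrE ?mulr_ge0 // ?ler0n //.
  by rewrite expnD natrM ler_pM // natz dl.
by rewrite -big_seq big_const_seq count_predT size_words iter_addr_0 PoszM -mulr_natl natz.
Qed.

End AutomatonVec.

(** * Tensors *)

Section Tensors.
Local Open Scope ring_scope.
Variable N : nat.
Hypothesis N0 : (0 < N)%N.

(* Entry of a tensor product of vectors of dimension [N], first factor most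
   significant. *)
Fixpoint tensor (vs : seq (nat -> int)) (e : nat) : int :=
  if vs is v :: vs' then v (e %/ N ^ size vs')%N * tensor vs' (e %% N ^ size vs')%N else 1.

(** The leading index is not reduced modulo [N], so for empty [vs] the identity needs [e < N]. The
    second alternative accounts for indices out of range. *)
Lemma tensor_rcons vs u e : tensor (rcons vs u) e = tensor vs (e %/ N)%N * u (e %% N)%N \/ (N ^ (size vs).+1 <= e)%N.
Proof.
case: (leqP (N ^ (size vs).+1) e) => [|eN]; [by right | left].
elim: vs e eN => [|v vs IH] e eN /=.
  by rewrite expn0 divn1 mulr1 mul1r modn_small // -[N]expn1.
rewrite size_rcons IH; last by rewrite ltn_mod expn_gt0 N0.
rewrite !expnSr modn_dvdm ?dvdn_mull // -modn_divl mulrA; congr (v _ * _ * _).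
by rewrite mulnC divnMA.
Qed.

Lemma tensor_cons v vs p r : (r < N ^ size vs)%N ->
  tensor (v :: vs) (p * N ^ size vs + r)%N = v p * tensor vs r.
Proof.
move=> rN /=; have NN : (0 < N ^ size vs)%N by rewrite expn_gt0 N0.
by rewrite divnMDl // divn_small // addn0 modnMDl modn_small.
Qed.

Variables (I : Type) (r : seq I) (c : I -> int) (s : nat).

(** The rotation is linear, so it acts on a sum of pure tensors term by term: the leading factor is
    multiplied by the matrix and becomes the last one. *)
Lemma rot_matrix (v : I -> nat -> int) (vs : I -> seq (nat -> int)) f g e :
  (forall i, size (vs i) = s) ->
  (forall e, (e < N ^ s.+1)%N -> f e = \sum_(i <- r) c i * tensor (v i :: vs i) e) ->
  (e < N ^ s.+1)%N ->
  rotf N (N ^ s) N f g e =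
  \sum_(i <- r) c i * tensor (rcons (vs i) (vecmat N (fun p q => g (p * N + q)%N) (v i))) e.
Proof.
move=> sz fE eN; have eN' : (e %/ N < N ^ s)%N by rewrite ltn_divLR // -expnSr.
rewrite /rotf; under eq_bigr => p _.
  rewrite fE; last by have := ltn_ord p; rewrite expnS; nia.
  rewrite mulr_suml; under eq_bigr => i _ do rewrite -{1}(sz i) tensor_cons ?sz //.
  over.
rewrite exchange_big /=; apply: eq_bigr => i _.
have [->|] := tensor_rcons (vs i) (vecmat N (fun p q => g (p * N + q)%N) (v i)) e; last first.
  by rewrite sz leqNgt eN.
rewrite /vecmat /dot !mulr_sumr; apply: eq_bigr => p _; ring.
Qed.

Lemma rot_vector (v : I -> nat -> int) (vs : I -> seq (nat -> int)) f g e :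
  (forall i, size (vs i) = s) ->
  (forall e, (e < N ^ s.+1)%N -> f e = \sum_(i <- r) c i * tensor (v i :: vs i) e) ->
  (e < N ^ s)%N ->
  rotf N (N ^ s) 1 f g e = \sum_(i <- r) (c i * dot N (v i) g) * tensor (vs i) e.
Proof.
move=> sz fE eN; rewrite /rotf divn1 modn1; under eq_bigr => p _.
  rewrite fE; last by have := ltn_ord p; rewrite expnS; nia.
  rewrite mulr_suml; under eq_bigr => i _ do rewrite -{1}(sz i) tensor_cons ?sz //.
  rewrite muln1 addn0; over.
rewrite exchange_big /=; apply: eq_bigr => i _.
by rewrite /dot mulr_sumr mulr_suml; apply: eq_bigr => p _; ring.
Qed.

End Tensors.

(** Any tensor has an additional leading index of dimension 1; multiplying it by a matrix with the
    single row [g] appends the factor [g]. *)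
Lemma rot_outer N vs f g e : 0 < N ->
  (forall e, e < N ^ size vs -> f e = tensor N vs e) -> e < N ^ (size vs).+1 ->
  rotf 1 (N ^ size vs) N f g e = tensor N (rcons vs g) e.
Proof.
move=> N0 fE eN; have [->|] := tensor_rcons N0 vs g e; last by rewrite leqNgt eN.
rewrite /rotf big_ord1 mul0n add0n fE; last by rewrite ltn_divLR // -expnSr.
by rewrite mul0n add0n.
Qed.

(** * The main loop *)

Definition zrot (src dst mat pm m R n : nat) : cmd :=
  zero_arr dst 19;; rot src dst mat pm m R n.

(** The vector is a matrix with one column, so the new last index has dimension 1 and disappears. *)
Definition contract (i j : nat) (pm m : nat) : cmd := zrot i j 11 pm 5 m 10.

Definition apply_matrix (i j : nat) : cmd := zrot i j 11 22 5 7 5.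

Definition outer (i j m : nat) : cmd := zrot i j 11 23 10 m 5.

(* The word with index 0 is set to 1, the tensor of order 0. *)
Definition init_tensor : cmd :=
  zero_arr 12 19;; fma 12 2 2 1 1 1;;
  outer 12 13 10;; outer 13 12 5;; outer 12 13 6;; outer 13 14 7.

(** The two final vectors are used alternately, so a summand with four equal factors yields the
    square of the product of its two scalar products. *)
Definition check : cmd :=
  contract 14 12 24 7;; contract 12 13 25 6;; contract 13 12 24 5;; contract 12 13 25 10;;
  nonzero 13 15.

(** The fourth rotation is [rot] and not [zrot]: it does not clear track 15, where the contributions
    of the letters accumulate. *)
Definition add_letter : cmd :=
  apply_matrix 14 12;; apply_matrix 12 13;; apply_matrix 13 12;;
  rot 12 15 11 22 5 7 5;; addw 22 6.

(** The last command copies track 15 to track 14, as a multiplication by the 1 x 1 matrix whose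
    entry is the constant word 1. *)
Definition advance : cmd :=
  zero_arr 15 19;; Zero 22;; For 21 4 add_letter;; zrot 15 14 2 1 10 8 10.

Definition main_loop : cmd := init_tensor;; For 20 6 (check;; advance).

Section MainLoop.
Local Open Scope ring_scope.
Variables (W k N : nat) (sc : nat -> int).
Hypothesis N0 : (0 < N)%N.

(** The [k] augmented matrices are followed by the initial vector and two versions of the final
    vector. *)
Definition n_entries : nat := (k * N ^ 2 + 3 * N)%N.

Record menv (s : store) : Prop := MEnv {
  menv_regs : [/\ reg s 1 = 0, reg s 2 = W, reg s 4 = k & reg s 10 = 1]%N;
  menv_dims : [/\ reg s 5 = N, reg s 6 = N ^ 2, reg s 7 = N ^ 3, reg s 8 = N ^ 4 &
    reg s 19 = N ^ 4 * W]%N;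
  menv_ptrs : [/\ reg s 23 = k * N ^ 2 * W, reg s 24 = (k * N ^ 2 + N) * W &
    reg s 25 = (k * N ^ 2 + 2 * N) * W]%N;
  menv_sc : arr n_entries W (mem s 11) sc;
  menv_one : arr 1 W (mem s 2) (fun=> 1)
}.

Definition keeps_menv (c : cmd) : bool :=
  all (fun r => r \notin modr c) [:: 1; 2; 4; 10; 5; 6; 7; 8; 19; 23; 24; 25]%N &&
  all (fun t => t \notin modt c) [:: 2; 11]%N.

Lemma menv_agree c s s' : keeps_menv c -> agree c s s' -> menv s -> menv s'.
Proof.
case/andP => /allP rc /allP tc [ar am] [h1 h2 h3 h4 h5].
by split; rewrite ?ar ?rc //; rewrite ?am ?tc.
Qed.

Lemma menv_sem c s : keeps_menv c -> menv s -> menv (sem c s).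
Proof. by move=> kc; apply: menv_agree kc (frame c s). Qed.

Lemma zrotP src dst mat pm m R n s mv Rv nv b Ns Nm f g :
  src != dst -> mat != dst -> (pm < 40)%N -> (m < 40)%N -> (R < 40)%N -> (n < 40)%N ->
  menv s -> reg s pm = (b * W)%N -> reg s m = mv -> reg s R = Rv -> reg s n = nv ->
  arr Ns W (mem s src) f -> arr Nm W (mem s mat) g ->
  (mv * Rv <= Ns)%N -> (b + mv * nv <= Nm)%N -> forall M, (M <= Rv * nv)%N -> (M <= N ^ 4)%N ->
  arr M W (mem (sem (zrot src dst mat pm m R n) s) dst)
    (rotf mv Rv nv f (fun i => g (b + i)%N)).
Proof.
move=> sd md pm40 m40 R40 n40 ms Ep Em ER En hf hg sz1 sz2 M MR MN.
pose s1 := sem (zero_arr dst 19) s.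
rewrite -[sem (zrot _ _ _ _ _ _ _) s]/(sem (rot src dst mat pm m R n) s1).
have fr r : (r < 62)%N -> reg s1 r = reg s r by move=> r62; rewrite frame_reg //= inE ltn_eqF.
have [r1 r2 r4 r10] := menv_regs ms; have [_ _ _ _ r19] := menv_dims ms.
have rr : rot_regs pm m R n s1 W mv Rv nv b by split; rewrite ?fr //; try lia; split; rewrite fr //; lia.
have m1 t : t != dst -> mem s1 t = mem s t by move=> td; rewrite frame_mem //= inE.
have z := @zero_arr_arr dst 19 s (N ^ 4) W isT r19.
have := @rotP src dst mat pm m R n sd md pm40 m40 R40 n40 s1 W mv Rv nv b (N ^ 4) Ns Nm
  f g (fun=> 0) rr.
rewrite (m1 src) // (m1 mat) // => /(_ hf hg z sz1 sz2) h.
apply: eq_arr (arr_sub MN h) => e eM.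
by rewrite (leq_trans eM MR) add0r.
Qed.

Section Contract.
Variables (I : Type) (r : seq I) (v : I -> nat -> int) (c : I -> int).

(** The coefficients [c] collect the scalars produced by the previous contractions, so the lemma can
    be applied four times in a row. *)
Lemma contractP s i j pm m b d f vs :
  (d < 4)%N -> i != j -> j != 11%N -> (pm < 40)%N -> (m < 40)%N -> menv s ->
  reg s pm = (b * W)%N -> reg s m = (N ^ d)%N -> (b + N <= n_entries)%N ->
  (forall i, size (vs i) = d) ->
  arr (N ^ d.+1) W (mem s i) f ->
  (forall e, (e < N ^ d.+1)%N -> f e = \sum_(i <- r) c i * tensor N (v i :: vs i) e) ->
  arr (N ^ d) W (mem (sem (contract i j pm m) s) j)
   (fun e => \sum_(i <- r) (c i * dot N (v i) (fun q => sc (b + q)%N)) * tensor N (vs i) e).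
Proof.
move=> d4 ij j11 pm40 m40 ms Ep Em bE svs hf fE.
have [r1 r2 r4 r10] := menv_regs ms; have [r5 _ _ _ _] := menv_dims ms.
have le4 : (N ^ d <= N ^ 4)%N by apply: leq_pexp2l => //; apply: ltnW.
have := @zrotP i j 11 pm 5 m 10 s N (N ^ d) 1 b _ _ f sc ij _ pm40 isT m40 isT ms Ep r5 Em r10 hf (menv_sc ms).
have j11' : 11%N != j by rewrite eq_sym.
have leS : (N * N ^ d <= N ^ d.+1)%N by rewrite -expnS.
rewrite !muln1 => /(_ j11' leS bE (N ^ d)%N (leqnn _) le4) h.
by apply: eq_arr h => e eN; apply: rot_vector.
Qed.

Definition mat_of (a p q : nat) : int := sc (a * N ^ 2 + (p * N + q))%N.

Lemma apply_matrixP s i j a f vs :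
  i != j -> j != 11%N -> menv s -> (a < k)%N -> reg s 22 = (a * N ^ 2 * W)%N ->
  (forall i, size (vs i) = 3) ->
  arr (N ^ 4) W (mem s i) f ->
  (forall e, (e < N ^ 4)%N -> f e = \sum_(i <- r) c i * tensor N (v i :: vs i) e) ->
  arr (N ^ 4) W (mem (sem (apply_matrix i j) s) j)
   (fun e => \sum_(i <- r) c i * tensor N (rcons (vs i) (vecmat N (mat_of a) (v i))) e).
Proof.
move=> ij j11 ms ak E22 svs hf fE.
have j11' : 11%N != j by rewrite eq_sym.
have [r5 _ r7 _ _] := menv_dims ms.
have leS : (N * N ^ 3 <= N ^ 4)%N by rewrite -expnS.
have leS' : (N ^ 4 <= N ^ 3 * N)%N by rewrite -expnSr.
have bE : (a * N ^ 2 + N * N <= n_entries)%N by rewrite /n_entries; nia.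
have := @zrotP i j 11 22 5 7 5 s N (N ^ 3) N (a * N ^ 2) _ _ f sc ij j11' isT isT isT isT ms
  E22 r5 r7 r5 hf (menv_sc ms) leS bE (N ^ 4)%N leS' (leqnn _).
apply: eq_arr => e eN.
by rewrite (rot_matrix N0 (fun i => sc (a * N ^ 2 + i)%N) svs fE eN).
Qed.

End Contract.

Definition init_vec (q : nat) : int := sc (k * N ^ 2 + q)%N.

Lemma outerP s i j m d f vs :
  (d < 4)%N -> i != j -> j != 11%N -> (m < 40)%N -> menv s -> reg s m = (N ^ d)%N ->
  size vs = d -> arr (N ^ d) W (mem s i) f ->
  (forall e, (e < N ^ d)%N -> f e = tensor N vs e) ->
  arr (N ^ d.+1) W (mem (sem (outer i j m) s) j) (tensor N (rcons vs init_vec)).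
Proof.
move=> d4 ij j11 m40 ms Em svs hf fE; subst d.
have j11' : 11%N != j by rewrite eq_sym.
have [_ _ _ r10] := menv_regs ms; have [r5 _ _ _ _] := menv_dims ms; have [r23 _ _] := menv_ptrs ms.
have le1 : (1 * N ^ size vs <= N ^ size vs)%N by rewrite mul1n.
have bE : (k * N ^ 2 + 1 * N <= n_entries)%N by rewrite /n_entries; nia.
have leS' : (N ^ (size vs).+1 <= N ^ size vs * N)%N by rewrite -expnSr.
have leS : (N ^ (size vs).+1 <= N ^ 4)%N by apply: leq_pexp2l.
have := @zrotP i j 11 23 10 m 5 s 1 (N ^ size vs) N (k * N ^ 2) _ _ f sc ij j11' isT isT m40 isT ms
  r23 r10 Em r5 hf (menv_sc ms) le1 bE _ leS' leS.
by apply: eq_arr => e eN; apply: rot_outer.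
Qed.

Definition quad (v : nat -> int) : seq (nat -> int) := [:: v; v; v; v].

Lemma init_tensorP s : menv s ->
  arr (N ^ 4) W (mem (sem init_tensor s) 14) (tensor N (quad init_vec)).
Proof.
move=> ms.
have [r1 r2 _ r10] := menv_regs ms; have [r5 r6 r7 _ r19] := menv_dims ms.
pose s1 := sem (zero_arr 12 19) s; pose s2 := sem (fma 12 2 2 1 1 1) s1.
pose s3 := sem (outer 12 13 10) s2; pose s4 := sem (outer 13 12 5) s3.
pose s5 := sem (outer 12 13 6) s4.
rewrite /init_tensor 5!semS -/s1 -/s2 -/s3 -/s4 -/s5.
have ms1 : menv s1 by apply: menv_sem ms.
have ms2 : menv s2 by apply: menv_sem ms1.
have ms3 : menv s3 by apply: menv_sem ms2.
have ms4 : menv s4 by apply: menv_sem ms3.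
have ms5 : menv s5 by apply: menv_sem ms4.
have z := @zero_arr_arr 12 19 s (N ^ 4) W isT r19.
have h2 : arr (N ^ 0) W (mem s2 12) (tensor N [::]).
  have [q1 q2 _ _] := menv_regs ms1.
  have := @fma_arr 12 2 2 1 1 1 s1 1 1 1 (fun=> 0) (fun=> 1) (fun=> 1) 0 0 0 isT isT isT isT isT q1.
  rewrite q2 q1 => h.
  have z1 : arr 1 W (mem s1 12) (fun=> 0) by apply: arr_sub z; rewrite expn_gt0 N0.
  have := h erefl erefl erefl z1 (menv_one ms1) (menv_one ms1) isT isT.
  by apply: eq_arr => e; rewrite ltnS leqn0 => /eqP ->; rewrite updE /= add0r mulr1.
have q10 : reg s2 10 = (N ^ 0)%N by have [] := menv_regs ms2.
have q5 : reg s3 5 = (N ^ 1)%N by have [] := menv_dims ms3.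
have q6 : reg s4 6 = (N ^ 2)%N by have [] := menv_dims ms4.
have q7 : reg s5 7 = (N ^ 3)%N by have [] := menv_dims ms5.
have h3 := @outerP s2 12 13 10 0 _ [::] isT isT isT isT ms2 q10 erefl h2 (fun _ _ => erefl).
have h4 := @outerP s3 13 12 5 1 _ [:: _] isT isT isT isT ms3 q5 erefl h3 (fun _ _ => erefl).
have h5 := @outerP s4 12 13 6 2 _ [:: _; _] isT isT isT isT ms4 q6 erefl h4 (fun _ _ => erefl).
exact: (@outerP s5 13 14 7 3 _ [:: _; _; _] isT isT isT isT ms5 q7 erefl h5 (fun _ _ => erefl)).
Qed.

Definition eta1 (q : nat) : int := sc (k * N ^ 2 + N + q)%N.
Definition eta2 (q : nat) : int := sc (k * N ^ 2 + 2 * N + q)%N.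

Lemma checkP s (I : Type) (r : seq I) (v : I -> nat -> int) (S : int) : menv s ->
  arr (N ^ 4) W (mem s 14) (fun e => \sum_(i <- r) tensor N (quad (v i)) e) ->
  S = \sum_(i <- r) (dot N (v i) eta1 * dot N (v i) eta2) ^+ 2 ->
  reg (sem check s) 15 = if (S == 0 %[mod (2 ^ W)%N%:Z])%Z then reg s 15 else 1%N.
Proof.
move=> ms h SE.
pose s1 := sem (contract 14 12 24 7) s; pose s2 := sem (contract 12 13 25 6) s1.
pose s3 := sem (contract 13 12 24 5) s2; pose s4 := sem (contract 12 13 25 10) s3.
rewrite /check 4!semS -/s1 -/s2 -/s3 -/s4.
have ms1 : menv s1 by apply: menv_sem ms.
have ms2 : menv s2 by apply: menv_sem ms1.
have ms3 : menv s3 by apply: menv_sem ms2.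
have ms4 : menv s4 by apply: menv_sem ms3.
have q10 : reg s3 10 = (N ^ 0)%N by have [] := menv_regs ms3.
have q5 : reg s2 5 = (N ^ 1)%N by have [] := menv_dims ms2.
have q6 : reg s1 6 = (N ^ 2)%N by have [] := menv_dims ms1.
have q7 : reg s 7 = (N ^ 3)%N by have [] := menv_dims ms.
have [_ p24 _] := menv_ptrs ms; have [_ _ p25] := menv_ptrs ms1.
have [_ p24' _] := menv_ptrs ms2; have [_ _ p25'] := menv_ptrs ms3.
have b1 : (k * N ^ 2 + N + N <= n_entries)%N by rewrite /n_entries; lia.
have b2 : (k * N ^ 2 + 2 * N + N <= n_entries)%N by rewrite /n_entries; lia.
have h1 := @contractP I r v (fun=> 1) s 14 12 24 7 _ 3 _ (fun i => [:: v i; v i; v i])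
  isT isT isT isT isT ms p24 q7 b1 (fun _ => erefl) h.
have {}h1 := h1 (fun e _ => eq_bigr _ (fun i _ => esym (mul1r _))).
have h2 := @contractP I r v _ s1 12 13 25 6 _ 2 _ (fun i => [:: v i; v i])
  isT isT isT isT isT ms1 p25 q6 b2 (fun _ => erefl) h1 (fun _ _ => erefl).
have h3 := @contractP I r v _ s2 13 12 24 5 _ 1 _ (fun i => [:: v i])
  isT isT isT isT isT ms2 p24' q5 b1 (fun _ => erefl) h2 (fun _ _ => erefl).
have h4 := @contractP I r v _ s3 12 13 25 10 _ 0 _ (fun i => [::])
  isT isT isT isT isT ms3 p25' q10 b2 (fun _ => erefl) h3 (fun _ _ => erefl).
have [_ W4 _ T4] := menv_regs ms4.
rewrite nonzeroP // W4 -/s4.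
have -> : reg s4 15 = reg s 15 by rewrite !(@frame_reg (contract _ _ _ _)).
have := h4 0%N isT; rewrite mul0n -/s4 => E4.
suff -> : (wval (mem s4 13) 0 W == 0%N) = (S == 0 %[mod (2 ^ W)%N%:Z])%Z by [].
have -> : S = \sum_(i <- r) (1 * dot N (v i) eta1 * dot N (v i) eta2 * dot N (v i) eta1 * dot N (v i) eta2) * 1.
  by rewrite SE; apply: eq_bigr => i _; rewrite expr2; ring.
rewrite -[X in (X == _ %[mod _])%Z]/(\sum_(i <- r) _ * tensor N [::] 0) -E4 mod0z.
by rewrite modz_nat modn_small // wval_lt.
Qed.

Section Advance.
Variables (I : Type) (r : seq I) (v : I -> nat -> int).

Definition images (a e : nat) : int :=
  \sum_(i <- r) tensor N (quad (vecmat N (mat_of a) (v i))) e.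

Lemma add_letterP s a h : menv s -> (a < k)%N -> reg s 22 = (a * N ^ 2 * W)%N ->
  arr (N ^ 4) W (mem s 14) (fun e => \sum_(i <- r) tensor N (quad (v i)) e) ->
  arr (N ^ 4) W (mem s 15) h ->
  arr (N ^ 4) W (mem (sem add_letter s) 15) (fun e => h e + images a e) /\
  reg (sem add_letter s) 22 = (a.+1 * N ^ 2 * W)%N.
Proof.
move=> ms ak p22 hT hh.
pose s1 := sem (apply_matrix 14 12) s; pose s2 := sem (apply_matrix 12 13) s1.
pose s3 := sem (apply_matrix 13 12) s2; pose s4 := sem (rot 12 15 11 22 5 7 5) s3.
rewrite -[sem add_letter s]/(sem (addw 22 6) s4).
have ms1 : menv s1 by apply: menv_sem ms.
have ms2 : menv s2 by apply: menv_sem ms1.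
have ms3 : menv s3 by apply: menv_sem ms2.
have ms4 : menv s4 by apply: menv_sem ms3.
have p1 : reg s1 22 = (a * N ^ 2 * W)%N by rewrite frame_reg.
have p2 : reg s2 22 = (a * N ^ 2 * W)%N by rewrite frame_reg.
have p3 : reg s3 22 = (a * N ^ 2 * W)%N by rewrite frame_reg.
have p4 : reg s4 22 = (a * N ^ 2 * W)%N by rewrite frame_reg.
have h1 := @apply_matrixP I r v (fun=> 1) s 14 12 a _ (fun i => [:: v i; v i; v i])
  isT isT ms ak p22 (fun _ => erefl) hT (fun e _ => eq_bigr _ (fun i _ => esym (mul1r _))).
have h2 := @apply_matrixP I r v _ s1 12 13 a _ (fun i => [:: v i; v i; _])
  isT isT ms1 ak p1 (fun _ => erefl) h1 (fun _ _ => erefl).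
have h3 := @apply_matrixP I r v _ s2 13 12 a _ (fun i => [:: v i; _; _])
  isT isT ms2 ak p2 (fun _ => erefl) h2 (fun _ _ => erefl).
have [q1 q2 q4 q10] := menv_regs ms3; have [r5 r6 r7 _ _] := menv_dims ms3.
have rr : rot_regs 22 5 7 5 s3 W N (N ^ 3) N (a * N ^ 2) by split.
have hh' : arr (N ^ 4) W (mem s3 15) h by rewrite !frame_mem.
have leS : (N * N ^ 3 <= N ^ 4)%N by rewrite -expnS.
have bE : (a * N ^ 2 + N * N <= n_entries)%N by rewrite /n_entries; nia.
have := @rotP 12 15 11 22 5 7 5 isT isT isT isT isT isT s3 W N (N ^ 3) N (a * N ^ 2) (N ^ 4)
  (N ^ 4) n_entries _ sc h rr h3 (menv_sc ms3) hh' leS bE.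
rewrite -/s4 => h4; split; last first.
  have [_ W4 _ _] := menv_regs ms4; have [_ d6 _ _ _] := menv_dims ms4.
  by rewrite addwP // p4 d6 W4; lia.
rewrite frame_mem //; apply: eq_arr h4 => e eN.
rewrite -expnSr eN; congr (_ + _).
rewrite (@rot_matrix N N0 I r (fun=> 1) 3 v (fun i => [:: vecmat N (mat_of a) (v i);
  vecmat N (mat_of a) (v i); vecmat N (mat_of a) (v i)]) _ _ e) //.
by apply: eq_bigr => i _; rewrite mul1r.
Qed.

Lemma advanceP s : menv s ->
  arr (N ^ 4) W (mem s 14) (fun e => \sum_(i <- r) tensor N (quad (v i)) e) ->
  arr (N ^ 4) W (mem (sem advance s) 14) (fun e => \sum_(a <- iota 0 k) images a e).
Proof.
move=> ms hT.
pose s1 := sem (zero_arr 15 19;; Zero 22) s; pose s2 := sem (For 21 4 add_letter) s1.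
rewrite -[sem advance s]/(sem (zrot 15 14 2 1 10 8 10) s2).
have ms1 : menv s1 by apply: (menv_sem (c := zero_arr 15 19;; Zero 22)) ms.
have ms2 : menv s2 by apply: menv_sem ms1.
have [q1 q2 q4 q10] := menv_regs ms1; have [_ _ _ _ r19] := menv_dims ms.
pose J a s' := [/\ reg s' 22 = (a * N ^ 2 * W)%N,
  arr (N ^ 4) W (mem s' 14) (fun e => \sum_(i <- r) tensor N (quad (v i)) e) &
  arr (N ^ 4) W (mem s' 15) (fun e => \sum_(b <- iota 0 a) images b e)].
have [_ _ h2] : J (reg s1 4) s2.
  apply: sem_For => //.
    rewrite /J mul0n; split=> //.
      by rewrite [mem _ _](@frame_mem (zero_arr 15 19)).
    have := @zero_arr_arr 15 19 s (N ^ 4) W isT r19.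
    by apply: eq_arr => e _; rewrite big_nil.
  move=> a s' ak ag _ [i22 i14 i15]; rewrite q4 in ak.
  have ms' : menv s' by apply: menv_agree ag ms1.
  have [h15 h22] := add_letterP ms' ak i22 i14 i15.
  have h14 : mem (sem add_letter s') 14 = mem s' 14 by rewrite frame_mem.
  move: (sem add_letter s') h15 h22 h14 => s'' h15 h22 h14.
  split; [by rewrite /= updE | by rewrite [mem _ _]h14 | apply: eq_arr h15 => e _].
  by rewrite -[a.+1]addn1 iotaD big_cat /= big_seq1 add0n.
have [q1' q2' q4' q10'] := menv_regs ms2; have [_ _ _ r8 _] := menv_dims ms2.
have q1'' : reg s2 1 = (0 * W)%N by [].
have le1 : (1 * N ^ 4 <= N ^ 4)%N by rewrite mul1n.
have le2 : (N ^ 4 <= N ^ 4 * 1)%N by rewrite muln1.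
have := @zrotP 15 14 2 1 10 8 10 s2 1 (N ^ 4) 1 0 _ _ _ _ isT isT isT isT isT isT ms2
  q1'' q10' r8 q10' h2 (menv_one ms2) le1 isT _ le2 (leqnn _).
rewrite q4; apply: eq_arr => e eN.
by rewrite /rotf big_ord1 mul0n add0n divn1 mulr1.
Qed.

End Advance.

End MainLoop.

Section MainLoopCorrect.
Local Open Scope ring_scope.
Variables (A : wautomaton) (W : nat) (sc : nat -> int).
Notation N := (wa_n A).+1.
Notation k := (wa_k A).

Definition the_defect (i : nat) : int :=
  @defect A (mat_of N sc) (init_vec k N sc) (eta1 k N sc) (eta2 k N sc) i.

(** The flag in register 15 is never reset, so it is still 0 at the end exactly if all tests have
    found the residue 0. *)
Lemma main_loopP s : menv W k N sc s -> reg s 15 = 0%N ->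
  (reg (sem main_loop s) 15 == 0%N) =
  all (fun i => (the_defect i == 0 %[mod (2 ^ W)%N%:Z])%Z) (iota 0 (N * N)).
Proof.
move=> ms s15; pose s1 := sem init_tensor s; rewrite /main_loop semS -/s1.
have ms1 : menv W k N sc s1 by apply: menv_sem ms.
have h1 : reg s1 15 = 0%N := etrans (@frame_reg init_tensor s 15 isT) s15.
have hT1 := init_tensorP (ltn0Sn _) ms; rewrite -/s1 in hT1.
clearbody s1.
pose vw := intvec A (mat_of N sc) (init_vec k N sc).
pose J i s' :=
  arr (N ^ 4) W (mem s' 14) (fun e => \sum_(w <- words A i) tensor N (quad (vw w)) e) /\
  (reg s' 15 == 0%N) = all (fun i => (the_defect i == 0 %[mod (2 ^ W)%N%:Z])%Z) (iota 0 i).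
have [_ q6 _ _ _] := menv_dims ms1.
suff [_] : J (reg s1 6) (sem (For 20 6 (check;; advance)) s1) by rewrite q6.
have w0 : wf (For 20 6 (check;; advance)) by [].
apply: (sem_For w0).
  split; last by rewrite [reg _ 15]h1.
  by apply: eq_arr hT1 => e _; rewrite big_seq1.
move=> i s' iN ag _ [hT h15].
have ms' : menv W k N sc s' by apply: menv_agree ag ms1.
pose s2 := sem check s'; rewrite semS -/s2.
have ms2 : menv W k N sc s2 by apply: menv_sem ms'.
have hT2 : mem s2 14 = mem s' 14 := @frame_mem check s' 14 isT.
have h2 : reg s2 15 = if (the_defect i == 0 %[mod (2 ^ W)%N%:Z])%Z then reg s' 15 else 1%N.
  by apply: (checkP (ltn0Sn _) ms' hT).
clearbody s2.
have h3 : reg (sem advance s2) 15 = reg s2 15 := @frame_reg advance s2 15 isT.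
rewrite -hT2 in hT; have {}hT := advanceP (ltn0Sn _) ms2 hT.
move: (sem advance s2) h3 hT => s3 h3 hT; split; last first.
  rewrite [reg _ 15]h3 h2 -[i.+1]addn1 iotaD all_cat -h15 /= andbT add0n.
  by case: ifP; rewrite ?andbT ?andbF.
apply: eq_arr hT => e _ /=; rewrite big_allpairs_dep exchange_big /=.
by apply: eq_bigr => w _; apply: eq_bigr => a _; rewrite /vw /intvec vec_rcons.
Qed.

End MainLoopCorrect.

(** * Arithmetic on numbers of the header, common denominators *)

Definition mul (r a b : nat) : cmd := Zero r;; For 60 a (For 61 b (Inc r)).

Lemma mulP r a b s : r < 60 -> a < 60 -> b < 60 -> r != a -> r != b ->
  reg (sem (mul r a b) s) r = reg s a * reg s b.
Proof.
move=> r60 a60 b60 ra rb.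
have w1 : wf (For 61 b (Inc r)) by rewrite /= !inE; lia.
have w2 : wf (For 60 a (For 61 b (Inc r))) by rewrite /= !inE; lia.
pose s1 := sem (Zero r) s.
have sa : reg s1 a = reg s a by rewrite /= updE eq_sym (negbTE ra).
have sb : reg s1 b = reg s b by rewrite /= updE eq_sym (negbTE rb).
have sr : reg s1 r = 0 by rewrite /= updE eqxx.
rewrite -[sem (mul r a b) s]/(sem (For 60 a (For 61 b (Inc r))) s1) -sa -sb.
clearbody s1.
apply: (@sem_For _ _ _ _ (fun k s' => reg s' r = k * reg s1 b)) => //.
  by rewrite /= updE ltn_eqF.
move=> k s' ks [ag _] _ Ir.
have s2 : reg s' b = reg s1 b by apply: ag; rewrite /= !inE; lia.
rewrite [reg _ _]/= updE ltn_eqF //.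
have : reg (sem (For 61 b (Inc r)) s') r = reg s' r + reg s' b.
  apply: (@sem_For _ _ _ _ (fun k s'' => reg s'' r = reg s' r + k)) => //.
    by rewrite /= updE; case: eqP => [?|_]; lia.
  move=> k' s'' _ _ _ E /=; rewrite !updE eqxx E.
  by case: eqP => [?|_]; lia.
by move=> ->; rewrite Ir s2; lia.
Qed.

(* The number in track 4 is found by comparison with 0, 1, ... below the input
   length; the result is 0 if it is not among them. *)
Definition unary_step : cmd :=
  zero_arr 7 2;; fma 7 6 2 1 1 1;; fma 7 4 3 1 1 1;; Zero 34;; nonzero 7 34;;
  IfEq 34 1 (Mov 35 33) Skip;; fma 6 2 2 1 1 1.

Definition unary : cmd := Zero 35;; zero_arr 6 2;; For 33 0 unary_step.

(** The sources of [fma] must differ from its target, so the product is formed on track 4 and then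
    copied back to track 10. *)
Definition scale_factor : cmd :=
  IfEq 28 29 Skip (zero_arr 4 2;; fma 4 10 9 1 1 30;; zero_arr 10 2;; fma 10 4 2 1 1 1);;
  addw 30 10.

Definition scale_entry : cmd :=
  zero_arr 10 2;; fma 10 8 2 1 31 1;; Zero 30;; For 29 9 scale_factor;;
  fma 11 10 2 31 1 1;; addw 31 10.

Definition scale : cmd := Zero 31;; For 28 9 scale_entry.

Section Scalars.
Local Open Scope ring_scope.
Variables (x : seq sym) (W n k : nat).
Hypothesis xW : (size x <= W)%N.

Lemma unaryP s (v : nat) : env x W n k s -> arr 1 W (mem s 4) (fun=> v%:Z) -> (v < 2 ^ W)%N ->
  reg (sem unary s) 35 = if (v < size x)%N then v else 0%N.
Proof.
move=> es hv vW.
pose s1 := sem (Zero 35;; zero_arr 6 2) s.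
rewrite -[sem unary s]/(sem (For 33 0 unary_step) s1).
have es1 : env x W n k s1 by apply: (env_sem (c := Zero 35;; zero_arr 6 2)) es.
pose J c s' := [/\ arr 1 W (mem s' 6) (fun=> c%:Z), mem s' 4 = mem s 4 &
  reg s' 35 = if (v < c)%N then v else 0%N].
suff [_ _] : J (reg s1 0) (sem (For 33 0 unary_step) s1) by rewrite (env0 es1).
apply: sem_For => //.
  split; first by apply: (@zero_arr_arr 6 2) => //; rewrite mul1n; apply: env2 es.
    by rewrite [mem _ _](@frame_mem (Zero 35;; zero_arr 6 2)).
  by rewrite [LHS](@frame_reg (zero_arr 6 2)).
move=> c s' cx ag i33 [h6 h4 h35]; rewrite (env0 es1) in cx.
have es' : env x W n k s' by apply: env_agree ag es1.
pose s2 := sem (zero_arr 7 2) s'; pose s3 := sem (fma 7 6 2 1 1 1) s2.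
pose s4 := sem (fma 7 4 3 1 1 1) s3; pose s5 := sem (Zero 34) s4.
pose s6 := sem (nonzero 7 34) s5; pose s7 := sem (IfEq 34 1 (Mov 35 33) Skip) s6.
rewrite /unary_step 6!semS -/s2 -/s3 -/s4 -/s5 -/s6 -/s7.
have es2 : env x W n k s2 by apply: env_sem es'.
have es3 : env x W n k s3 by apply: env_sem es2.
have es4 : env x W n k s4 by apply: env_sem es3.
have es5 : env x W n k s5 by apply: env_sem es4.
have es6 : env x W n k s6 by apply: env_sem es5.
have es7 : env x W n k s7 by apply: env_sem es6.
have z : arr 1 W (mem s2 7) (fun=> 0).
  by apply: (@zero_arr_arr 7 2) => //; rewrite mul1n; apply: env2 es'.
have m26 : mem s2 6 = mem s' 6 by rewrite frame_mem.
have m34 : mem s3 4 = mem s 4 by rewrite !frame_mem.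
have m76 : mem s7 6 = mem s' 6 by rewrite !(@frame_mem (IfEq 34 1 (Mov 35 33) Skip)) // !frame_mem.
have h3 := @fma_arr 7 6 2 1 1 1 s2 1 1 1 (fun=> 0) (fun=> c%:Z) (fun=> 1) 0 0 0
  isT isT isT isT isT (env1 es2).
rewrite (env2 es2) (env1 es2) m26 in h3.
have {}h3 := h3 erefl erefl erefl z h6 (env_one es2) isT isT.
have hv' : arr 1 W (mem s3 4) (fun=> v%:Z) by rewrite m34.
have h7 := @fma_arr 7 4 3 1 1 1 s3 1 1 1 _ (fun=> v%:Z) (fun=> -1) 0 0 0
  isT isT isT isT isT (env1 es3).
rewrite (env2 es3) (env1 es3) in h7.
have {}h7 := h7 _ erefl erefl erefl h3 hv' (env_mone es3) isT isT.
have E7 : (wval (mem s4 7) 0 W == 0%N) = (c == v).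
  have := h7 0%N isT; rewrite !updE eqxx mul0n add0r mulr1 mulrN1 => E.
  (* Track 7 holds [c - v] modulo [2 ^ W]. Both numbers are below [2 ^ W], so this residue is 0 only
     if they are equal. *)
  have cW : (c < 2 ^ W)%N by apply: leq_trans cx _; apply: leq_trans xW (ltnW (ltn_expl _ _)).
  apply/idP/idP => [/eqP w0|/eqP cv].
    move: E; rewrite w0 mod0z => /esym/eqP; rewrite -{1}[0](mod0z (2 ^ W)%N) -/(_ == _ %[mod _])%Z.
    rewrite eqz_mod_dvd subr0 => dv.
    have : (c%:Z == v%:Z %[mod (2 ^ W)%N])%Z by rewrite eqz_mod_dvd.
    by rewrite !modz_nat !modn_small.
  by move: E; rewrite cv subrr mod0z modz_nat modn_small ?wval_lt // => -[->].
have h6' := @fma_arr 6 2 2 1 1 1 s7 1 1 1 (fun=> c%:Z) (fun=> 1) (fun=> 1) 0 0 0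
  isT isT isT isT isT (env1 es7).
rewrite (env2 es7) (env1 es7) m76 in h6'.
have {}h6' := h6' erefl erefl erefl h6 (env_one es7) (env_one es7) isT isT.
have r6 : reg s6 34 = if c == v then 0%N else 1%N.
  by rewrite nonzeroP // ?(env10 es5) // (env2 es5) -E7.
have r33 : reg s6 33 = c by rewrite !frame_reg.
have r35 : reg s6 35 = reg s' 35 by rewrite !frame_reg.
have r7 : reg s7 35 = if c == v then c else reg s' 35.
  rewrite /s7 -[sem _ s6]/(if reg s6 34 == reg s6 1 then set_reg s6 35 (reg s6 33) else s6).
  by rewrite r6 (env1 es6) r33; case: (c == v).
have r8 : reg (sem (fma 6 2 2 1 1 1) s7) 35 = reg s7 35 by rewrite frame_reg.
have m8 : mem (sem (fma 6 2 2 1 1 1) s7) 4 = mem s 4.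
  by rewrite frame_mem // (@frame_mem (IfEq 34 1 (Mov 35 33) Skip)) // !frame_mem.
move: (sem (fma _ _ _ _ _ _) s7) h6' r8 m8 => s8 h6' r8 m8; split => //.
  apply: eq_arr h6' => e; rewrite ltnS leqn0 => /eqP ->.
  by rewrite updE /= mulr1 -[c.+1]addn1 PoszD.
rewrite /= updE /= r8 r7 h35 ltnS [(v <= c)%N]leq_eqVlt [v == c]eq_sym.
by case: (c =P v) => [->|].
Qed.

End Scalars.

(** * Scaling by the common denominator *)

Section Scale.
Local Open Scope ring_scope.
Variables (W E : nat) (num den : nat -> int).

Record senv (s : store) : Prop := SEnv {
  senv1 : reg s 1 = 0%N;
  senv2 : reg s 2 = W;
  senv9 : reg s 9 = E;
  senv10 : reg s 10 = 1%N;
  senv_num : arr E W (mem s 8) num;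
  senv_den : arr E W (mem s 9) den;
  senv_one : arr 1 W (mem s 2) (fun=> 1)
}.

Definition keeps_senv (c : cmd) : bool :=
  all (fun r => r \notin modr c) [:: 1; 2; 9; 10]%N &&
  all (fun t => t \notin modt c) [:: 8; 9; 2]%N.

Lemma senv_agree c s s' : keeps_senv c -> agree c s s' -> senv s -> senv s'.
Proof.
case/andP => /allP rc /allP tc [ar am] [h1 h2 h3 h4 h5 h6 h7].
by split; rewrite ?ar ?rc //; rewrite ?am ?tc.
Qed.

Lemma senv_sem c s : keeps_senv c -> senv s -> senv (sem c s).
Proof. by move=> kc; apply: senv_agree kc (frame c s). Qed.

Definition cofactor_prod (e F : nat) : int := \prod_(f < F | f != e :> nat) den f.
(** For the parsed fractions this is the fraction times the product of all denominators, obtained by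
    omitting a factor instead of dividing by it. *)
Definition scaled (e : nat) : int := num e * cofactor_prod e E.

Lemma cofactor_prodS e F :
  cofactor_prod e F.+1 = if F == e then cofactor_prod e F else cofactor_prod e F * den F.
Proof. by rewrite /cofactor_prod big_mkcond big_ord_recr -big_mkcond /=; case: eqP; rewrite ?mulr1. Qed.

Lemma zero_word s t : senv s -> arr 1 W (mem (sem (zero_arr t 2) s) t) (fun=> 0).
Proof. by move=> es; apply: zero_arr_arr => //; rewrite mul1n; apply: senv2 es. Qed.

Lemma scale_factorP s (e f : nat) (z : int) : senv s -> (f < E)%N ->
  reg s 28 = e -> reg s 29 = f -> reg s 30 = (f * W)%N ->
  arr 1 W (mem s 10) (fun=> z) ->
  arr 1 W (mem (sem scale_factor s) 10) (fun=> if f == e then z else z * den f) /\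
  reg (sem scale_factor s) 30 = (f.+1 * W)%N.
Proof.
move=> es fE r28 r29 r30 hz.
pose c := zero_arr 4 2;; fma 4 10 9 1 1 30;; zero_arr 10 2;; fma 10 4 2 1 1 1.
pose s5 := if f == e then s else sem c s.
have -> : sem scale_factor s = sem (addw 30 10) s5.
  by rewrite /s5 eq_sym -r28 -r29.
have es5 : senv s5 by rewrite /s5; case: eqP => // _; apply: senv_sem es.
have r30' : reg s5 30 = (f * W)%N.
  by rewrite /s5; case: eqP => // _; rewrite frame_reg.
split; last by rewrite addwP // (senv10 es5) (senv2 es5) r30'; lia.
rewrite frame_mem // /s5; case: eqP => // _.
pose s1 := sem (zero_arr 4 2) s; pose s2 := sem (fma 4 10 9 1 1 30) s1.
pose s3 := sem (zero_arr 10 2) s2; rewrite -[sem c s]/(sem (fma 10 4 2 1 1 1) s3).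
have es1 : senv s1 by apply: senv_sem es.
have es2 : senv s2 by apply: senv_sem es1.
have es3 : senv s3 by apply: senv_sem es2.
have z1 := zero_word 4 es; have z3 := zero_word 10 es2.
have q30 : reg s1 30 = (f * W)%N by rewrite frame_reg.
have h10 : arr 1 W (mem s1 10) (fun=> z) by rewrite frame_mem.
have h2 := @fma_arr 4 10 9 1 1 30 s1 1 1 E (fun=> 0) (fun=> z) den 0 0 f
  isT isT isT isT isT (senv1 es1).
rewrite (senv2 es1) (senv1 es1) in h2.
have {}h2 := h2 erefl erefl q30 z1 h10 (senv_den es1) isT fE.
have h4 : arr 1 W (mem s3 4) (fun=> z * den f).
  rewrite frame_mem //; apply: eq_arr h2 => e'; rewrite ltnS leqn0 => /eqP ->.
  by rewrite updE /= add0r.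
have h5 := @fma_arr 10 4 2 1 1 1 s3 1 1 1 (fun=> 0) _ (fun=> 1) 0 0 0
  isT isT isT isT isT (senv1 es3).
rewrite (senv2 es3) (senv1 es3) in h5.
have {}h5 := h5 _ erefl erefl erefl z3 h4 (senv_one es3) isT isT.
apply: eq_arr h5 => e'; rewrite ltnS leqn0 => /eqP ->.
by rewrite updE /= add0r mulr1.
Qed.

Lemma scale_entryP s (e : nat) H : senv s -> (e < E)%N ->
  reg s 28 = e -> reg s 31 = (e * W)%N -> arr E W (mem s 11) H -> H e = 0 ->
  arr E W (mem (sem scale_entry s) 11) (upd H e (scaled e)) /\
  reg (sem scale_entry s) 31 = (e.+1 * W)%N.
Proof.
move=> es eE r28 r31 hH He.
pose s1 := sem (zero_arr 10 2) s; pose s2 := sem (fma 10 8 2 1 31 1) s1.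
pose s3 := sem (Zero 30) s2; pose s4 := sem (For 29 9 scale_factor) s3.
pose s5 := sem (fma 11 10 2 31 1 1) s4.
rewrite /scale_entry 5!semS -/s1 -/s2 -/s3 -/s4 -/s5.
have es1 : senv s1 by apply: senv_sem es.
have es2 : senv s2 by apply: senv_sem es1.
have es3 : senv s3 by apply: senv_sem es2.
have es4 : senv s4 by apply: senv_sem es3.
have es5 : senv s5 by apply: senv_sem es4.
have z1 := zero_word 10 es.
have q31 : reg s1 31 = (e * W)%N by rewrite frame_reg.
have h2 := @fma_arr 10 8 2 1 31 1 s1 1 E 1 (fun=> 0) num (fun=> 1) 0 e 0
  isT isT isT isT isT (senv1 es1).
rewrite (senv2 es1) (senv1 es1) in h2.
have {}h2 := h2 erefl q31 erefl z1 (senv_num es1) (senv_one es1) eE isT.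
have r28' : reg s3 28 = e by rewrite !frame_reg.
pose J f s' := arr 1 W (mem s' 10) (fun=> num e * cofactor_prod e f) /\
  reg s' 30 = (f * W)%N.
have [h4 _] : J (reg s3 9) s4.
  apply: sem_For => //.
    split; last by rewrite /= !updE.
    apply: eq_arr h2 => e'; rewrite ltnS leqn0 => /eqP ->.
    by rewrite updE /= add0r mulr1 /cofactor_prod big_ord0 mulr1.
  move=> f s' fE ag r29 [hf r30]; rewrite (senv9 es3) in fE.
  have es' : senv s' by apply: senv_agree ag es3.
  have q28 : reg s' 28 = e by case: ag => -> // _.
  have [h1 h3] := scale_factorP es' fE q28 r29 r30 hf.
  move: (sem scale_factor s') h1 h3 => s'' h1 h3; split; last by rewrite /= updE /= h3.
  apply: eq_arr h1 => e' _; rewrite cofactor_prodS.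
  by case: eqP => // _; rewrite mulrA.
rewrite (senv9 es3) in h4.
have q31' : reg s4 31 = (e * W)%N by rewrite !frame_reg.
have hH' : arr E W (mem s4 11) H by rewrite !frame_mem.
have h5 := @fma_arr 11 10 2 31 1 1 s4 E 1 1 H _ (fun=> 1) e 0 0
  isT isT isT isT isT (senv1 es4).
rewrite (senv2 es4) (senv1 es4) in h5.
have {}h5 := h5 _ q31' erefl erefl hH' h4 (senv_one es4) isT isT.
split; last first.
  have -> : (e.+1 * W = e * W + 1 * W)%N by lia.
  by rewrite addwP // (senv10 es5) (senv2 es5) frame_reg // q31'.
rewrite frame_mem //; apply: eq_arr h5 => e' _.
by rewrite !updE He add0r mulr1.
Qed.

Lemma scaleP s : senv s -> arr E W (mem s 11) (fun=> 0) ->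
  arr E W (mem (sem scale s) 11) scaled.
Proof.
move=> es z; pose s1 := sem (Zero 31) s.
have es1 : senv s1 by apply: senv_sem es.
pose J e s' := arr E W (mem s' 11) (fun i => if (i < e)%N then scaled i else 0) /\
  reg s' 31 = (e * W)%N.
have [h _] : J (reg s1 9) (sem (For 28 9 scale_entry) s1).
  apply: sem_For => //.
  move=> e s' eE ag r28 [h r31]; rewrite (senv9 es1) in eE.
  have es' : senv s' by apply: senv_agree ag es1.
  have He : (if (e < e)%N then scaled e else 0) = 0 by rewrite ltnn.
  have [h1 h2] := scale_entryP es' eE r28 r31 h He.
  move: (sem scale_entry s') h1 h2 => s'' h1 h2; split; last by rewrite /= updE /= h2.
  apply: eq_arr h1 => i _; rewrite updE ltnS [(i <= e)%N]leq_eqVlt.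
  by case: (i =P e) => [->|].
by apply: eq_arr h => e eE; rewrite (senv9 es1) eE.
Qed.

End Scale.

(** * The entries of the augmented automaton *)

Definition parse_row : cmd := For 27 3 parse_entry.
(** Each row of the letter is completed by 0; the additional last row, which is absent from the
    input, consists of zeros and a final 1. *)
Definition parse_letter : cmd := For 26 3 (parse_row;; pad);; For 26 3 pad;; pad_with 2.
Definition parse_vec (c : cmd) : cmd := parse_row;; c.
(* The final vector is read twice, to be completed by 0 and by -1. *)
Definition parse_body : cmd :=
  (For 21 4 parse_letter;; parse_vec (pad_with 2));;
  Mov 17 16;; parse_vec pad;; Mov 16 17;; parse_vec (pad_with 3).

Section Entries.
Local Open Scope ring_scope.

Definition frac (q : rat) : int * int := (numq q, denq q).

Lemma flatten_seq1 (T U : Type) (f : T -> U) s : flatten [seq [:: f i] | i <- s] = map f s.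
Proof. by elim: s => //= i s ->. Qed.

Lemma nth_flatten_const (T : Type) (d : T) m (ss : seq (seq T)) i j :
  all (fun s => size s == m) ss -> (i < size ss)%N -> (j < m)%N ->
  nth d (flatten ss) (i * m + j) = nth d (nth [::] ss i) j.
Proof.
elim: ss i => //= s ss IH [|i] /andP[/eqP sm ssm] isz jm; rewrite nth_cat sm.
  by rewrite mul0n add0n jm.
by rewrite mulSn -addnA ltnNge leq_addr /= addKn IH.
Qed.

Lemma size_flatten_const (T : Type) m (ss : seq (seq T)) :
  all (fun s => size s == m) ss -> size (flatten ss) = (size ss * m)%N.
Proof. by elim: ss => //= s ss IH /andP[/eqP sm ssm]; rewrite size_cat sm IH ?mulSn. Qed.

Lemma map_enum_iota (U : Type) m (F : 'I_m -> U) (G : nat -> U) :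
  (forall i : 'I_m, G i = F i) -> [seq F i | i <- enum 'I_m] = [seq G i | i <- iota 0 m].
Proof.
by move=> GF; rewrite -val_enum_ord -map_comp; apply: eq_map => i /=; rewrite GF.
Qed.

Variable A : wautomaton.
Notation n := (wa_n A).
Notation k := (wa_k A).
Notation N := (n.+1).

Definition enc_vec (f : nat -> rat) : seq sym := flatten [seq enc_rat (f q) | q <- iota 0 n].
Definition enc_letters : seq sym :=
  flatten [seq flatten [seq enc_vec (ent (letter A a) p) | p <- iota 0 n] | a <- iota 0 k].
Definition enc_alpha : seq sym := enc_vec (ent (wa_alpha A) 0).
Definition enc_eta : seq sym := enc_vec (ent (wa_eta A) ^~ 0%N).

Lemma encodeE : encode A =
  bin n ++ Sep :: bin k ++ Sep :: enc_letters ++ enc_alpha ++ enc_eta.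
Proof.
rewrite /encode; do 2 ![congr (_ ++ _); congr (_ :: _)].
congr (_ ++ _ ++ _); congr flatten; apply: map_enum_iota => i.
- congr flatten; apply/esym/map_enum_iota => p; congr flatten; apply/esym/map_enum_iota => q.
  by rewrite /letter valK entE.
- by rewrite (entE (wa_alpha A) 0).
- by rewrite (entE (wa_eta A) i 0).
Qed.

Definition vec_fields (f : nat -> rat) : seq (int * int) := [seq frac (f q) | q <- iota 0 N].
Definition letter_fields (a : nat) : seq (int * int) :=
  flatten [seq vec_fields (aug_M A a p) | p <- iota 0 N].
Definition matrix_fields : seq (int * int) := flatten [seq letter_fields a | a <- iota 0 k].
Definition body_fields : seq (int * int) :=
  ((matrix_fields ++ vec_fields (aug_alpha A)) ++ vec_fields (aug_eta A 0)) ++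
  vec_fields (aug_eta A (-1)).

Lemma size_vec_fields f : size (vec_fields f) = N.
Proof. by rewrite size_map size_iota. Qed.

Lemma vec_fields_all (T : Type) (F : T -> nat -> rat) s :
  all (fun s => size s == N) [seq vec_fields (F p) | p <- s].
Proof. by elim: s => // p s IH; apply/andP; split=> //; rewrite size_vec_fields. Qed.

Lemma size_letter_fields a : size (letter_fields a) = (N ^ 2)%N.
Proof.
by rewrite (size_flatten_const (vec_fields_all _ _)) size_map size_iota.
Qed.

Lemma letter_fields_all s : all (fun s => size s == N ^ 2)%N [seq letter_fields a | a <- s].
Proof. by elim: s => // p s IH; apply/andP; split=> //; rewrite size_letter_fields. Qed.

Lemma size_matrix_fields : size matrix_fields = (k * N ^ 2)%N.
Proof. by rewrite (size_flatten_const (letter_fields_all _)) size_map size_iota. Qed.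

Lemma size_body_fields : size body_fields = n_entries k N.
Proof.
by rewrite /body_fields !size_cat !size_vec_fields size_matrix_fields /n_entries; lia.
Qed.

Lemma nth_vec_fields f q : (q < N)%N -> nth (0, 0) (vec_fields f) q = frac (f q).
Proof. by move=> qN; rewrite (nth_map 0%N) ?size_iota // nth_iota. Qed.

Lemma fields_matrix a p q : (a < k)%N -> (p < N)%N -> (q < N)%N ->
  fields body_fields (a * N ^ 2 + (p * N + q))%N = frac (aug_M A a p q).
Proof.
move=> ak pN qN; have pq : (p * N + q < N ^ 2)%N by nia.
have lt : (a * N ^ 2 + (p * N + q) < k * N ^ 2)%N by nia.
rewrite /fields /body_fields !nth_cat !size_cat size_matrix_fields !size_vec_fields.
rewrite lt !(leq_trans lt) ?leq_addr // -?addnA ?leq_addr //.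
rewrite (nth_flatten_const _ (letter_fields_all _)) ?size_map ?size_iota //.
rewrite (nth_map 0%N) ?size_iota // nth_iota // add0n.
rewrite (nth_flatten_const _ (vec_fields_all _ _)) ?size_map ?size_iota //.
by rewrite (nth_map 0%N) ?size_iota // nth_iota // add0n nth_vec_fields.
Qed.

Lemma fields_alpha q : (q < N)%N -> fields body_fields (k * N ^ 2 + q)%N = frac (aug_alpha A q).
Proof.
move=> qN; rewrite /fields /body_fields !nth_cat !size_cat size_matrix_fields !size_vec_fields.
rewrite ifT; [|lia]; rewrite ifT; [|lia]; rewrite ifF; [|lia].
by rewrite addKn nth_vec_fields.
Qed.

Lemma fields_eta1 q : (q < N)%N ->
  fields body_fields (k * N ^ 2 + N + q)%N = frac (aug_eta A 0 q).
Proof.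
move=> qN; rewrite /fields /body_fields !nth_cat !size_cat size_matrix_fields !size_vec_fields.
rewrite ifT; [|lia]; rewrite ifF; [|lia].
by rewrite addKn nth_vec_fields.
Qed.

Lemma fields_eta2 q : (q < N)%N ->
  fields body_fields (k * N ^ 2 + 2 * N + q)%N = frac (aug_eta A (-1) q).
Proof.
move=> qN; rewrite /fields /body_fields !nth_cat !size_cat size_matrix_fields !size_vec_fields.
rewrite ifF; [|lia].
by rewrite (_ : _ - _ = q)%N ?nth_vec_fields //; lia.
Qed.

Section Run.
Variables (x : seq sym) (W : nat).
Hypothesis xW : (size x <= W)%N.
Notation proc := (proc x W n k).

Lemma iotaN : iota 0 N = rcons (iota 0 n) n.
Proof. by rewrite -[N]addn1 iotaD cats1. Qed.

Lemma vec_fieldsE f : vec_fields f = [seq frac (f q) | q <- iota 0 n] ++ [:: frac (f n)].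
Proof. by rewrite /vec_fields iotaN map_rcons cats1. Qed.

Lemma proc_row f : proc parse_row (enc_vec f) [seq frac (f q) | q <- iota 0 n].
Proof.
rewrite -flatten_seq1; apply: (@proc_for x W n k xW 27 3 parse_entry n _ _ isT isT isT) => [s es|q _]; last exact: (proc_entry xW).
exact: env3 es.
Qed.

Lemma proc_vec c f g : (forall q, (q < n)%N -> g q = f q) ->
  proc c [::] [:: frac (g n)] -> proc (parse_vec c) (enc_vec f) (vec_fields g).
Proof.
move=> gf pc; rewrite vec_fieldsE -[enc_vec f]cats0; apply: (@proc_seq x W n k parse_row _ _ _ _ _ isT _ pc).
have -> : [seq frac (g q) | q <- iota 0 n] = [seq frac (f q) | q <- iota 0 n].
  by apply/eq_in_map => q; rewrite mem_iota => /andP[_ qn]; rewrite gf.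
exact: proc_row.
Qed.

Lemma proc_pad1 : proc (pad_with 2) [::] [:: frac 1].
Proof. by apply: (proc_pad_with xW) => // s; apply: env_one. Qed.

Lemma proc_letter a : proc parse_letter
  (flatten [seq enc_vec (ent (letter A a) p) | p <- iota 0 n]) (letter_fields a).
Proof.
rewrite /letter_fields iotaN map_rcons flatten_rcons.
rewrite -[flatten [seq enc_vec _ | _ <- _]]cats0.
apply: (@proc_seq x W n k (For 26 3 (parse_row;; pad)) _ _ _ _ _ isT).
  have -> : [seq vec_fields (aug_M A a p) | p <- iota 0 n] =
      [seq (fun p => [seq frac (ent (letter A a) p q) | q <- iota 0 n] ++ [:: (0, 1)]) p
        | p <- iota 0 n].
    apply/eq_in_map => p; rewrite mem_iota => /andP[_ pn]; rewrite vec_fieldsE; congr (_ ++ _).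
      by apply/eq_map => q; rewrite /aug_M pn.
    by rewrite /aug_M pn /ent; case: insub => // p'; rewrite insubN ?ltnn.
  have -> : [seq enc_vec (ent (letter A a) p) | p <- iota 0 n] =
     [seq (fun p => enc_vec (ent (letter A a) p) ++ [::]) p | p <- iota 0 n].
    by apply: eq_map => p; rewrite cats0.
  apply: (@proc_for x W n k xW 26 3 (parse_row;; pad) n _ _ isT isT isT) => [s es|p _]; first exact: env3 es.
  by apply: (@proc_seq x W n k parse_row _ _ _ _ _ isT); [apply: proc_row | apply: (proc_pad xW)].
rewrite vec_fieldsE {2}/aug_M ltnn eqxx.
have -> : [seq frac (aug_M A a n q) | q <- iota 0 n] =
    flatten [seq (fun=> [:: (0, 1)]) q | q <- iota 0 n].
  rewrite (flatten_seq1 (fun=> (0, 1))); apply/eq_in_map => q; rewrite mem_iota => /andP[_ qn].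
  by rewrite /aug_M ltnn ltn_eqF.
have e0 : @flatten sym [seq (fun=> [::]) q | q <- iota 0 n] = [::] by elim: iota.
rewrite -[[::]](cats0 (@nil sym)) -{1}e0.
apply: (@proc_seq x W n k (For 26 3 pad) _ _ _ _ _ isT); last exact: proc_pad1.
by apply: (@proc_for x W n k xW 26 3 pad n _ _ isT isT isT) => [s es|p _]; [apply: env3 es | apply: (proc_pad xW)].
Qed.

Lemma parse_bodyP s : env x W n k s -> reg s 18 = 0%N ->
  (forall N, arr N W (mem s 8) (fun=> 0)) -> (forall N, arr N W (mem s 9) (fun=> 0)) ->
  rest x s = enc_letters ++ enc_alpha ++ enc_eta ->
  ents W (sem parse_body s) body_fields.
Proof.
move=> es r18 h8 h9 Er.
pose c1 := For 21 4 parse_letter;; parse_vec (pad_with 2).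
pose s1 := sem c1 s; pose s2 := sem (Mov 17 16) s1; pose s3 := sem (parse_vec pad) s2.
pose s4 := sem (Mov 16 17) s3.
rewrite /parse_body -/c1 4!semS -/s1 -/s2 -/s3 -/s4.
have p1 : proc c1 (enc_letters ++ enc_alpha) (matrix_fields ++ vec_fields (aug_alpha A)).
  apply: (@proc_seq x W n k (For 21 4 parse_letter) _ _ _ _ _ isT).
    apply: (@proc_for x W n k xW 21 4 parse_letter k _ _ isT isT isT) => [t et|a _]; first exact: env4 et.
    exact: proc_letter.
  apply: proc_vec => [q qn|]; rewrite /aug_alpha ?qn // ltnn.
  exact: proc_pad1.
have hl : ents W s [::].
  by split=> // M; split; [apply: eq_arr (h8 M) | apply: eq_arr (h9 M)] => e _; rewrite /fields nth_nil.
rewrite catA in Er; have [l1 r1] := p1 s _ _ es hl Er.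
have es1 : env x W n k s1 by apply: env_sem es.
have es2 : env x W n k s2 by apply: (env_sem (c := Mov 17 16)) es1.
have es3 : env x W n k s3 by apply: (env_sem (c := parse_vec pad)) es2.
have es4 : env x W n k s4 by apply: (env_sem (c := Mov 16 17)) es3.
have l2 := @ents_reg W s1 _ 17 (reg s1 16) isT l1; rewrite -[set_reg _ _ _]/s2 in l2.
have r2 : rest x s2 = enc_eta ++ [::] by rewrite cats0 -r1; apply: (@rest_reg x s1 17 (reg s1 16) isT).
have p2 : proc (parse_vec pad) enc_eta (vec_fields (aug_eta A 0)).
  apply: proc_vec => [q qn|]; rewrite /aug_eta ?qn // ltnn; exact: (proc_pad xW).
have [l3 _] := p2 s2 _ _ es2 l2 r2.
have l4 := @ents_reg W s3 _ 16 (reg s3 17) isT l3; rewrite -[set_reg _ _ _]/s4 in l4.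
have r4 : rest x s4 = enc_eta ++ [::].
  by rewrite -r2 /rest [reg s4 16](@frame_reg (parse_vec pad) s2 17 isT).
have p3 : proc (parse_vec (pad_with 3)) enc_eta (vec_fields (aug_eta A (-1))).
  apply: proc_vec => [q qn|]; rewrite /aug_eta ?qn // ltnn.
  by apply: (proc_pad_with xW) => // t; apply: env_mone.
by have [l5 _] := p3 s4 _ _ es4 l4 r4; rewrite /body_fields.
Qed.

End Run.

End Entries.

(** * Size of the entries *)

Section Weight.
Local Open Scope ring_scope.

(* Bounds every entry after scaling by the common denominator. *)
Definition weight (l : seq (int * int)) : nat := \prod_(e <- l) (maxn `|e.1| 1 * `|e.2|)%N.

Lemma weight_cat l l' : weight (l ++ l') = (weight l * weight l')%N.
Proof. by rewrite /weight big_cat. Qed.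

Lemma bval_lt bs : (bval bs < 2 ^ size bs)%N.
Proof.
elim: bs => [|y bs IH]; first by rewrite /bval big_ord0.
by rewrite bval_cons /= expnS; case: y; rewrite /=; lia.
Qed.

Lemma bin_lt m : (m < 2 ^ size (bin m))%N.
Proof. by rewrite -{1}(bin_val m) bval_lt. Qed.

Lemma enc_int_le (z : int) : (`|z| < 2 ^ size (enc_int z))%N.
Proof.
case: z => m.
  have -> : size (enc_int m) = (size (bin m)).+1 by [].
  have -> : `|m%:Z|%N = m by [].
  by have := bin_lt m; rewrite expnS; lia.
have -> : size (enc_int (Negz m)) = (size (bin m.+1)).+1 by [].
have -> : `|Negz m|%N = m.+1 by [].
by have := bin_lt m.+1; rewrite expnS; lia.
Qed.

Lemma weight_frac q : (weight [:: frac q] <= 2 ^ size (enc_rat q))%N.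
Proof.
rewrite /weight big_seq1 /frac /= /enc_rat size_cat /= size_cat.
apply: (@leq_trans (2 ^ size (enc_int (numq q)) * 2 ^ size (enc_int (denq q)))%N).
  have := enc_int_le (numq q); have := enc_int_le (denq q) => h1 h2.
  by apply: leq_mul; [rewrite geq_max expn_gt0 (ltnW h2) | apply: ltnW].
by rewrite -expnD leq_exp2l // leq_add2l addn1 leqW // leqW.
Qed.

Lemma weight_flatten (T : eqType) (s : seq T) (F : T -> seq sym) G :
  (forall i, i \in s -> (weight (G i) <= 2 ^ size (F i))%N) ->
  (weight (flatten (map G s)) <= 2 ^ size (flatten (map F s)))%N.
Proof.
elim: s => [|i s IH] h; first by rewrite /weight big_nil.
rewrite /= weight_cat size_cat expnD leq_mul // ?h ?mem_head // IH // => j js.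
by rewrite h // inE js orbT.
Qed.

Variable A : wautomaton.
Notation n := (wa_n A).
Notation k := (wa_k A).
Notation N := (n.+1).

Lemma weight_vec f g : (forall q, (q < n)%N -> g q = f q) -> weight [:: frac (g n)] = 1%N ->
  (weight (vec_fields A g) <= 2 ^ size (enc_vec A f))%N.
Proof.
move=> gf w1; rewrite vec_fieldsE weight_cat w1 muln1 -flatten_seq1.
apply: weight_flatten => q; rewrite mem_iota => /andP[_ qn].
by rewrite gf // weight_frac.
Qed.

Lemma weight_matrix : (weight (matrix_fields A) <= 2 ^ size (enc_letters A))%N.
Proof.
apply: weight_flatten => a _; rewrite /letter_fields iotaN map_rcons flatten_rcons weight_cat.
rewrite -[X in (_ <= X)%N]muln1 leq_mul //.
  apply: weight_flatten => p; rewrite mem_iota => /andP[_ pn]; apply: weight_vec => [q qn|].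
    by rewrite /aug_M pn.
  rewrite /aug_M pn /ent; case: insub => [p'|]; rewrite ?insubN ?ltnn // /weight big_seq1 //.
rewrite vec_fieldsE {2}/aug_M ltnn eqxx weight_cat {2}/weight big_seq1 muln1.
rewrite /weight big_map big_seq big1 // => q; rewrite mem_iota => /andP[_ qn].
by rewrite /aug_M ltnn ltn_eqF.
Qed.

(** A fraction of the input has weight at most 2 to the length of its code, and the padding has
    weight 1. The factor 2 in the exponent pays for the final vector, which is encoded once and
    stored twice. *)
Lemma weight_body :
  (weight (body_fields A) <= 2 ^ (size (enc_letters A ++ enc_alpha A ++ enc_eta A) * 2))%N.
Proof.
rewrite /body_fields !weight_cat.
have h1 := weight_matrix.
have h2 : (weight (vec_fields A (aug_alpha A)) <= 2 ^ size (enc_alpha A))%N.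
  by apply: weight_vec => [q qn|]; rewrite /aug_alpha ?qn // ltnn /weight big_seq1.
have h3 z : `|numq z|%N = 1%N \/ z = 0 -> denq z = 1 ->
    (weight (vec_fields A (aug_eta A z)) <= 2 ^ size (enc_eta A))%N.
  move=> hz dz; apply: weight_vec => [q qn|]; first by rewrite /aug_eta qn.
  by rewrite /aug_eta ltnn /weight big_seq1 /= dz; case: hz => [->|->].
have h4 := h3 0 (or_intror erefl) erefl; have h5 := h3 (-1) (or_introl erefl) erefl.
apply: (leq_trans (leq_mul (leq_mul (leq_mul h1 h2) h4) h5)).
by rewrite -!expnD leq_exp2l // !size_cat; lia.
Qed.

Lemma body_den_gt0 e : e \in body_fields A -> 0 < e.2.
Proof.
have vec f : e \in vec_fields A f -> 0 < e.2 by case/mapP => q _ ->; apply: denq_gt0.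
rewrite /body_fields mem_cat => /orP[|he]; last exact: (vec _ he).
rewrite mem_cat => /orP[|he]; last exact: (vec _ he).
rewrite mem_cat => /orP[he|he]; last exact: (vec _ he).
by case/flatten_mapP: he => a _ /flatten_mapP[p _ he]; apply: (vec _ he).
Qed.

Definition num_at e := (fields (body_fields A) e).1.
Definition den_at e := (fields (body_fields A) e).2.
Notation E := (n_entries k N).
Definition common_den : int := \prod_(f < E) den_at f.
Definition entry : nat -> int := scaled E num_at den_at.

Lemma den_at_gt0 f : (f < E)%N -> 0 < den_at f.
Proof. by move=> fE; apply: body_den_gt0; apply: mem_nth; rewrite size_body_fields. Qed.

Lemma common_den_neq0 : common_den != 0.
Proof. by rewrite gt_eqF // prodr_gt0 // => f _; apply: den_at_gt0. Qed.

Lemma entryE e q : (e < E)%N -> fields (body_fields A) e = frac q ->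
  (entry e)%:~R = common_den%:~R * q :> rat.
Proof.
move=> eE Eq; rewrite /entry /scaled.
have -> : common_den = denq q * cofactor_prod den_at e E.
  rewrite /common_den /cofactor_prod (bigD1 (Ordinal eE)) //= {1}/den_at Eq.
  by congr (_ * _); apply: eq_bigl => f.
rewrite {1}/num_at Eq /= !intrM [RHS]mulrAC; congr (_ * _).
have d0 : (denq q)%:~R != 0 :> rat by rewrite intr_eq0 denq_neq0.
by rewrite -{3}[q]divq_num_den mulrC divfK.
Qed.

(** All factors of the weight are at least 1. The scaled entry keeps its own numerator and the other
    denominators, so it is bounded by a subproduct. *)
Lemma entry_le e : (e < E)%N -> `|entry e| <= (weight (body_fields A))%:Z.
Proof.
move=> eE; rewrite /entry /scaled /cofactor_prod -abszE lez_nat abszM /weight.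
rewrite (big_nth (0, 0)) size_body_fields big_mkord [leqRHS](bigD1 (Ordinal eE)) //=.
rewrite -/(fields _ _) -/(num_at e) -/(den_at e).
have dg f : (f < E)%N -> (0 < `|den_at f|)%N by move=> fE; rewrite absz_gt0 gt_eqF // den_at_gt0.
apply: leq_mul; first by have := dg e eE; nia.
rewrite (big_morph absz abszM absz1) [leqRHS](eq_bigl (fun f : 'I_E => f != e :> nat)) //.
by apply: leq_prod => f _; have := dg f (ltn_ord f); rewrite -/(fields _ _) -/(den_at f); nia.
Qed.

End Weight.

(** * Reading the input and deciding *)

(** All bits set is -1 in two's complement. For the word 1 a single bit suffices, because track 2 is
    initially clear. *)
Definition consts : cmd := Wr 2 1 true;; For 62 2 (Wr 3 62 true).
Definition read_nat (r : nat) : cmd := parse_nat;; unary;; Mov r 35.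
Definition header : cmd := consts;; read_nat 3;; read_nat 4.
Definition pointers : cmd :=
  Zero 23;; addw 23 11;; Mov 24 23;; addw 24 5;; Mov 25 24;; addw 25 5.
Definition decide : cmd := parse_body;; scale;; pointers;; main_loop.

Lemma wval_ones (m : nat -> bool) n : (forall a, a < n -> m a) -> (wval m 0 n).+1 = 2 ^ n.
Proof.
elim: n => [|n IH] mn; first by rewrite wval0.
by rewrite wvalS add0n mn // mul1n expnS -addSn IH => [|a an]; [lia | apply: mn; apply: ltnW].
Qed.

Lemma wval_unit (m : nat -> bool) n : 0 < n -> (forall a, a < n -> m a = (a == 0)) -> wval m 0 n = 1.
Proof.
move=> n0 mn; rewrite (@wval_bits m n [:: S1]) //.
  by rewrite bval_cons /bval big_ord0.
by move=> a an; rewrite mn //; case: a {an}.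
Qed.

Section Header.
Local Open Scope ring_scope.
Variables (x : seq sym) (W : nat).
Hypothesis (xW : (size x <= W)%N) (W0 : (0 < W)%N).

Lemma consts_env s : reg s 0 = size x -> reg s 1 = 0%N -> reg s 2 = W -> reg s 10 = 1%N ->
  (forall t, mem s t = mem (init_store x) t) -> env x W (reg s 3) (reg s 4) (sem consts s).
Proof.
move=> r0 r1 r2 r10 ms; pose s1 := sem (Wr 2 1 true) s; rewrite /consts semS -/s1.
have h3 : forall a, (a < W)%N -> mem (sem (For 62 2 (Wr 3 62 true)) s1) 3 a.
  rewrite -r2; apply: (@sem_For 62 2 (Wr 3 62 true) s1 (fun j s' => forall a, (a < j)%N -> mem s' 3 a)) => //.
  move=> j s' js ag e62 IH a; rewrite ltnS leq_eqVlt /= !updE eqxx updE e62.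
  by case: eqP => //= _; apply: IH.
have q r : r \notin [:: 62]%N -> reg (sem (For 62 2 (Wr 3 62 true)) s1) r = reg s r.
  by move=> h; rewrite frame_reg.
have m t : t \notin [:: 3]%N -> mem (sem (For 62 2 (Wr 3 62 true)) s1) t = mem s1 t.
  by move=> h; rewrite frame_mem.
split; rewrite ?q //.
- by move=> p; rewrite !m //= !updE /= !ms /=; case: nth.
- move=> e; rewrite ltnS leqn0 => /eqP ->; rewrite mul0n m // wval_unit // => a aW.
  rewrite /= !updE /= updE r1 ms /=; case: (a == 0%N) => //.
  by case: nth.
- move=> e; rewrite ltnS leqn0 => /eqP ->; rewrite mul0n.
  apply/eqP; rewrite eqz_mod_dvd opprK -(wval_ones h3) -[(wval _ _ _).+1]addn1 PoszD.
  exact: dvdzz.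
Qed.

Lemma env_set3 n k s v : env x W n k s -> env x W v k (set_reg s 3 v).
Proof. by case=> ? ? ? ? ? ? ? ? ?; split. Qed.

Lemma env_set4 n k s v : env x W n k s -> env x W n v (set_reg s 4 v).
Proof. by case=> ? ? ? ? ? ? ? ? ?; split. Qed.

Lemma read_natP n k r s v post : (r == 3%N) || (r == 4%N) -> env x W n k s ->
  rest x s = bin v ++ Sep :: post -> exists s1,
  [/\ sem (read_nat r) s = set_reg s1 r (if (v < size x)%N then v else 0%N),
      env x W n k s1 & rest x s1 = post].
Proof.
move=> r34 es Er; pose s1 := sem parse_nat s; pose s2 := sem unary s1.
have [r1 h1] := parse_natP xW es Er (bin_nosep v); rewrite -/s1 in r1 h1.
have es1 : env x W n k s1 by apply: env_sem es.
have es2 : env x W n k s2 by apply: env_sem es1.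
rewrite bin_val in h1.
have vW : (v < 2 ^ W)%N.
  apply: leq_trans (bin_lt v) _; rewrite leq_exp2l //.
  by have := congr1 size Er; rewrite size_drop size_cat; lia.
have h2 := unaryP xW es1 h1 vW.
exists s2; split=> //; first by rewrite /read_nat 2!semS -/s1 -/s2 -h2.
by rewrite -r1 /rest (@frame_reg unary s1 16 isT).
Qed.

Lemma headerP s n k post : reg s 0 = size x -> reg s 1 = 0%N -> reg s 2 = W -> reg s 10 = 1%N ->
  reg s 16 = 0%N -> (forall t, mem s t = mem (init_store x) t) ->
  x = bin n ++ Sep :: bin k ++ Sep :: post ->
  env x W (if (n < size x)%N then n else 0%N) (if (k < size x)%N then k else 0%N)
    (sem header s) /\ rest x (sem header s) = post.
Proof.
move=> r0 r1 r2 r10 r16 ms Ex; pose s1 := sem consts s; rewrite /header 2!semS -/s1.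
have es1 := consts_env r0 r1 r2 r10 ms; rewrite -/s1 in es1.
have rs1 : rest x s1 = x by rewrite /rest (@frame_reg consts s 16 isT) r16 drop0.
clearbody s1; rewrite [RHS]Ex in rs1.
have [s2 [-> es2 rs2]] := read_natP (r := 3) isT es1 rs1.
move/env_set3: es2 => /(_ (if (n < size x)%N then n else 0%N)) es2.
have rs2' : rest x (set_reg s2 3 (if (n < size x)%N then n else 0%N)) = bin k ++ Sep :: post by [].
move: (set_reg s2 3 _) es2 rs2' => s3 es3 rs3.
have [s4 [-> es4 rs4]] := read_natP (r := 4) isT es3 rs3.
by split; [apply: env_set4 es4 | ].
Qed.

End Header.

Section Decide.
Local Open Scope ring_scope.
Variables (B : wautomaton) (x : seq sym) (W : nat).
Hypothesis xW : (size x <= W)%N.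
Notation n := (wa_n B).
Notation k := (wa_k B).
Notation N := (n.+1).

Lemma pointersP s : reg s 2 = W -> reg s 5 = N -> reg s 11 = (k * N ^ 2)%N ->
  [/\ reg (sem pointers s) 23 = k * N ^ 2 * W, reg (sem pointers s) 24 = (k * N ^ 2 + N) * W &
    reg (sem pointers s) 25 = (k * N ^ 2 + 2 * N) * W]%N.
Proof.
move=> r2 r5 r11; pose s1 := sem (Zero 23) s; pose s2 := sem (addw 23 11) s1.
pose s3 := sem (Mov 24 23) s2; pose s4 := sem (addw 24 5) s3; pose s5 := sem (Mov 25 24) s4.
rewrite /pointers 5!semS -/s1 -/s2 -/s3 -/s4 -/s5.
have h23 : reg s2 23 = (k * N ^ 2 * W)%N.
  by rewrite addwP // [reg s1 11]r11 [reg s1 2]r2.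
have q5 : reg s3 5 = N := etrans (@frame_reg (addw 23 11) s1 5 isT) r5.
have q2 : reg s3 2 = W := etrans (@frame_reg (addw 23 11) s1 2 isT) r2.
have q24 : reg s3 24 = (k * N ^ 2 * W)%N by [].
have q23 : reg s3 23 = (k * N ^ 2 * W)%N by [].
clearbody s3.
have h24 : reg s4 24 = ((k * N ^ 2 + N) * W)%N by rewrite addwP // q24 q5 q2; lia.
have p5 : reg s5 5 = N := etrans (@frame_reg (addw 24 5) s3 5 isT) q5.
have p2 : reg s5 2 = W := etrans (@frame_reg (addw 24 5) s3 2 isT) q2.
have p23 : reg s5 23 = (k * N ^ 2 * W)%N := etrans (@frame_reg (addw 24 5) s3 23 isT) q23.
have p24 : reg s5 24 = ((k * N ^ 2 + N) * W)%N by [].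
have p25 : reg s5 25 = ((k * N ^ 2 + N) * W)%N by [].
clearbody s5; split.
- by rewrite (@frame_reg (addw 25 5) s5 23 isT).
- by rewrite (@frame_reg (addw 25 5) s5 24 isT).
- by rewrite addwP // p25 p5 p2; lia.
Qed.

Hypothesis W_large : forall i, (i < N * N)%N ->
  (k ^ i * (N * weight (body_fields B)) ^ (4 * i.+2) < 2 ^ W)%N.

Lemma decideP s : env x W n k s ->
  [/\ reg s 5 = N, reg s 6 = N ^ 2, reg s 7 = N ^ 3, reg s 8 = N ^ 4 & reg s 19 = N ^ 4 * W]%N ->
  reg s 9 = n_entries k N -> reg s 11 = (k * N ^ 2)%N -> reg s 15 = 0%N -> reg s 18 = 0%N ->
  (forall t, (t \in [:: 8; 9; 11])%N -> forall a, mem s t a = false) ->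
  rest x s = enc_letters B ++ enc_alpha B ++ enc_eta B ->
  reg (sem decide s) 15 = 0%N <-> is_IFA B.
Proof.
move=> es dims r9 r11 r15 r18 m0 Er.
have zero t M : (t \in [:: 8; 9; 11])%N -> arr M W (mem s t) (fun=> 0).
  by move=> tt e _; rewrite wval_zero // => a _; apply: m0.
pose s1 := sem parse_body s; pose s2 := sem scale s1; pose s3 := sem pointers s2.
rewrite /decide 3!semS -/s1 -/s2 -/s3.
have es1 : env x W n k s1 by apply: env_sem es.
have [_ h1] := parse_bodyP xW es r18 (fun M => zero 8%N M isT) (fun M => zero 9%N M isT) Er.
rewrite -/s1 in h1.
have f1 r : r \in [:: 5; 6; 7; 8; 9; 11; 15; 19]%N -> reg s1 r = reg s r.
  by move=> hr; apply: frame_reg; move: r hr; apply/allP.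
have m1 : mem s1 11 = mem s 11 := @frame_mem parse_body s 11 isT.
have z1 : arr (n_entries k N) W (mem s1 11) (fun=> 0) by rewrite m1; apply: zero.
clearbody s1.
have se1 : senv W (n_entries k N) (num_at B) (den_at B) s1.
  split; [exact: env1 es1 | exact: env2 es1 | by rewrite f1 | exact: env10 es1 | | |].
  - exact: (h1 (n_entries k N)).1.
  - exact: (h1 (n_entries k N)).2.
  - exact: env_one es1.
have h2 := scaleP se1 z1; rewrite -/s2 in h2.
have es2 : env x W n k s2 by apply: env_sem es1.
have f2 r : r \in [:: 5; 6; 7; 8; 9; 11; 15; 19]%N -> reg s2 r = reg s1 r.
  by move=> hr; apply: frame_reg; move: r hr; apply/allP.
clearbody s2.
have g r : r \in [:: 5; 6; 7; 8; 9; 11; 15; 19]%N -> reg s2 r = reg s r.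
  by move=> hr; rewrite f2 // f1.
have [d5 d6 d7 d8 d19] := dims.
have p5 : reg s2 5 = N by rewrite g.
have p11 : reg s2 11 = (k * N ^ 2)%N by rewrite g.
have ptrs := pointersP (env2 es2) p5 p11; rewrite -/s3 in ptrs.
have es3 : env x W n k s3 by apply: env_sem es2.
have m3 : mem s3 11 = mem s2 11 := @frame_mem pointers s2 11 isT.
have f3 r : r \in [:: 5; 6; 7; 8; 9; 11; 15; 19]%N -> reg s3 r = reg s2 r.
  by move=> hr; apply: frame_reg; move: r hr; apply/allP.
clearbody s3.
have g' r : r \in [:: 5; 6; 7; 8; 9; 11; 15; 19]%N -> reg s3 r = reg s r.
  by move=> hr; rewrite f3 // g.
have ms3 : menv W k N (entry B) s3.
  split.
  - by rewrite (env1 es3) (env2 es3) (env4 es3) (env10 es3).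
  - by rewrite !g' // d5 d6 d7 d8 d19.
  - exact: ptrs.
  - by rewrite m3.
  - exact: env_one es3.
have r15' : reg s3 15 = 0%N by rewrite g'.
have := main_loopP ms3 r15'; move: (reg _ 15) => flag Ef.
have lt3 i : (i < N)%N -> forall b, (b <= 2)%N -> (k * N ^ 2 + b * N + i < n_entries k N)%N.
  by move=> iN b b2; rewrite /n_entries; nia.
have ltM a p q : (a < k)%N -> (p < N)%N -> (q < N)%N -> (a * N ^ 2 + (p * N + q) < n_entries k N)%N.
  move=> ak pN qN; have : (p * N + q < N ^ 2)%N by nia.
  by rewrite /n_entries; nia.
have aE i : (i < N)%N -> (k * N ^ 2 + i < n_entries k N)%N.
  by move=> iN; have := lt3 i iN 0%N isT; rewrite mul0n addn0.
have e1E i : (i < N)%N -> (k * N ^ 2 + N + i < n_entries k N)%N.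
  by move=> iN; have := lt3 i iN 1%N isT; rewrite mul1n.
have gME a p q : (a < k)%N -> (p < N)%N -> (q < N)%N ->
    (mat_of N (entry B) a p q)%:~R = (common_den B)%:~R * aug_M B a p q :> rat.
  by move=> ak pN qN; apply: entryE; [apply: ltM | apply: fields_matrix].
have gAE q : (q < N)%N -> (init_vec k N (entry B) q)%:~R = (common_den B)%:~R * aug_alpha B q :> rat.
  by move=> qN; apply: entryE; [apply: aE | apply: fields_alpha].
have g1E q : (q < N)%N -> (eta1 k N (entry B) q)%:~R = (common_den B)%:~R * aug_eta B 0 q :> rat.
  by move=> qN; apply: entryE; [apply: e1E | apply: fields_eta1].
have g2E q : (q < N)%N -> (eta2 k N (entry B) q)%:~R = (common_den B)%:~R * aug_eta B (-1) q :> rat.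
  by move=> qN; apply: entryE; [apply: lt3 | apply: fields_eta2].
(* Nonzero multiples of [2 ^ W] are at least [2 ^ W] in absolute value, which [defect_le] and the
   choice of [W] exclude. *)
have key i : (i < N * N)%N ->
    (the_defect B (entry B) i == 0 %[mod (2 ^ W)%N%:Z])%Z = (the_defect B (entry B) i == 0).
  move=> iN.
  have le : `|the_defect B (entry B) i| < (2 ^ W)%N%:Z.
    apply: (@le_lt_trans _ _ (k ^ i * (N * weight (body_fields B)) ^ (4 * i.+2))%N%:Z).
      apply: defect_le => [a p q ak pN qN|q qN|q qN|q qN]; apply: entry_le.
      - exact: ltM.
      - exact: aE.
      - exact: e1E.
      - exact: lt3.
    by rewrite ltz_nat W_large.
  apply/idP/eqP => [|->]; last by rewrite eqxx.
  rewrite eqz_mod_dvd subr0 => /dvdzP[c Ec].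
  move: le; rewrite Ec normrM; have [->|c0] := eqVneq c 0; first by rewrite mul0r.
  have c1 : 1 <= `|c| by rewrite -gtz0_ge1 normr_gt0.
  by rewrite ltNge => /negP[]; rewrite ler_peMl.
rewrite -(defectP (common_den_neq0 B) gME gAE g1E g2E) -/(the_defect B (entry B)).
split=> [f0 i iN|d0].
  move/esym: Ef; rewrite f0 eqxx => /allP /(_ i); rewrite mem_iota add0n iN => /(_ isT).
  by rewrite key // => /eqP.
apply/eqP; rewrite Ef; apply/allP => i; rewrite mem_iota add0n => /andP[_ iN].
by rewrite key //; apply/eqP/d0.
Qed.

End Decide.

(** * The whole program *)

Definition start : cmd := Inc 10;; Mov 12 0;; Inc 12.
Definition add_entries : cmd := Mov 9 11;; For 60 5 (Inc 9);; For 60 5 (Inc 9);; For 60 5 (Inc 9).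
Definition dims : cmd :=
  (Mov 5 3;; Inc 5);; mul 6 5 5;; mul 7 6 5;; mul 8 7 5;; mul 11 6 4;; mul 19 8 2;; add_entries.
(** Register 12 receives the input length plus one, and three squarings turn it into the word size
    [W], its eighth power. *)
Definition prog : cmd :=
  start;; mul 13 12 12;; mul 14 13 13;; mul 2 14 14;; header;; dims;; decide.

Lemma size_flatten_ge (T : Type) (F : T -> seq sym) s :
  (forall i, 0 < size (F i)) -> size s <= size (flatten (map F s)).
Proof.
by move=> F0; elim: s => //= i s IH; rewrite size_cat; have := F0 i; lia.
Qed.

Lemma enc_rat_gt0 q : 0 < size (enc_rat q).
Proof. by rewrite size_cat addn_gt0 orbT. Qed.

Lemma size_enc_vec A f : wa_n A <= size (enc_vec A f).
Proof.
rewrite -{1}(size_iota 0 (wa_n A)); apply: size_flatten_ge => q; exact: enc_rat_gt0.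
Qed.

Lemma states_lt A : wa_n A < size (encode A).
Proof.
rewrite encodeE; have := size_enc_vec A (ent (wa_alpha A) 0); rewrite -/(enc_alpha A).
rewrite size_cat /= size_cat /= !size_cat; lia.
Qed.

Lemma letters_lt A : 0 < wa_n A -> wa_k A < size (encode A).
Proof.
move=> n0.
have h : wa_k A <= size (enc_letters A).
  rewrite -{1}(size_iota 0 (wa_k A)); apply: size_flatten_ge => a.
  apply: (leq_trans n0); rewrite -{1}(size_iota 0 (wa_n A)); apply: size_flatten_ge => p.
  exact: (leq_trans n0 (size_enc_vec _ _)).
by rewrite encodeE size_cat /= size_cat /= !size_cat; lia.
Qed.

(** By [k <= 2 ^ L], [n.+1 <= 2 ^ L] and [i < L * L] the exponent is at most [13 * L ^ 3 + 24 * L],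
    hence at most [19 * L.+1 ^ 3]. Since [19 < 2 ^ 5 <= L.+1 ^ 5], the eighth power exceeds it. *)
Lemma pow2_bound n k L i w : n < L -> k <= L -> i < n.+1 * n.+1 -> w <= 2 ^ (L * 2) ->
  k ^ i * (n.+1 * w) ^ (4 * i.+2) < 2 ^ (L.+1 ^ 8).
Proof.
move=> nL kL iN wL.
have L2 m : m <= L -> m <= 2 ^ L by move=> mL; apply: leq_trans mL (ltnW (ltn_expl _ _)).
have leX a b e : a <= b -> a ^ e <= b ^ e by case: e => // e ab; rewrite leq_exp2r.
have iL : i < L * L by apply: leq_trans iN _; apply: leq_mul.
apply: (@leq_ltn_trans (2 ^ (L * i + (L + L * 2) * (4 * i.+2)))).
  rewrite [leqRHS]expnD !(expnM 2); apply: leq_mul; first by apply/leX/L2.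
  by apply: leX; rewrite expnD; apply: leq_mul => //; apply: L2.
rewrite ltn_exp2l //.
have L0 : 0 < L by lia.
have q2 : 2 <= L.+1 by lia.
have h1 : L * i + (L + L * 2) * (4 * i.+2) <= 19 * L.+1 ^ 3.
  apply: (@leq_trans (13 * (L * (L * L)) + 24 * L)).
    have : L * i <= L * (L * L) by rewrite leq_mul2l (ltnW iL) orbT.
    lia.
  by rewrite !expnS expn0; nia.
apply: leq_ltn_trans h1 _; rewrite -[8]/(5 + 3) expnD ltn_mul2r expn_gt0 /=.
by apply: (@leq_trans (2 ^ 5)) => //; apply: leX.
Qed.

(** The whole program computes its own loop limits, so [cost_bound] does not apply to it as a whole.
    It applies to the stages, within which the limits are constant. The number 20 is a common bound
    for their nesting depths. *)
Definition stage_ok (R : seq nat) (c : cmd) : bool :=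
  [&& wf c, all (fun l => (l \notin modr c) && (l \in R)) (limits c) & depth c <= 20].

Lemma stage_cost B R c s : stage_ok R c -> all (fun l => reg s l <= B) R ->
  cost c s <= kappa c * B.+1 ^ 20.
Proof.
case/and3P => wc /allP lc d20 /allP hR; apply: leq_trans (@cost_bound B c s wc _) _.
  by move=> l /lc /andP[-> lR]; apply: hR.
by rewrite leq_mul2l leq_pexp2l // orbT.
Qed.

Lemma start_ok : stage_ok [::] start. Proof. by []. Qed.
Lemma header_ok : stage_ok [:: 0; 2] header. Proof. by vm_compute. Qed.
Lemma decide_ok : stage_ok [:: 0; 2; 3; 4; 5; 6; 7; 8; 9; 10; 11; 19] decide.
Proof. by vm_compute. Qed.
Lemma prog_in : cmd_in 70 20 prog && wf prog.
Proof. by vm_compute. Qed.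
Lemma prog_zero : 1 \notin modr prog.
Proof. by vm_compute. Qed.

Lemma cost_seq c d s E : cost c s <= kappa c * E -> cost d (sem c s) <= kappa d * E ->
  cost (c;; d) s <= kappa (c;; d) * E.
Proof. by move=> h1 h2; rewrite /= mulnDl leq_add. Qed.

Lemma mul_reg r a b s r' : r' \notin [:: 60; 61; r] -> reg (sem (mul r a b) s) r' = reg s r'.
Proof. by move=> h; rewrite frame_reg //; move: h; rewrite /= !inE; lia. Qed.

Lemma mul_mem r a b s t : mem (sem (mul r a b) s) t = mem s t.
Proof. by rewrite frame_mem. Qed.

Lemma add_entriesP s : reg (sem add_entries s) 9 = reg s 11 + 3 * reg s 5.
Proof.
have loop t : reg (sem (For 60 5 (Inc 9)) t) 9 = reg t 9 + reg t 5.
  apply: (@sem_For 60 5 (Inc 9) t (fun j t' => reg t' 9 = reg t 9 + j)) => //.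
    by rewrite addn0.
  by move=> j t' _ _ _ E; rewrite /= !updE /= E addnS.
have fr t : reg (sem (For 60 5 (Inc 9)) t) 5 = reg t 5 := @frame_reg (For 60 5 (Inc 9)) t 5 isT.
rewrite /add_entries 3!semS !loop !fr [reg (sem _ _) 9]/= [reg (sem (Mov _ _) _) 5]/= updE.
by rewrite !mulSn mul0n addn0 !addnA.
Qed.

Lemma dimsP s W n k B : reg s 2 = W -> reg s 3 = n -> reg s 4 = k ->
  n.+1 ^ 4 <= B -> W <= B -> k <= B ->
  [/\ [/\ reg (sem dims s) 5 = n.+1, reg (sem dims s) 6 = n.+1 ^ 2,
    reg (sem dims s) 7 = n.+1 ^ 3, reg (sem dims s) 8 = n.+1 ^ 4 &
    reg (sem dims s) 19 = n.+1 ^ 4 * W],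
   reg (sem dims s) 9 = n_entries k n.+1, reg (sem dims s) 11 = k * n.+1 ^ 2 &
   cost dims s <= kappa dims * B.+1 ^ 20].
Proof.
move=> r2 r3 r4 NB WB kB.
pose N := n.+1; rewrite -/N in NB *.
have NB' e : e <= 4 -> N ^ e <= B by move=> e4; apply: leq_trans NB; apply: leq_pexp2l.
pose s1 := sem (Mov 5 3;; Inc 5) s; pose s2 := sem (mul 6 5 5) s1.
pose s3 := sem (mul 7 6 5) s2; pose s4 := sem (mul 8 7 5) s3.
pose s5 := sem (mul 11 6 4) s4; pose s6 := sem (mul 19 8 2) s5.
have a5 : reg s1 5 = N by rewrite /N -r3.
have a2 : reg s1 2 = W by rewrite -r2.
have a4 : reg s1 4 = k by rewrite -r4.
have b6 : reg s2 6 = N ^ 2 by rewrite mulP // a5.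
have b r : r \in [:: 2; 4; 5] -> reg s2 r = reg s1 r by move=> h; apply: mul_reg; move: r h; apply/allP.
have c7 : reg s3 7 = N ^ 3 by rewrite mulP // (b 5) // b6 a5 [RHS]expnS mulnC.
have c r : r \in [:: 2; 4; 5; 6] -> reg s3 r = reg s2 r by move=> h; apply: mul_reg; move: r h; apply/allP.
have d8 : reg s4 8 = N ^ 4 by rewrite mulP // c7 (c 5) // (b 5) // a5 [RHS]expnS mulnC.
have d r : r \in [:: 2; 4; 5; 6; 7] -> reg s4 r = reg s3 r by move=> h; apply: mul_reg; move: r h; apply/allP.
have e6 : reg s4 6 = N ^ 2 by rewrite (d 6) // (c 6).
have e5 : reg s4 5 = N by rewrite (d 5) // (c 5) // (b 5).
have e4 : reg s4 4 = k by rewrite (d 4) // (c 4) // (b 4).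
have e2 : reg s4 2 = W by rewrite (d 2) // (c 2) // (b 2).
have e7 : reg s4 7 = N ^ 3 by rewrite d.
have f11 : reg s5 11 = k * N ^ 2 by rewrite mulP // e6 e4 mulnC.
have f r : r \in [:: 2; 5; 6; 7; 8] -> reg s5 r = reg s4 r by move=> h; apply: mul_reg; move: r h; apply/allP.
have g19 : reg s6 19 = N ^ 4 * W by rewrite mulP // (f 8) // (f 2) // d8 e2.
have g r : r \in [:: 5; 6; 7; 8; 11] -> reg s6 r = reg s5 r by move=> h; apply: mul_reg; move: r h; apply/allP.
have h r : r \in [:: 5; 6; 7; 8; 11; 19] -> reg (sem add_entries s6) r = reg s6 r.
  by move=> hr; apply: frame_reg; move: r hr; apply/allP.
have sE : sem dims s = sem add_entries s6 by [].
have ab5 : reg s2 5 = N by rewrite (b 5).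
have ac5 : reg s3 5 = N by rewrite (c 5) // (b 5).
have ac6 : reg s3 6 = N ^ 2 by rewrite (c 6).
have af8 : reg s5 8 = N ^ 4 by rewrite f.
have af2 : reg s5 2 = W by rewrite f.
have ag5 : reg s6 5 = N by rewrite g // f.
split; rewrite ?sE.
- split.
  + by rewrite (h 5).
  + by rewrite (h 6) // (g 6) // (f 6).
  + by rewrite (h 7) // (g 7) // (f 7).
  + by rewrite (h 8) // (g 8).
  + by rewrite (h 19).
- by rewrite add_entriesP ag5 (g 11) // f11.
- by rewrite (h 11) // (g 11).
have okm r a b' t : stage_ok [:: a; b'] (mul r a b') -> reg t a <= B -> reg t b' <= B ->
    cost (mul r a b') t <= kappa (mul r a b') * B.+1 ^ 20.
  by move=> ok ha hb; apply: (stage_cost ok); rewrite /= ha hb.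
have N1 : N <= B by rewrite -[N]expn1; apply: NB'.
rewrite /dims; apply: cost_seq; first by apply: (@stage_cost B [::]).
rewrite -/s1; apply: cost_seq; first by apply: okm => //; rewrite a5.
rewrite -/s2; apply: cost_seq; first by apply: okm => //; rewrite ?b6 ?ab5 // NB'.
rewrite -/s3; apply: cost_seq; first by apply: okm => //; rewrite ?c7 ?ac5 // NB'.
rewrite -/s4; apply: cost_seq; first by apply: okm => //; rewrite ?e6 ?e4 // NB'.
rewrite -/s5; apply: cost_seq; first by apply: okm => //; rewrite ?af8 ?af2 // NB'.
by apply: (@stage_cost B [:: 5]) => //=; rewrite ag5 N1.
Qed.

Lemma is_IFA_no_states A : wa_n A = 0 -> is_IFA A.
Proof.
case: A => n k M al et /= n0; subst n => w; left.
by rewrite /wa_L /= mxE big_ord0.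
Qed.

Lemma cubic_bound q : 2 <= q -> q ^ 3 + 3 * q <= q ^ 5.
Proof.
move=> q2; rewrite -[5]/(2 + 3) expnD.
have h1 : 4 <= q ^ 2 by rewrite -[4]/(2 ^ 2) leq_exp2r.
have h2 : q <= q ^ 3 by rewrite -{1}[q]expn1 leq_pexp2l // ltnW.
by move: (q ^ 2) (q ^ 3) h1 h2 => a b h1 h2; nia.
Qed.

Section Encoded.
Variable A : wautomaton.
Notation x := (encode A).
Notation L := (size (encode A)).

(* Without states the number of letters may exceed the length of the encoding,
   and then the letters carry no information. *)
Lemma normalize : exists B,
  [/\ wa_n B = wa_n A, wa_k B = (if wa_k A < L then wa_k A else 0), is_IFA B <-> is_IFA A &
   enc_letters B ++ enc_alpha B ++ enc_eta B = enc_letters A ++ enc_alpha A ++ enc_eta A].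
Proof.
case: ifP => kL; first by exists A.
have n0 : wa_n A = 0 by apply/eqP; move: kL; apply: contraFT => n0; apply: letters_lt; rewrite lt0n.
pose M (a : 'I_0) : 'M[rat]_(wa_n A) := 0%R.
exists (WAutomaton M (wa_alpha A) (wa_eta A)); split=> //.
  by split=> _; apply: is_IFA_no_states.
have e0 B : wa_n B = 0 -> enc_letters B = [::].
  by case: B => m l M' al et /= m0; subst m; rewrite /enc_letters /=; elim: iota.
by rewrite !e0.
Qed.

Lemma size_body : size (enc_letters A ++ enc_alpha A ++ enc_eta A) <= L.
Proof. by rewrite encodeE [leqRHS]size_cat /= [in leqRHS]size_cat /=; lia. Qed.

Lemma prog_reg1 : reg (sem prog (init_store x)) 1 = 0.
Proof. exact: (@frame_reg prog (init_store x) 1 prog_zero). Qed.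

Lemma progP : let s := sem prog (init_store x) in
  (reg s 15 = 0 <-> is_IFA A) /\
  (cost prog (init_store x) <= kappa prog * (L.+1 ^ 13) ^ 20).
Proof.
move=> s; pose q := L.+1; pose W := q ^ 8; pose s0 := init_store x.
have nL := states_lt A.
have q2 : 2 <= q by rewrite /q; lia.
have q0 : 0 < q by [].
have LW : L <= W by apply: leq_trans (leqnSn _) _; rewrite -/q -{1}[q]expn1 leq_pexp2l.
have W0 : 0 < W by rewrite expn_gt0.
(* The largest loop limit is the bit length [N ^ 4 * W] of a tensor, with [N <= q] and
   [W = q ^ 8]. *)
pose B := q ^ 12.
have qB e : e <= 12 -> q ^ e <= B by move=> e12; apply: leq_pexp2l.
have BE : B.+1 <= L.+1 ^ 13.
  have B0 : 0 < B by rewrite expn_gt0.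
  by rewrite -/q expnS -/B; nia.
pose s1 := sem start s0; pose s2 := sem (mul 13 12 12) s1; pose s3 := sem (mul 14 13 13) s2.
pose s4 := sem (mul 2 14 14) s3; pose s5 := sem header s4; pose s6 := sem dims s5.
have a12 : reg s1 12 = q by [].
have a r : r \in [:: 1; 3; 4; 15; 16; 18] -> reg s1 r = 0.
  move=> hr; have -> : reg s1 r = reg s0 r.
    by apply: frame_reg; move: r hr; apply/allP.
  by rewrite /=; case: eqP hr => // ->.
have b13 : reg s2 13 = q ^ 2 by rewrite mulP // a12.
have b r : r \in [:: 0; 1; 3; 4; 10; 15; 16; 18] -> reg s2 r = reg s1 r.
  by move=> h; apply: mul_reg; move: r h; apply/allP.
have c14 : reg s3 14 = q ^ 4 by rewrite mulP // b13 -expnD.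
have c r : r \in [:: 0; 1; 3; 4; 10; 15; 16; 18] -> reg s3 r = reg s2 r.
  by move=> h; apply: mul_reg; move: r h; apply/allP.
have d2 : reg s4 2 = W by rewrite mulP // c14 -expnD.
have d r : r \in [:: 0; 1; 3; 4; 10; 15; 16; 18] -> reg s4 r = reg s3 r.
  by move=> h; apply: mul_reg; move: r h; apply/allP.
have d' r : r \in [:: 0; 1; 3; 4; 10; 15; 16; 18] -> reg s4 r = reg s1 r.
  by move=> hr; rewrite d // c // b.
have m4 t : mem s4 t = mem s0 t by rewrite /s4 mul_mem /s3 mul_mem /s2 mul_mem.
have cost4 : forall c', cost c' s4 <= kappa c' * B.+1 ^ 20 ->
    cost (start;; mul 13 12 12;; mul 14 13 13;; mul 2 14 14;; c') s0 <=
    kappa (start;; mul 13 12 12;; mul 14 13 13;; mul 2 14 14;; c') * B.+1 ^ 20.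
  move=> c' h; apply: cost_seq; first exact: (stage_cost start_ok).
  rewrite -/s1; apply: cost_seq.
    by apply: (@stage_cost B [:: 12]) => //; rewrite all_seq1 a12 -[q in q <= _]expn1 qB.
  rewrite -/s2; apply: cost_seq.
    by apply: (@stage_cost B [:: 13]) => //; rewrite all_seq1 b13 qB.
  rewrite -/s3; apply: cost_seq => //.
  by apply: (@stage_cost B [:: 14]) => //; rewrite all_seq1 c14 qB.
have sE : s = sem decide s6.
  by rewrite /s /prog 6!semS -/s1 -/s2 -/s3 -/s4 -/s5 -/s6.
have f0 : reg s4 0 = L by rewrite d'.
have f1 : reg s4 1 = 0 by rewrite d' // a.
have f10 : reg s4 10 = 1 by rewrite d'.
have f16 : reg s4 16 = 0 by rewrite d' // a.
have f15 : reg s4 15 = 0 by rewrite d' // a.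
have f18 : reg s4 18 = 0 by rewrite d' // a.
clear a12 a b13 b c14 c d d'.
have [C [nC kC ifaC bodyC]] := normalize.
have [es rs] := headerP LW W0 f0 f1 d2 f10 f16 m4 (encodeE A).
rewrite -/s5 nL in es rs; rewrite -kC -nC in es; rewrite -bodyC in rs.
have kL : wa_k C <= L by rewrite kC; case: ifP => // /ltnW.
rewrite -nC in nL.
have g15 : reg s5 15 = 0 := etrans (@frame_reg header s4 15 isT) f15.
have g18 : reg s5 18 = 0 := etrans (@frame_reg header s4 18 isT) f18.
have gm t : t \in [:: 8; 9; 11] -> forall p, mem s5 t p = false.
  move=> tt p; rewrite (@frame_mem header); last by move: t tt; apply/allP.
  by rewrite m4 /=; case: nth => //; move: tt; rewrite !inE; case: t => [|[|t]].
have NB : (wa_n C).+1 ^ 4 <= B.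
  apply: leq_trans (qB 4 isT); rewrite leq_exp2r //; exact: leqW nL.
have WB : W <= B by apply: qB.
have kB : wa_k C <= B by apply: leq_trans (leqW kL) _; rewrite -/q -[q]expn1 qB.
have [dd r9 r11 dcost] := dimsP (env2 es) (env3 es) (env4 es) NB WB kB.
rewrite -/s6 in dd r9 r11.
have es6 : env x W (wa_n C) (wa_k C) s6.
  apply: env_sem es; by vm_compute.
have h15 : reg s6 15 = 0 := etrans (@frame_reg dims s5 15 isT) g15.
have h18 : reg s6 18 = 0 := etrans (@frame_reg dims s5 18 isT) g18.
have hm t : t \in [:: 8; 9; 11] -> forall p, mem s6 t p = false.
  by move=> tt p; rewrite (@frame_mem dims) ?gm.
have rs6 : rest x s6 = enc_letters C ++ enc_alpha C ++ enc_eta C.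
  by rewrite -rs /rest (@frame_reg dims s5 16 isT).
split.
  rewrite sE -ifaC; apply: (decideP LW _ es6 dd r9 r11 h15 h18 hm rs6) => i iN.
  apply: pow2_bound => //.
  apply: leq_trans (weight_body C) _; rewrite leq_exp2l // leq_mul2r.
  by rewrite bodyC size_body orbT.
apply: leq_trans (leq_mul (leqnn _) (_ : B.+1 ^ 20 <= _)); last by rewrite leq_exp2r.
rewrite /prog; apply: cost4; apply: cost_seq.
  by apply: (stage_cost header_ok); rewrite /= f0 d2 WB; rewrite (leq_trans LW WB).
rewrite -/s5; apply: cost_seq => //; rewrite -/s6.
apply: (stage_cost decide_ok).
have [d5 d6 d7 d8 d19] := dd.
have qn : (wa_n C).+1 <= q by apply: leqW.
have qn2 : (wa_n C).+1 ^ 2 <= q ^ 2 by rewrite leq_exp2r.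
have NL4 : (wa_n C).+1 ^ 4 * W <= B.
  by rewrite /W /B -[12]/(4 + 8) expnD leq_mul2r leq_exp2r // qn orbT.
have kN : wa_k C * (wa_n C).+1 ^ 2 <= q ^ 3 by rewrite [q ^ 3]expnS leq_mul // leqW.
have E3 : n_entries (wa_k C) (wa_n C).+1 <= B.
  apply: (@leq_trans (q ^ 5)); last exact: qB.
  have h1 : n_entries (wa_k C) (wa_n C).+1 <= q ^ 3 + 3 * q.
    by rewrite /n_entries leq_add // leq_mul2l qn.
  exact: leq_trans h1 (cubic_bound q2).
have t0 : L <= B := leq_trans LW WB.
have t5 : (wa_n C).+1 <= B := leq_trans qn (qB 1 isT).
have t6 : (wa_n C).+1 ^ 2 <= B := leq_trans qn2 (qB 2 isT).
have t7 : (wa_n C).+1 ^ 3 <= B := leq_trans (leq_pexp2l (ltn0Sn _) (isT : 3 <= 4)) NB.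
have t11 : wa_k C * (wa_n C).+1 ^ 2 <= B := leq_trans kN (qB 3 isT).
have t10 : 1 <= B := leq_trans q0 (qB 1 isT).
clearbody s6.
rewrite /= (env0 es6) (env2 es6) (env3 es6) (env4 es6) (env10 es6) d5 d6 d7 d8 d19 r9 r11.
by rewrite t0 WB (ltnW t5) kB t5 t6 t7 NB E3 t10 t11 NL4.
Qed.

End Encoded.

(** The running time is quadratic in the number of instructions, which is of order [L.+1 ^ 260] with
    [260 = 13 * 20]; one more factor [L.+1] accounts for the input, and [521 = 1 + 2 * 260]. *)
Lemma time_bound K L t : t <= K * (L.+1 ^ 13) ^ 20 ->
  t.+1 * (2 * (L.+1 + t.+1) + 4) + 1 + (L + L.+1) <= 11 * K.+1 ^ 2 * L.+1 ^ 521.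
Proof.
have hL : L + L.+1 <= 2 * L.+1 by lia.
have : 0 < L.+1 by [].
move: (L.+1) hL => q hL q0 tK.
have Q0 : 0 < (q ^ 13) ^ 20 by rewrite !expn_gt0 q0.
have tP : t.+1 <= K.+1 * (q ^ 13) ^ 20 by rewrite mulSn -add1n leq_add.
have -> : 11 * K.+1 ^ 2 * q ^ 521 = 11 * (q * (K.+1 * (q ^ 13) ^ 20 * (K.+1 * (q ^ 13) ^ 20))).
  rewrite -!expnM -[521]/(1 + 13 * 20 * 2) expnD expn1 expnM.
  by move: (q ^ (13 * 20)) => Q; rewrite -!mulnn; ring.
have P0 : 0 < K.+1 * (q ^ 13) ^ 20 by rewrite muln_gt0.
move: (K.+1 * _) tP P0 {tK Q0} => P tP P0.
have h1 : t.+1 * (2 * (q + t.+1) + 4) <= P * (2 * (q + P) + 4) by apply: leq_mul; lia.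
have h2 : P <= P * P by rewrite leq_pmulr.
have h3 : P * P <= q * (P * P) by rewrite leq_pmull.
have h4 : q <= q * (P * P) by rewrite leq_pmulr // muln_gt0 P0.
have h5 : P * q <= q * (P * P) by rewrite [P * q]mulnC leq_mul2l h2 orbT.
apply: (@leq_trans (P * (2 * (q + P) + 4) + 1 + 2 * q)); first by rewrite leq_add // leq_add2r.
by rewrite !mulnDr; lia.
Qed.

(* There is a Turing machine that, on the binary encoding of any Q-weighted
   automaton A, halts within a polynomial number of steps (in the encoding
   length) in the accepting state iff A is an IFA, and in the rejecting
   state otherwise. *)
Theorem theorem3 :
  exists (M : TM) (c d : nat),
    forall A : wautomaton,
      let x := encode A in
      let st := cf_state (tm_run M (c * (size x).+1 ^ d) x) in
      (is_IFA A -> st = tm_acc M) /\ (~ is_IFA A -> st = tm_rej M).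
Proof.
have /andP[prog_bounds prog_wf] := prog_in.
(* All registers are below 70 and all tracks below 20. The machine accepts if the answer in register
   15 equals register 1, which stays 0. *)
have [M MP] := @decider 70 20 prog 15 1 prog_wf prog_bounds isT isT.
exists M, (11 * (kappa prog).+1 ^ 2), 521 => A x st.
have [progA costA] := progP A.
have x0 : x <> [::] by move=> E; have := states_lt A; rewrite -/x E.
have := MP x _ x0 (time_bound costA).
rewrite -/st prog_reg1 => ->; move: (reg _ 15) progA => flag progA.
case: eqP => [f0|nf]; split=> // h; first by case: h; apply/progA.
by case: nf; apply/progA.
Qed.
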